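(* Let $f\colon\mathbb{R}^n\to\mathbb{R}\cup\{+\infty\}$ be a lower semi-continuous semi-algebraic function and let $S\subset\mathbb{R}^n$ be a closed semi-algebraic set such that $\mathrm{dom} f\cap S$ is nonempty and unbounded. Assume that the qualification condition $(\mathrm{QC})$ holds. Then the set of all optimal solutions of the problem of minimizing $f(x)$ subject to $x\in S$, i.e. $\{x^*\in S\mid f(x^* )=\inf_{x\in S}f(x)\}$, is nonempty and compact if and only if $$\Sigma(f,S)\neq\emptyset,\quad\min_{x\in\Sigma(f,S)}f(x)\le\min_{k\in K}\lambda_k,\quad\text{and}\quad\min_{x\in\Sigma(f,S)}f(x)<\min_{k\notin K}\lambda_k.$$
   Context: Conventions. $\inf\emptyset=+\infty$ (also for minima over empty sets); $k\notin K$ means $k\in\{1,\ldots,p\}\setminus K$. $\|\cdot\|$ is the Euclidean norm on $\mathbb{R}^n$; $\mathbb{B}_R$ and $\mathbb{S}_R$ are the closed ball and the sphere of radius $R>0$ centered at $0$. A subset of $\mathbb{R}^n$ is semi-algebraic if it is a finite union of sets, each defined by finitely many polynomial equalities and strict inequalities; a map is semi-algebraic if its graph is (for $f\colon\mathbb{R}^n\to\mathbb{R}\cup\{+\infty\}$ the graph is $\{(x,y)\in\mathbb{R}^n\times\mathbb{R}\mid y=f(x)\}$). $\mathrm{dom} f=\{x\mid f(x)<+\infty\}$, $\mathrm{epi} f=\{(x,\alpha)\in\mathbb{R}^n\times\mathbb{R}\mid f(x)\le\alpha\}$. Normals and subdifferentials. For $x\in S\subset\mathbb{R}^n$, the regular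 normal cone $\widehat N(x;S)$ is the set of $v$ with $\langle v,x'-x\rangle\le o(\|x'-x\|)$ as $x'\to x$, $x'\in S$. The limiting normal cone $N(x;S)$ is the set of $v$ for which there are $x_k\to x$, $x_k\in S$, and $v_k\to v$ with $v_k\in\widehat N(x_k;S)$. For $x\in\mathrm{dom} f$: $\partial f(x)=\{v\mid (v,-1)\in N((x,f(x));\mathrm{epi} f)\}$ and $\partial^\infty f(x)=\{v\mid (v,0)\in N((x,f(x));\mathrm{epi} f)\}$. $(\mathrm{QC})$: $\partial^\infty f(x)\cap(-N(x;S))=\{0\}$ for all $x\in\mathrm{dom} f\cap S$. Critical points: $\Sigma(f,S)=\{x\in\mathrm{dom} f\cap S\mid 0\in\partial f(x)+N(x;S)\}$; $f(\Sigma(f,S))$ is a finite subset of $\mathbb{R}$. Tangency variety: $\Gamma(f,S)=\{x\in\mathrm{dom} f\cap S\mid \exists\mu\in\mathbb{R}:\ 0\in\partial f(x)+N(x;S)+\mu x\}$ (a semi-algebraic set). Decomposition at infinity. Fix a finite partition of $\Gamma(f,S)$ into semi-algebraic sets $C_1,\ldots,C_\ell$ on each of which $f$ is continuous. By Hardt's triviality theorem applied to $x\mapsto\|x\|$ on $\Gamma(f,S)$, there are $R>0$, semi-algebraic sets $F_1,\ldots,F_\ell$ and a semi-algebraic homeomorphism $h\colon(\cup_i F_i)\times(R,+\infty)\to\Gamma(f,S)\setminus\mathbb{B}_R$ with $\|h(x,t)\|=t$ and $h(F_i\times(R,+\infty))=C_i\setminus\mathbb{B}_R$ for all $i$. Let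 $\Gamma_1,\ldots,\Gamma_p$ be the sets $h(F'\times(R,+\infty))$, with $F'$ running over the connected components of $F_1,\ldots,F_\ell$. Thus $\Gamma(f,S)\setminus\mathbb{B}_R$ is the disjoint union of the semi-algebraic sets $\Gamma_k$; each $\Gamma_k$ is connected and unbounded, $\Gamma_k\cap\mathbb{S}_t$ is nonempty and connected for each $t>R$, and $f|_{\Gamma_k}$ is continuous. $R$ may be increased to $R'$ by restricting $h$, i.e. replacing $\Gamma_k$ by $\Gamma_k\setminus\mathbb{B}_{R'}$. Under $(\mathrm{QC})$, for $R$ large enough $f$ is constant on each $\Gamma_k\cap\mathbb{S}_t$, $t>R$, so $f_k\colon(R,+\infty)\to\mathbb{R}$, $f_k(t):=f(x)$ for any $x\in\Gamma_k\cap\mathbb{S}_t$, is well defined; it is semi-algebraic and, for $R$ large enough, either constant or strictly monotone, hence $\lambda_k:=\lim_{t\to+\infty}f_k(t)\in\mathbb{R}\cup\{\pm\infty\}$ exists. $R$ is fixed sufficiently large (the claim is for all sufficiently large $R$). $K:=\{k\in\{1,\ldots,p\}\mid f_k\text{ is not constant}\}$. *)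

(* Defs.v *)
From HB Require Import structures.
From mathcomp Require Import all_boot all_order all_algebra.
From mathcomp Require Import all_classical all_reals all_analysis.
From mathcomp.multinomials Require mpoly.
Set Implicit Arguments.
Unset Strict Implicit.
Unset Printing Implicit Defensive.
Import Order.TTheory GRing.Theory Num.Theory.
Import numFieldNormedType.Exports.
Local Open Scope classical_set_scope.
Local Open Scope ring_scope.

(* The library norm on 'rV[R]_n is the sup norm.  It induces the usual topology
   and the usual bounded sets, so the library notions [closed], [compact],
   [connected], [bounded_set] and [-->] are used as they are; only the formulas
   that involve the value of the norm need the Euclidean one. *)
Definition dot (R : realType) (n : nat) (u v : 'rV[R]_n) : R :=
  \sum_(i < n) u 0 i * v 0 i.

Definition enorm (R : realType) (n : nat) (u : 'rV[R]_n) : R :=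
  Num.sqrt (dot u u).

Definition eball (R : realType) (n : nat) (r : R) : set 'rV[R]_n :=
  [set x | enorm x <= r].

Definition esphere (R : realType) (n : nat) (r : R) : set 'rV[R]_n :=
  [set x | enorm x = r].

(* A pair (P, Q) of lists of polynomials stands for the set of the x such that
   p(x) = 0 for p in P and q(x) > 0 for q in Q. *)
Definition basic_semialg (R : realType) (n : nat) (x : 'rV[R]_n)
    (c : seq (mpoly.mpoly n R) * seq (mpoly.mpoly n R)) : bool :=
  all (fun p => mpoly.meval (fun i => x 0 i) p == 0) c.1 &&
  all (fun q => 0 < mpoly.meval (fun i => x 0 i) q) c.2.

Definition semialgebraic (R : realType) (n : nat) (A : set 'rV[R]_n) : Prop :=
  exists s : seq (seq (mpoly.mpoly n R) * seq (mpoly.mpoly n R)),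
    A = [set x | has (basic_semialg x) s].

(* R^n x R is represented by 'rV[R]_(n + 1). *)
Definition rV_pair (R : realType) (n : nat) (x : 'rV[R]_n) (a : R) :
    'rV[R]_(n + 1) :=
  row_mx x a%:M.

Definition semialgebraic_efun (R : realType) (n : nat)
    (f : 'rV[R]_n -> \bar R) : Prop :=
  semialgebraic
    [set rV_pair z.1 z.2 | z in [set z : 'rV[R]_n * R | f z.1 = z.2%:E]].

Definition semialgebraic_map_on (R : realType) (m n : nat)
    (D : set ('rV[R]_m * R)) (h : 'rV[R]_m * R -> 'rV[R]_n) : Prop :=
  semialgebraic [set row_mx (rV_pair z.1 z.2) (h z) | z in D].

Definition edom (R : realType) (n : nat) (f : 'rV[R]_n -> \bar R) :
    set 'rV[R]_n :=
  [set x | (f x < +oo)%E].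

Definition epi (R : realType) (n : nat) (f : 'rV[R]_n -> \bar R) :
    set 'rV[R]_(n + 1) :=
  [set rV_pair z.1 z.2 | z in [set z : 'rV[R]_n * R | (f z.1 <= z.2%:E)%E]].

Definition regular_normal (R : realType) (n : nat) (S : set 'rV[R]_n)
    (x : 'rV[R]_n) : set 'rV[R]_n :=
  [set v | forall e : R, 0 < e ->
     \forall y \near within S (nbhs x), dot v (y - x) <= e * enorm (y - x)].

Definition limiting_normal (R : realType) (n : nat) (S : set 'rV[R]_n)
    (x : 'rV[R]_n) : set 'rV[R]_n :=
  [set v | exists (x_ v_ : nat -> 'rV[R]_n),
     [/\ x_ @ \oo --> x, v_ @ \oo --> v &
         forall k, S (x_ k) /\ regular_normal S (x_ k) (v_ k)]].

(* The two subdifferentials are only meant at points of [edom f] for an [f]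
   that never takes the value -oo, where [f x] is [(fine (f x))%:E]. *)
Definition subdiff (R : realType) (n : nat) (f : 'rV[R]_n -> \bar R)
    (x : 'rV[R]_n) : set 'rV[R]_n :=
  [set v | limiting_normal (epi f) (rV_pair x (fine (f x))) (rV_pair v (-1))].

Definition horizon_subdiff (R : realType) (n : nat) (f : 'rV[R]_n -> \bar R)
    (x : 'rV[R]_n) : set 'rV[R]_n :=
  [set v | limiting_normal (epi f) (rV_pair x (fine (f x))) (rV_pair v 0)].

Definition qualification (R : realType) (n : nat) (f : 'rV[R]_n -> \bar R)
    (S : set 'rV[R]_n) : Prop :=
  forall x, (edom f `&` S) x ->
    horizon_subdiff f x `&` [set - w | w in limiting_normal S x] = [set 0].

Definition critical (R : realType) (n : nat) (f : 'rV[R]_n -> \bar R)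
    (S : set 'rV[R]_n) : set 'rV[R]_n :=
  [set x | (edom f `&` S) x /\
     exists v w, [/\ subdiff f x v, limiting_normal S x w & 0 = v + w]].

Definition tangency (R : realType) (n : nat) (f : 'rV[R]_n -> \bar R)
    (S : set 'rV[R]_n) : set 'rV[R]_n :=
  [set x | (edom f `&` S) x /\
     exists (mu : R) v w,
       [/\ subdiff f x v, limiting_normal S x w & 0 = v + w + mu *: x]].

(* The conclusion of Hardt's theorem for [x |-> enorm x] on [G], above
   ]r0, +oo[, compatibly with the sets [C i]. *)
Record norm_trivialization (R : realType) (n m l : nat) (G : set 'rV[R]_n)
    (C : 'I_l -> set 'rV[R]_n) (F : 'I_l -> set 'rV[R]_m) (r0 : R)
    (h : 'rV[R]_m * R -> 'rV[R]_n) : Prop := NormTrivialization {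
  triv_fiber_semialg : forall i, semialgebraic (F i);
  triv_semialg :
    semialgebraic_map_on ((\bigcup_i F i) `*` `]r0, +oo[%classic) h;
  triv_bij :
    set_bij ((\bigcup_i F i) `*` `]r0, +oo[%classic) (G `\` @eball R n r0) h;
  triv_continuous :
    {within (\bigcup_i F i) `*` `]r0, +oo[%classic, continuous h};
  triv_inv_continuous :
    exists2 g : 'rV[R]_n -> 'rV[R]_m * R,
      {within G `\` @eball R n r0, continuous g} &
      {in (\bigcup_i F i) `*` `]r0, +oo[%classic, cancel h g};
  triv_norm : forall x t, (\bigcup_i F i) x -> r0 < t -> enorm (h (x, t)) = t;
  triv_pieces : forall i,
    h @` (F i `*` `]r0, +oo[%classic) = C i `\` @eball R n r0 }.

Definition components (R : realType) (m l : nat) (F : 'I_l -> set 'rV[R]_m) :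
    set (set 'rV[R]_m) :=
  [set D | exists i x, F i x /\ D = connected_component (F i) x].

(* [Gamma_k h (F' k) r] is the k-th piece of the tangency variety outside the
   ball of radius r. *)
Definition Gamma_k (R : realType) (n m : nat) (h : 'rV[R]_m * R -> 'rV[R]_n)
    (D : set 'rV[R]_m) (r : R) : set 'rV[R]_n :=
  h @` (D `*` `]r, +oo[%classic).

(* The value of [f] at a chosen point of [G] of norm t; it does not depend on
   the choice when [f] is constant on [G `&` esphere t]. *)
Definition sphere_value (R : realType) (n : nat) (f : 'rV[R]_n -> \bar R)
    (G : set 'rV[R]_n) (t : R) : \bar R :=
  f (get (G `&` @esphere R n t)).

Definition limit_value (R : realType) (n : nat) (f : 'rV[R]_n -> \bar R)
    (G : set 'rV[R]_n) : \bar R :=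
  lim (sphere_value f G t @[t --> +oo]).

Definition constant_beyond (R : realType) (g : R -> \bar R) (r : R) : Prop :=
  exists c, forall t, r < t -> g t = c.

Definition solutions (R : realType) (n : nat) (f : 'rV[R]_n -> \bar R)
    (S : set 'rV[R]_n) : set 'rV[R]_n :=
  [set x | S x /\ f x = ereal_inf (f @` S)].

(* Main.v *)
Require Import Defs.
From HB Require Import structures.
From mathcomp Require Import all_boot all_order all_algebra.
From mathcomp Require Import all_classical all_reals all_analysis.
From mathcomp.real_closed Require ordered_qelim polyrcf qe_rcf.
From mathcomp.multinomials Require mpoly.
From mathcomp Require Import ring lra.
Set Implicit Arguments.
Unset Strict Implicit.
Unset Printing Implicit Defensive.
Import Order.TTheory GRing.Theory Num.Theory.
Import numFieldNormedType.Exports.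
Local Open Scope classical_set_scope.
Local Open Scope ring_scope.

(** Why the theorem is true.  On a large sphere centred at the origin, a
    minimizer of [f] over the part of [S] on that sphere belongs to the
    tangency variety, so the behaviour at infinity of the infimum of [f] over
    [S] is read off the finitely many functions [f_k].  Suppose that the two
    inequalities hold.  If the infimum were smaller than the least critical
    value and not attained, minimizers on larger and larger spheres would take
    values at most [a], for some [a] smaller than every critical value, and
    some [f_k] would have a limit at most [a].  So the infimum is attained;
    every solution is critical, hence in the tangency variety, and if the
    solutions were unbounded some [f_k] would take the minimal value for
    arbitrarily large radii.  Such an [f_k] is eventually constant, which the
    strict inequality excludes.  Conversely, a solution is critical, every
    [f_k] stays above the minimum, and a constant [f_k] equal to the minimum
    would give an unbounded set of solutions.

    Three facts about [f] and [S] are used.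

    - Sard-type facts ([sphere_values_no_itv], [critical_values_finite]): the
      values of [f] at the tangency points of a given norm contain no interval,
      and there are finitely many critical values.

    - Transversality ([spheres_transverse]): on large spheres, no nonzero
      normal to the sphere belongs to the sum of the horizon subdifferential
      and of the normal cone of [S].

    - The multiplier rule ([multiplier_rule]), both for minimizers over [S]
      (which are critical) and for minimizers over [S] on a large sphere (which
      are tangency points by transversality).  It is proved by penalization and
      a limit.

    The first two come from one identity ([curve_identity]): along a definable
    curve equipped with definable normals, the normals annihilate the velocity.
    For regular normals this holds because the curve stays in the set on both
    sides of the point.  For limiting normals ([approx_normal_slope]) the
    curve is replaced near a parameter [s0] by a definable curve that stays
    within [(s - s0) ^+ 2] of it and carries regular normals within [s - s0]
    of the given ones; the derivative of a definable function has a limit, so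
    the velocity of the new curve tends to the velocity of the old one at [s0],
    and the orthogonality passes to the limit.

    The tame geometry is reduced to three facts: definable predicates are
    closed under quantifiers ([definable_exists], from quantifier elimination
    over real closed fields), a definable predicate on the line is constant
    between finitely many points ([definable_tame]), and definable choice
    ([definable_choice]).  Since an interval is uncountable, if countably many
    definable sets cover it, one of them contains a subinterval
    ([definable_cover]).  This makes pointwise statements uniform on a
    subinterval and gives differentiability ([definable_differentiable]).

    The functions [f_k] are studied as continuous selections of the definable
    family of sets of tangency values on spheres.  If [f_k] oscillated between
    two levels, by the intermediate value theorem every level in between would
    be a tangency value for arbitrarily large radii, hence for all large radii,
    and some sphere would have an interval of tangency values; so [f_k] has a
    limit ([selection_limit]).  Similar reasoning shows that it cannot return
    forever to the minimal value without being eventually equal to it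
    ([selection_ev_eq]). *)

(** * Semialgebraic predicates and elimination of quantifiers *)

Section Definable.
Context {R : realType}.

(** A finite list of coordinate functions is enough to speak of polynomials on
    a type; it makes products and rows of reals contexts for formulas without
    encoding them as one fixed type. *)
Class context (T : Type) := coordinates : seq (T -> R).

#[global] Instance context_real : context R := [:: id].
#[global] Instance context_row n : context 'rV[R]_n :=
  [seq (fun x : 'rV[R]_n => x 0 i) | i <- enum 'I_n].
#[global] Instance context_prod T U {c : context T} {d : context U} :
    context (T * U) :=
  [seq (fun p => x p.1) | x <- @coordinates T c] ++
  [seq (fun p => x p.2) | x <- @coordinates U d].

Definition nth_coord T {c : context T} i : T -> R :=
  nth (fun=> 0) (@coordinates T c) i.

Inductive pol T {c : context T} : (T -> R) -> Prop :=
| pol_cst a : pol (fun=> a)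
| pol_coord i : pol (nth_coord i)
| pol_add p q : pol p -> pol q -> pol (fun t => p t + q t)
| pol_mul p q : pol p -> pol q -> pol (fun t => p t * q t).

(** The semialgebraic predicates.  Taking only the quantifier-free ones as the
    definition makes substitution of polynomial maps immediate; closure under
    quantifiers is then a theorem. *)
Inductive definable T {c : context T} : (T -> Prop) -> Prop :=
| definable_eq0 p : pol p -> definable (fun t => p t = 0)
| definable_gt0 p : pol p -> definable (fun t => 0 < p t)
| definable_and A B :
    definable A -> definable B -> definable (fun t => A t /\ B t)
| definable_not A : definable A -> definable (fun t => ~ A t).

Lemma eq_pol T {c : context T} (p q : T -> R) : p =1 q -> pol p -> pol q.
Proof. by move=> /funext ->. Qed.

Lemma eq_definable T {c : context T} (A B : T -> Prop) :
  (forall t, A t <-> B t) -> definable A -> definable B.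
Proof. by move=> AB; have -> : A = B by apply: funext => t; apply: propext. Qed.

Lemma definable_or T {c : context T} (A B : T -> Prop) :
  definable A -> definable B -> definable (fun t => A t \/ B t).
Proof.
move=> dA dB; apply: (eq_definable (A := fun t => ~ (~ A t /\ ~ B t))).
  by move=> t; split; [move=> h; apply: contrapT; tauto|tauto].
by apply: definable_not; apply: definable_and; apply: definable_not.
Qed.

Lemma definable_imp T {c : context T} (A B : T -> Prop) :
  definable A -> definable B -> definable (fun t => A t -> B t).
Proof.
move=> dA dB; apply: (eq_definable (A := fun t => ~ (A t /\ ~ B t))).
  by move=> t; split; [move=> h a; apply: contrapT; tauto|tauto].
by apply: definable_not; apply: definable_and => //; apply: definable_not.
Qed.

Lemma definable_cst T {c : context T} (P : Prop) : definable (fun _ : T => P).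
Proof.
have dT : definable (fun _ : T => (0:R) = 0) by apply: (definable_eq0 (pol_cst _)).
have [p|np] := pselect P; first by apply: eq_definable dT.
by apply: eq_definable (definable_not dT) => t; split.
Qed.

Lemma pol_opp T {c : context T} (p : T -> R) :
  pol p -> pol (fun t => - p t).
Proof.
move=> pp; apply: (eq_pol (p := fun t => -1 * p t)).
  by move=> t; rewrite mulN1r.
by apply: pol_mul => //; apply: pol_cst.
Qed.

Lemma pol_exp T {c : context T} (p : T -> R) k :
  pol p -> pol (fun t => p t ^+ k).
Proof.
move=> pp; elim: k => [|k IH]; first exact: pol_cst.
by apply: (eq_pol _ (pol_mul pp IH)) => t; rewrite exprS.
Qed.

Lemma pol_sum T {c : context T} (I : Type) (s : seq I) (Q : pred I) (p : I -> T -> R) :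
  (forall i, pol (p i)) -> pol (fun t => \sum_(i <- s | Q i) p i t).
Proof.
move=> pp; elim: s => [|i s IH].
  by apply: eq_pol (pol_cst 0) => t; rewrite big_nil.
case Qi: (Q i); last by apply: eq_pol IH => t; rewrite big_cons Qi.
by apply: (eq_pol _ (pol_add (pp i) IH)) => t; rewrite big_cons Qi.
Qed.

Lemma pol_prod T {c : context T} (I : Type) (s : seq I) (Q : pred I) (p : I -> T -> R) :
  (forall i, pol (p i)) -> pol (fun t => \prod_(i <- s | Q i) p i t).
Proof.
move=> pp; elim: s => [|i s IH].
  by apply: eq_pol (pol_cst 1) => t; rewrite big_nil.
case Qi: (Q i); last by apply: eq_pol IH => t; rewrite big_cons Qi.
by apply: (eq_pol _ (pol_mul (pp i) IH)) => t; rewrite big_cons Qi.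
Qed.

Lemma definable_all T {c : context T} (I : Type) (s : seq I) (A : I -> T -> Prop) :
  (forall i, definable (A i)) ->
  definable (fun t => forall i, List.In i s -> A i t).
Proof.
move=> dA; elim: s => [|i s IH].
  by apply: eq_definable (definable_cst (c := c) True) => t; split.
apply: (eq_definable _ (definable_and (dA i) IH)) => t; split=> [[Ai As] j|h].
  by case=> [<-|/As].
by split; [apply: h; left|move=> j js; apply: h; right].
Qed.

Lemma definable_allI T {c : context T} (I : finType) (A : I -> T -> Prop) :
  (forall i, definable (A i)) -> definable (fun t => forall i, A i t).
Proof.
move=> dA; apply: eq_definable (definable_all (enum I) dA) => t.
split=> h i // ; apply: h.
have : i \in enum I by rewrite mem_enum.
by elim: (enum I) => //= j s IH; rewrite inE => /orP[/eqP->|/IH]; [left|right].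
Qed.

Let env T {c : context T} (t : T) : seq R := [seq x t | x <- @coordinates T c].

Let nth_env T {c : context T} (t : T) i : (env t)`_i = nth_coord i t.
Proof.
rewrite /env /nth_coord; have [lt|ge] := ltnP i (size (@coordinates T c)).
  by rewrite (nth_map (fun=> 0)).
by rewrite !nth_default ?size_map.
Qed.

Let pol_term T {c : context T} (p : T -> R) : pol p ->
  exists u : GRing.term R, forall t, p t = GRing.eval (env t) u.
Proof.
elim=> [a|i|q r _ [u qu] _ [v rv]|q r _ [u qu] _ [v rv]].
- by exists (GRing.Const a).
- by exists (GRing.Var _ i) => t /=; rewrite nth_env.
- by exists (GRing.Add u v) => t /=; rewrite qu rv.
- by exists (GRing.Mul u v) => t /=; rewrite qu rv.
Qed.

Let definable_formula T {c : context T} (A : T -> Prop) : definable A ->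
  exists phi : ordered_qelim.ord.formula R,
    forall t, A t <-> ordered_qelim.ord.holds (env t) phi.
Proof.
elim=> [p /pol_term[u pu]|p /pol_term[u pu]|P Q _ [u Pu] _ [v Qv]|P _ [u Pu]].
- exists (ordered_qelim.ord.Equal u (GRing.Const 0)) => t /=.
  by rewrite pu.
- exists (ordered_qelim.ord.Lt (GRing.Const 0) u) => t /=.
  by rewrite pu.
- exists (ordered_qelim.ord.And u v) => t /=; rewrite -Pu -Qv; tauto.
- exists (ordered_qelim.ord.Not u) => t /=; rewrite -Pu; tauto.
Qed.

Let rterm_pol T {c : context T} (u : GRing.term R) :
  GRing.rterm u -> pol (fun t : T => GRing.eval (env t) u).
Proof.
elim: u => //= [i|a|k|u IHu v IHv /andP[/IHu + /IHv]|u IHu /IHu|u IHu k /IHu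
  |u IHu v IHv /andP[/IHu + /IHv]|u IHu k /IHu].
- by move=> _; apply: (eq_pol _ (pol_coord (c := c) i)) => t; rewrite nth_env.
- by move=> _; apply: pol_cst.
- by move=> _; apply: pol_cst.
- exact: pol_add.
- exact: pol_opp.
- move=> pu; apply: (eq_pol _ (pol_mul (pol_cst k%:R) pu)) => t.
  by rewrite mulr_natl.
- exact: pol_mul.
- exact: pol_exp.
Qed.

Let qf_definable T {c : context T} (phi : ordered_qelim.ord.formula R) :
  ordered_qelim.ord.qf_form phi && ordered_qelim.ord.rformula phi ->
  definable (fun t : T => ordered_qelim.ord.qf_eval (env t) phi).
Proof.
have sub_pol u v : GRing.rterm u -> GRing.rterm v ->
    pol (fun t : T => GRing.eval (env t) v - GRing.eval (env t) u).
  by move=> ru rv; apply: pol_add; [|apply: pol_opp]; apply: rterm_pol.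
elim: phi => //=.
- by move=> b _; apply: definable_cst.
- move=> u v /andP[ru rv]; apply: (eq_definable _ (definable_eq0 (sub_pol _ _ ru rv))).
  by move=> t; split=> [/eqP|/eqP ->]; rewrite ?subrr // subr_eq0 eq_sym.
- move=> u v /andP[ru rv]; apply: (eq_definable _ (definable_gt0 (sub_pol _ _ ru rv))).
  by move=> t; rewrite subr_gt0.
- move=> u v /andP[ru rv].
  apply: (eq_definable _ (definable_not (definable_gt0 (sub_pol _ _ rv ru)))).
  by move=> t; rewrite subr_gt0; split=> [/negP|h]; rewrite -?leNgt //; apply/negP; rewrite -leNgt.
- move=> u IHu v IHv /andP[/andP[qu qv] /andP[ru rv]].
  apply: (eq_definable _ (definable_and (IHu _) (IHv _))); rewrite ?qu ?qv ?ru ?rv //.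
  by move=> t; split=> [[-> ->]|/andP[]].
- move=> u IHu v IHv /andP[/andP[qu qv] /andP[ru rv]].
  apply: (eq_definable _ (definable_or (IHu _) (IHv _))); rewrite ?qu ?qv ?ru ?rv //.
  by move=> t; split=> [/orP|/orP].
- move=> u IHu v IHv /andP[/andP[qu qv] /andP[ru rv]].
  apply: (eq_definable _ (definable_imp (IHu _) (IHv _))); rewrite ?qu ?qv ?ru ?rv //.
  by move=> t; split=> [/implyP|/implyP].
- move=> u IHu ruq; apply: (eq_definable _ (definable_not (IHu ruq))).
  by move=> t; split=> /negP.
Qed.

(** Tarski-Seidenberg.  The value of the new coordinate is appended to the
    list of the values of the coordinates, which is the environment in which a
    formula is evaluated. *)
Lemma definable_exists T {c : context T} (A : T -> R -> Prop) :
  definable (fun p : T * R => A p.1 p.2) -> definable (fun t => exists a, A t a).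
Proof.
move=> /definable_formula[phi Aphi].
pose k := size (@coordinates T c).
pose ex := ordered_qelim.ord.Exists k phi.
pose psi := ordered_qelim.ord.quantifier_elim (fun i bc => qe_rcf.qfr_to_formula (@qe_rcf.wproj R i bc))
  (ordered_qelim.ord.to_rform ex).
have rex := ordered_qelim.ord.to_rform_rformula ex.
have qpsi : ordered_qelim.ord.qf_form psi && ordered_qelim.ord.rformula psi.
  exact: (ordered_qelim.ord.quantifier_elim_wf (@qe_rcf.wf_QE_wproj R)).
apply: (eq_definable _ (qf_definable (c := c) qpsi)) => t.
have envE a : env (t, a) = set_nth 0 (env t) k a.
  have sk : size (env t) = k by rewrite size_map.
  rewrite set_nthE sk ltnn subnn /= /env map_cat -!map_comp /= cats1.
  by [].
have exP := ordered_qelim.ord.quantifier_elim_rformP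
  (@qe_rcf.wf_QE_wproj R) (@qe_rcf.valid_QE_wproj R) (env t) rex.
split=> [/exP/ordered_qelim.ord.to_rformP[a]|[a Ata]].
  by rewrite -envE => /(Aphi (t, a)); exists a.
apply/exP/ordered_qelim.ord.to_rformP; exists a.
by rewrite -envE; apply/(Aphi (t, a)).
Qed.

End Definable.

(** * Definable maps *)

Section DefinableMaps.
Context {R : realType}.

Definition pmap T U {c : context T} {d : context U} (F : T -> U) : Prop :=
  forall i, pol (R := R) (fun t => nth_coord (R := R) i (F t)).

Lemma nth_coord_pair T U {c : context T} {d : context U} i (p : T * U) :
  nth_coord (R := R) i p = if (i < size (@coordinates R T c))%N then nth_coord i p.1
  else nth_coord (i - size (@coordinates R T c)) p.2.
Proof.
rewrite /nth_coord nth_cat size_map; case: ifPn => [lt|].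
  by rewrite (nth_map (fun=> 0)).
rewrite -leqNgt => ge; have [lt|ge'] := ltnP (i - size (@coordinates R T c)) (size (@coordinates R U d)).
  by rewrite (nth_map (fun=> 0)).
by rewrite !nth_default ?size_map.
Qed.

Lemma nth_coord_row n (i : 'I_n) (x : 'rV[R]_n) : nth_coord (R := R) i x = x 0 i.
Proof.
rewrite /nth_coord (nth_map i) ?nth_ord_enum //.
by rewrite size_enum_ord.
Qed.

Lemma nth_coord_real i (x : R) : nth_coord i x = if i == 0%N then x else 0.
Proof. by case: i => [|[|i]]. Qed.

Lemma pmap_pair S T U {b : context S} {c : context T} {d : context U}
  (F : S -> T) (G : S -> U) : pmap F -> pmap G -> pmap (fun s => (F s, G s)).
Proof.
move=> pF pG i; case: (ltnP i (size (@coordinates R T c))) => lt.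
  apply: eq_pol (pF i) => s; rewrite nth_coord_pair lt //.
apply: eq_pol (pG (i - size (@coordinates R T c))%N) => s.
by rewrite nth_coord_pair ltnNge lt.
Qed.

Lemma pmap_fst S T U {b : context S} {c : context T} {d : context U}
  (F : S -> T * U) : pmap F -> pmap (fun s => (F s).1).
Proof.
move=> pF i; case: (ltnP i (size (@coordinates R T c))) => lt.
  by apply: eq_pol (pF i) => s; rewrite nth_coord_pair lt.
by apply: eq_pol (pol_cst 0) => s; rewrite /nth_coord nth_default.
Qed.

Lemma pmap_snd S T U {b : context S} {c : context T} {d : context U}
  (F : S -> T * U) : pmap F -> pmap (fun s => (F s).2).
Proof.
move=> pF i; apply: eq_pol (pF (size (@coordinates R T c) + i)%N) => s.
by rewrite nth_coord_pair ltnNge leq_addr /= addKn.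
Qed.

Lemma pmap_id T {c : context T} : pmap (fun t : T => t).
Proof. by move=> i; apply: pol_coord. Qed.

Lemma pmap_real T {c : context T} (g : T -> R) : pmap g <-> pol g.
Proof.
split=> [pg|pg i].
  by apply: eq_pol (pg 0%N) => t.
case: i => [|i]; first by apply: eq_pol pg.
by apply: eq_pol (pol_cst 0) => t; rewrite nth_coord_real.
Qed.

Lemma pol_comp T U {c : context T} {d : context U} (F : T -> U) (p : U -> R) :
  pmap F -> pol p -> pol (fun t => p (F t)).
Proof.
move=> pF; elim=> [a|i|q r _ qF _ rF|q r _ qF _ rF].
- exact: pol_cst.
- exact: pF.
- exact: pol_add.
- exact: pol_mul.
Qed.

Lemma definable_pcomp T U {c : context T} {d : context U} (F : T -> U)
  (A : U -> Prop) :
  pmap F -> definable A -> definable (fun t => A (F t)).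
Proof.
move=> pF; elim=> [p pp|p pp|B C _ BF _ CF|B _ BF].
- exact/(definable_eq0 (p := fun t => p (F t)))/pol_comp.
- exact/(definable_gt0 (p := fun t => p (F t)))/pol_comp.
- exact: definable_and.
- exact: definable_not.
Qed.

Definition dfun T {c : context T} (g : T -> R) : Prop :=
  definable (fun p : T * R => g p.1 = p.2).

Definition dmap T U {c : context T} {d : context U} (F : T -> U) : Prop :=
  forall i, dfun (fun t => nth_coord i (F t)).

Lemma eq_dfun T {c : context T} (g h : T -> R) : g =1 h -> dfun g -> dfun h.
Proof. by move=> /funext ->. Qed.

Lemma dfun_pol T {c : context T} (p : T -> R) : pol p -> dfun p.
Proof.
move=> pp; apply: (eq_definable (A := fun q => p q.1 - q.2 = 0)).
  by move=> q; split=> [/eqP|->]; rewrite ?subrr // subr_eq0 => /eqP.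
apply/definable_eq0/pol_add; last apply: pol_opp.
  exact: (pol_comp (pmap_fst (@pmap_id _ _)) pp).
by apply/pmap_real; apply: pmap_snd; apply: pmap_id.
Qed.

Lemma dfun_cst T {c : context T} a : dfun (fun=> a : R).
Proof. exact/dfun_pol/pol_cst. Qed.

Ltac pm := repeat first [apply: pmap_id | apply: pmap_pair | apply: pmap_fst
  | apply: pmap_snd].

(** The graph of a sum is described with one existential quantifier, over the
    value of the first summand. *)
Lemma dfun_add T {c : context T} (g h : T -> R) :
  dfun g -> dfun h -> dfun (fun t => g t + h t).
Proof.
move=> dg dh; apply: (eq_definable
  (A := fun p => exists a, g p.1 = a /\ h p.1 = p.2 - a)).
  move=> p; split=> [[a [<- ->]]|<-]; first by rewrite addrC subrK.
  by exists (g p.1); rewrite addrC addKr.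
apply: definable_exists; apply: definable_and.
  by apply: (definable_pcomp (F := fun p : T * R * R => (p.1.1, p.2)) _ dg); pm.
apply: (definable_pcomp (F := fun p : T * R * R => (p.1.1, p.1.2 - p.2)) _ dh).
apply: pmap_pair; first by pm.
by apply/pmap_real/pol_add; last apply: pol_opp; apply/pmap_real; pm.
Qed.

Lemma dfun_mul T {c : context T} (g h : T -> R) :
  dfun g -> dfun h -> dfun (fun t => g t * h t).
Proof.
move=> dg dh; apply: (eq_definable
  (A := fun p => exists a, g p.1 = a /\ exists b, h p.1 = b /\ a * b - p.2 = 0)).
  move=> p; split=> [[a [<- [b [<-]]]] /eqP|<-].
    by rewrite subr_eq0 => /eqP.
  by exists (g p.1); split=> //; exists (h p.1); rewrite subrr.
apply: definable_exists; apply: definable_and.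
  by apply: (definable_pcomp (F := fun p : T * R * R => (p.1.1, p.2)) _ dg); pm.
apply: definable_exists; apply: definable_and.
  by apply: (definable_pcomp (F := fun p : T * R * R * R => (p.1.1.1, p.2)) _ dh); pm.
apply/definable_eq0/pol_add; last apply: pol_opp.
  by apply: pol_mul; apply/pmap_real; pm.
by apply/pmap_real; pm.
Qed.

Lemma definable_dfun_eq0 T {c : context T} (g : T -> R) :
  dfun g -> definable (fun t => g t = 0).
Proof.
move=> dg; apply: (definable_pcomp (F := fun t => (t, 0)) _ dg).
by apply: pmap_pair; [pm|apply/pmap_real/pol_cst].
Qed.

Lemma definable_dfun_gt0 T {c : context T} (g : T -> R) :
  dfun g -> definable (fun t => 0 < g t).
Proof.
move=> dg; apply: (eq_definable (A := fun t => exists a, g t = a /\ 0 < a)).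
  by move=> t; split=> [[a [->]]|] //; exists (g t).
apply: definable_exists; apply: definable_and; first exact: dg.
by apply: definable_gt0; apply/pmap_real; pm.
Qed.

(** It is enough to substitute in the atoms, where this is closure of definable
    functions under sums and products. *)
Lemma definable_comp T U {c : context T} {d : context U} (F : T -> U)
  (A : U -> Prop) :
  definable A -> dmap F -> definable (fun t => A (F t)).
Proof.
move=> dA dF; elim: dA => [p pp|p pp|B C _ BF _ CF|B _ BF].
- apply: (definable_dfun_eq0 (g := fun t => p (F t))).
  elim: pp => *; [exact: dfun_cst|exact: dF|exact: dfun_add|exact: dfun_mul].
- apply: (definable_dfun_gt0 (g := fun t => p (F t))).
  elim: pp => *; [exact: dfun_cst|exact: dF|exact: dfun_add|exact: dfun_mul].
- exact: definable_and.
- exact: definable_not.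
Qed.

Lemma dfun_pcomp T U {c : context T} {d : context U} (F : T -> U) (g : U -> R) :
  pmap F -> dfun g -> dfun (fun t => g (F t)).
Proof.
move=> pF dg; apply: (definable_pcomp (F := fun p : T * R => (F p.1, p.2)) _ dg).
apply: pmap_pair; last by pm.
by move=> i; apply: (pol_comp (F := fst) _ (pF i)); pm.
Qed.

Lemma dmap_pcomp S T U {b : context S} {c : context T} {d : context U}
  (F : S -> T) (G : T -> U) : pmap F -> dmap G -> dmap (fun t => G (F t)).
Proof. by move=> pF dG i; apply: (dfun_pcomp pF (dG i)). Qed.

Lemma dmap_pmap T U {c : context T} {d : context U} (F : T -> U) :
  pmap F -> dmap F.
Proof. by move=> pF i; apply: dfun_pol. Qed.

Lemma dmap_pair S T U {b : context S} {c : context T} {d : context U}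
  (F : S -> T) (G : S -> U) : dmap F -> dmap G -> dmap (fun s => (F s, G s)).
Proof.
move=> pF pG i; case: (ltnP i (size (@coordinates R T c))) => lt.
  apply: eq_dfun (pF i) => s; rewrite nth_coord_pair lt //.
apply: eq_dfun (pG (i - size (@coordinates R T c))%N) => s.
by rewrite nth_coord_pair ltnNge lt.
Qed.

Lemma dmap_fst S T U {b : context S} {c : context T} {d : context U}
  (F : S -> T * U) : dmap F -> dmap (fun s => (F s).1).
Proof.
move=> pF i; case: (ltnP i (size (@coordinates R T c))) => lt.
  by apply: eq_dfun (pF i) => s; rewrite nth_coord_pair lt.
by apply: eq_dfun (dfun_cst 0) => s; rewrite /nth_coord nth_default.
Qed.

Lemma dmap_snd S T U {b : context S} {c : context T} {d : context U}
  (F : S -> T * U) : dmap F -> dmap (fun s => (F s).2).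
Proof.
move=> pF i; apply: eq_dfun (pF (size (@coordinates R T c) + i)%N) => s.
by rewrite nth_coord_pair ltnNge leq_addr /= addKn.
Qed.

Lemma dmap_id T {c : context T} : dmap (fun t : T => t).
Proof. exact/dmap_pmap/pmap_id. Qed.

Lemma dmap_dfun T {c : context T} (g : T -> R) : dmap g -> dfun g.
Proof. by move=> /(_ 0%N); apply: eq_dfun => t. Qed.

Lemma dfun_dmap T {c : context T} (g : T -> R) : dfun g -> dmap g.
Proof.
move=> pg [|i]; first by apply: eq_dfun pg.
by apply: eq_dfun (dfun_cst 0) => t; rewrite nth_coord_real.
Qed.

Lemma dmap_row T {c : context T} n (F : T -> 'rV[R]_n) :
  (forall i, dfun (fun t => F t 0 i)) -> dmap F.
Proof.
move=> dF i; have [lt|ge] := ltnP i n.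
  by apply: eq_dfun (dF (Ordinal lt)) => t; rewrite -nth_coord_row.
apply: eq_dfun (dfun_cst 0) => t.
by rewrite /nth_coord nth_default // size_map size_enum_ord.
Qed.

Lemma dfun_coord T {c : context T} n (F : T -> 'rV[R]_n) i :
  dmap F -> dfun (fun t => F t 0 i).
Proof. by move=> /(_ (i : nat)); apply: eq_dfun => t; rewrite nth_coord_row. Qed.

Lemma dmap_comp S T U {b : context S} {c : context T} {d : context U}
  (F : S -> T) (G : T -> U) : dmap G -> dmap F -> dmap (fun t => G (F t)).
Proof.
move=> dG dF i; apply: (definable_comp (F := fun p : S * R => (F p.1, p.2)) (dG i)).
apply: dmap_pair; last by apply: dmap_pmap; pm.
by apply: (dmap_pcomp (F := fst) _ dF); pm.
Qed.

Lemma dfun_comp T U {c : context T} {d : context U} (F : T -> U) (g : U -> R) :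
  dfun g -> dmap F -> dfun (fun t => g (F t)).
Proof. by move=> /dfun_dmap dg dF; apply: dmap_dfun; apply: dmap_comp dF. Qed.

Lemma dfun_opp T {c : context T} (g : T -> R) : dfun g -> dfun (fun t => - g t).
Proof.
move=> dg; apply: (eq_dfun _ (dfun_mul (dfun_cst (-1)) dg)) => t.
by rewrite mulN1r.
Qed.

Lemma dfun_exp T {c : context T} (g : T -> R) k : dfun g -> dfun (fun t => g t ^+ k).
Proof.
move=> dg; elim: k => [|k IH]; first exact: dfun_cst.
by apply: eq_dfun (dfun_mul dg IH) => t; rewrite exprS.
Qed.

Lemma dfun_sum T {c : context T} (I : Type) (s : seq I) (Q : pred I) (p : I -> T -> R) :
  (forall i, dfun (p i)) -> dfun (fun t => \sum_(i <- s | Q i) p i t).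
Proof.
move=> pp; elim: s => [|i s IH].
  by apply: eq_dfun (dfun_cst 0) => t; rewrite big_nil.
case Qi: (Q i); last by apply: eq_dfun IH => t; rewrite big_cons Qi.
by apply: (eq_dfun _ (dfun_add (pp i) IH)) => t; rewrite big_cons Qi.
Qed.

Lemma dfun_dot T {c : context T} n (F G : T -> 'rV[R]_n) :
  dmap F -> dmap G -> dfun (fun t => dot (F t) (G t)).
Proof.
by move=> dF dG; apply: dfun_sum => i; apply: dfun_mul; apply: dfun_coord.
Qed.

Lemma definable_eq T {c : context T} (g h : T -> R) :
  dfun g -> dfun h -> definable (fun t => g t = h t).
Proof.
move=> dg dh; apply: eq_definable (definable_dfun_eq0 (dfun_add dg (dfun_opp dh))).
by move=> t; split=> [/eqP|->]; rewrite ?subrr // subr_eq0 => /eqP.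
Qed.

Lemma definable_lt T {c : context T} (g h : T -> R) :
  dfun g -> dfun h -> definable (fun t => g t < h t).
Proof.
move=> dg dh; apply: eq_definable (definable_dfun_gt0 (dfun_add dh (dfun_opp dg))).
by move=> t; rewrite subr_gt0.
Qed.

Lemma definable_le T {c : context T} (g h : T -> R) :
  dfun g -> dfun h -> definable (fun t => g t <= h t).
Proof.
move=> dg dh; apply: eq_definable (definable_not (definable_lt dh dg)).
by move=> t; rewrite leNgt; split=> [/negP|/negP].
Qed.

Lemma definable_neq T {c : context T} (g h : T -> R) :
  dfun g -> dfun h -> definable (fun t => g t != h t).
Proof.
move=> dg dh; apply: eq_definable (definable_not (definable_eq dg dh)).
by move=> t; split=> [/eqP|/eqP].
Qed.

Lemma definable_eqV T {c : context T} n (F G : T -> 'rV[R]_n) :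
  dmap F -> dmap G -> definable (fun t => F t = G t).
Proof.
move=> dF dG; apply: (eq_definable (A := fun t => forall i, F t 0 i = G t 0 i)).
  by move=> t; split=> [h|-> //]; apply/rowP => i; apply: h.
by apply: definable_allI => i; apply: definable_eq; apply: dfun_coord.
Qed.

Lemma dfun_sqrt T {c : context T} (g : T -> R) : dfun g -> dfun (fun t => Num.sqrt (g t)).
Proof.
move=> dg; apply: (dfun_comp (g := @Num.sqrt R) (F := g)); last exact: dfun_dmap.
apply: (eq_definable (A := fun p => (0 <= p.1 /\ 0 <= p.2 /\ p.2 ^+ 2 = p.1)
   \/ (~ 0 <= p.1 /\ p.2 = 0))).
  move=> [x y] /=; split=> [[[_ [y0 <-]]|[/negP x0 ->]]|<-].
  - by rewrite sqrtr_sqr ger0_norm.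
  - by rewrite ler0_sqrtr // ltW // ltNge.
  have [x0|x0] := leP 0 x.
    by left; split=> //; rewrite sqrtr_ge0 sqr_sqrtr.
  by right; split=> //; rewrite ler0_sqrtr // ltW.
have d1 : dfun (fun p : R * R => p.1) by apply/dmap_dfun/dmap_pmap; pm.
have d2 : dfun (fun p : R * R => p.2) by apply/dmap_dfun/dmap_pmap; pm.
have d0 := @dfun_cst (R * R)%type _ 0.
apply: definable_or; apply: definable_and.
- exact: definable_le.
- by apply: definable_and; [exact: definable_le|apply: definable_eq => //; exact: dfun_exp].
- by apply: definable_not; exact: definable_le.
- exact: definable_eq.
Qed.

Lemma dfun_enorm T {c : context T} n (F : T -> 'rV[R]_n) :
  dmap F -> dfun (fun t => enorm (F t)).
Proof. by move=> dF; apply/dfun_sqrt/dfun_dot. Qed.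

Lemma dfun_norm T {c : context T} (g : T -> R) : dfun g -> dfun (fun t => `|g t|).
Proof.
move=> dg; apply: eq_dfun (dfun_sqrt (dfun_exp 2 dg)) => t.
by rewrite sqrtr_sqr.
Qed.

Lemma dmap_add T {c : context T} n (F G : T -> 'rV[R]_n) :
  dmap F -> dmap G -> dmap (fun t => F t + G t).
Proof.
move=> dF dG; apply: dmap_row => i.
apply: (eq_dfun (g := fun t => F t 0 i + G t 0 i)) => [t|]; first by rewrite mxE.
by apply: dfun_add; apply: dfun_coord.
Qed.

Lemma dmap_opp T {c : context T} n (F : T -> 'rV[R]_n) :
  dmap F -> dmap (fun t => - F t).
Proof.
move=> dF; apply: dmap_row => i.
apply: (eq_dfun (g := fun t => - F t 0 i)) => [t|]; first by rewrite mxE.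
by apply: dfun_opp; apply: dfun_coord.
Qed.

Lemma dmap_scale T {c : context T} n (g : T -> R) (F : T -> 'rV[R]_n) :
  dfun g -> dmap F -> dmap (fun t => g t *: F t).
Proof.
move=> dg dF; apply: dmap_row => i.
apply: (eq_dfun (g := fun t => g t * F t 0 i)) => [t|]; first by rewrite mxE.
by apply: dfun_mul => //; apply: dfun_coord.
Qed.

Lemma dmap_row_mx T {c : context T} m n (F : T -> 'rV[R]_m) (G : T -> 'rV[R]_n) :
  dmap F -> dmap G -> dmap (fun t => row_mx (F t) (G t)).
Proof.
move=> dF dG; apply: dmap_row => i.
case: (fintype.splitP i) => j ij.
  apply: eq_dfun (dfun_coord j dF) => t.
  by rewrite (_ : i = lshift n j) ?row_mxEl //; apply/val_inj.
apply: eq_dfun (dfun_coord j dG) => t.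
by rewrite (_ : i = rshift m j) ?row_mxEr //; apply/val_inj.
Qed.

Lemma dmap_cst T {c : context T} U {d : context U} (u : U) : dmap (fun _ : T => u).
Proof. by move=> i; apply: dfun_cst. Qed.

Lemma dmap_rV_pair T {c : context T} n (F : T -> 'rV[R]_n) (g : T -> R) :
  dmap F -> dfun g -> dmap (fun t => rV_pair (F t) (g t)).
Proof.
move=> dF dg; apply: dmap_row_mx => //; apply: dmap_row => i.
by apply: eq_dfun dg => t; rewrite ord1 mxE eqxx mulr1n.
Qed.

Lemma definable_forall T {c : context T} (A : T -> R -> Prop) :
  definable (fun p : T * R => A p.1 p.2) -> definable (fun t => forall a, A t a).
Proof.
move=> /definable_not dA.
apply: (eq_definable _ (definable_not (definable_exists (A := fun t a => ~ A t a) dA))).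
move=> t; split=> [h a|h [a]]; last by apply; apply: h.
by apply: contrapT => na; apply: h; exists a.
Qed.

(** One coordinate is quantified at a time. *)
Lemma definable_existsV n T {c : context T} (A : T -> 'rV[R]_n -> Prop) :
  definable (fun p : T * 'rV[R]_n => A p.1 p.2) ->
  definable (fun t => exists x, A t x).
Proof.
elim: n T c A => [|n IH] T c A dA.
  apply: (eq_definable (A := fun t => A t 0)).
    by move=> t; split=> [|[x]]; [exists 0|rewrite [x]thinmx0].
  apply: (definable_pcomp (F := fun t => (t, 0 : 'rV[R]_0)) _ dA).
  apply: pmap_pair; first by pm.
  by move=> i; apply: pol_cst.
apply: (eq_definable (A := fun t => exists a, exists x : 'rV[R]_n,
    A t (row_mx (a%:M : 'rV[R]_1) x))).
  move=> t; split=> [[a [x Ax]]|[x Ax]]; first by eexists; exact: Ax.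
  exists ((lsubmx (x : 'rV_(1 + n))) 0 0), (rsubmx (x : 'rV_(1 + n))).
  by rewrite -mx11_scalar hsubmxK.
apply: definable_exists; apply: IH.
apply: (definable_comp (F := fun p : T * R * 'rV[R]_n =>
  (p.1.1, row_mx (p.1.2%:M : 'rV[R]_1) p.2)) dA).
apply: dmap_pair; first by apply: dmap_pmap; pm.
apply: dmap_row_mx; last by apply: dmap_pmap; pm.
apply: dmap_row => i.
have d2 : dfun (fun p : T * R * 'rV[R]_n => p.1.2) by apply/dmap_dfun/dmap_pmap; pm.
by apply: eq_dfun d2 => t; rewrite ord1 mxE eqxx mulr1n.
Qed.

Lemma definable_forallV n T {c : context T} (A : T -> 'rV[R]_n -> Prop) :
  definable (fun p : T * 'rV[R]_n => A p.1 p.2) ->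
  definable (fun t => forall x, A t x).
Proof.
move=> /definable_not dA.
apply: (eq_definable _ (definable_not (definable_existsV (A := fun t a => ~ A t a) dA))).
move=> t; split=> [h a|h [a]]; last by apply; apply: h.
by apply: contrapT => na; apply: h; exists a.
Qed.

Lemma definable_andb T {c : context (R := R) T} (u v : T -> bool) :
  definable u -> definable v -> definable (fun t => u t && v t).
Proof.
move=> du dv; apply: eq_definable (definable_and du dv) => t.
by split=> [[-> ->]|/andP[]].
Qed.

Lemma definable_and3 T {c : context (R := R) T} (A B D : T -> Prop) :
  definable A -> definable B -> definable D ->
  definable (fun t => [/\ A t, B t & D t]).
Proof.
move=> dA dB dD; apply: eq_definable (definable_and dA (definable_and dB dD)) => t.
by split=> [[? []]|[]].
Qed.

Lemma definable_and4 T {c : context (R := R) T} (A B D E : T -> Prop) :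
  definable A -> definable B -> definable D -> definable E ->
  definable (fun t => [/\ A t, B t, D t & E t]).
Proof.
move=> dA dB dD dE.
apply: eq_definable (definable_and dA (definable_and3 dB dD dE)) => t.
by split=> [[? []]|[]].
Qed.

Lemma definable_exists2 T {c : context T} (A B : T -> R -> Prop) :
  definable (fun p : T * R => A p.1 p.2 /\ B p.1 p.2) ->
  definable (fun t => exists2 a, A t a & B t a).
Proof.
move=> dAB; apply: eq_definable (definable_exists (A := fun t a => A t a /\ B t a) dAB).
by move=> t; split=> [[a []]|[a]]; exists a.
Qed.

End DefinableMaps.

(** The case split on the head symbol prevents [dfun] and [dmap] from being
    unfolded, which would make the search loop.  The lemma [dmap_dfun] is used
    only on projections for the same reason. *)
Ltac definability1 := cbv beta; lazymatch goal with
  | |- definable _ => first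
    [ apply: definable_cst
    | apply: definable_and | apply: definable_or | apply: definable_imp
    | apply: definable_lt | apply: definable_le | apply: definable_eq
    | apply: definable_neq | apply: definable_eqV
    | apply: definable_andb | apply: definable_and3 | apply: definable_and4
    | apply: definable_not | apply: definable_exists2
    | apply: definable_exists | apply: definable_existsV
    | apply: definable_forall | apply: definable_forallV
    | (apply: definable_allI; intro) ]
  | |- dfun _ => first
    [ assumption | apply: dfun_cst | apply: dfun_add | apply: dfun_opp | apply: dfun_mul
    | apply: dfun_exp | apply: dfun_norm | apply: dfun_dot | apply: dfun_enorm
    | apply: dfun_coord
    | (apply: dmap_dfun; first [assumption | apply: dmap_id | apply: dmap_fst | apply: dmap_snd ]) ]
  | |- dmap _ => first
    [ assumption | apply: dmap_id | apply: dmap_fst | apply: dmap_snd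
    | apply: dmap_pair | apply: dmap_rV_pair | apply: dmap_scale
    | apply: dmap_add | apply: dmap_opp | apply: dmap_cst
    | apply: dfun_dmap ]
  end.
Ltac definability := repeat definability1.
Ltac definability_with tac := repeat first [tac | definability1].

(** * Tameness on the real line *)

Section Tame.
Context {R : realType}.
Implicit Types (A : R -> Prop) (a b c d x y : R) (s : seq R).

Lemma pol_horner (p : R -> R) : pol p -> exists q : {poly R}, forall x, p x = q.[x].
Proof.
elim=> [a|i|u v _ [q qu] _ [r rv]|u v _ [q qu] _ [r rv]].
- by exists a%:P => x; rewrite hornerC.
- have [->|i0] := eqVneq i 0%N; first by exists 'X => x; rewrite nth_coord_real hornerX.
  by exists 0 => x; rewrite nth_coord_real (negPf i0) horner0.
- by exists (q + r) => x; rewrite hornerD qu rv.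
- by exists (q * r) => x; rewrite hornerM qu rv.
Qed.

(** A polynomial keeps its sign between consecutive roots. *)
Lemma definable_tame A : definable A -> exists s : seq R, forall x y, x <= y ->
  (forall z, z \in s -> ~~ (x <= z <= y)) -> (A x <-> A y).
Proof.
have sgr_const (q : {poly R}) x y : x <= y -> q != 0 ->
    (forall z, z \in polyrcf.rootsR q -> ~~ (x <= z <= y)) ->
    Num.sg q.[x] = Num.sg q.[y].
  move=> xy q0 noroot; apply: (@polyrcf.polyrN0_itv _ `[x, y]).
  - move=> z; rewrite in_itv /= => zxy; apply/negP => rz.
    have /noroot : z \in polyrcf.rootsR q by rewrite -polyrcf.roots_on_rootsR.
    by rewrite zxy.
  - by rewrite in_itv /= lexx xy.
  - by rewrite in_itv /= lexx xy.
elim=> [p /pol_horner[q pq]|p /pol_horner[q pq]|B C _ [s Bs] _ [t Ct]|B _ [s Bs]].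
- exists (polyrcf.rootsR q) => x y xy noroot; rewrite !pq.
  have [->|q0] := eqVneq q 0; first by rewrite !horner0.
  have sxy := sgr_const q x y xy q0 noroot.
  by split=> /eqP; rewrite -sgr_eq0; [rewrite sxy|rewrite -sxy]; rewrite sgr_eq0 => /eqP.
- exists (polyrcf.rootsR q) => x y xy noroot; rewrite !pq.
  have [->|q0] := eqVneq q 0; first by rewrite !horner0.
  have sxy := sgr_const q x y xy q0 noroot.
  by rewrite -sgr_gt0 sxy sgr_gt0.
- exists (s ++ t) => x y xy st.
  rewrite (Bs x y) ?(Ct x y) // => z zs; apply: st; rewrite mem_cat zs ?orbT //.
- by exists s => x y xy st; rewrite (Bs x y).
Qed.

Lemma gap_right s a : exists2 b, a < b & forall z, z \in s -> ~~ (a < z < b).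
Proof.
elim: s => [|z s [b ab bs]]; first by exists (a + 1) => //; rewrite ltrDl.
have [az|za] := ltP a z; last first.
  exists b => // u; rewrite inE => /orP[/eqP ->|/bs //].
  by rewrite negb_and -leNgt za.
exists (Num.min b z); first by rewrite lt_min ab.
move=> u; rewrite inE lt_min => /orP[/eqP ->|/bs]; first by rewrite ltxx !andbF.
by apply: contra => /and3P[-> ->].
Qed.

Definition ev_right a A := exists2 b, a < b & forall x, a < x < b -> A x.
Definition ev_left a A := exists2 b, b < a & forall x, b < x < a -> A x.
Definition ev_pinfty A := exists b, forall x, b < x -> A x.

Lemma definable_right A a : definable A ->
  ev_right a A \/ ev_right a (fun x => ~ A x).
Proof.
move=> /definable_tame[s As]; have [b ab bs] := gap_right s a.
have eqA x y : a < x < b -> a < y < b -> (A x <-> A y).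
  wlog xy : x y / x <= y => [H xI yI|xI yI].
    have [xy|yx] := leP x y; first exact: H.
    by apply: iff_sym; apply: H => //; apply: ltW.
  apply: As => // z /bs; apply: contra => /andP[xz zy]; apply/andP; split; lra.
have mI : a < (a + b) / 2 < b by apply/andP; split; lra.
have [Am|nAm] := pselect (A ((a + b) / 2)).
  by left; exists b => // x xI; apply/(eqA x _ xI mI).
by right; exists b => // x xI; rewrite (eqA x _ xI mI).
Qed.

Lemma ev_leftN A a : ev_right (- a) (fun x => A (- x)) -> ev_left a A.
Proof.
move=> [b ab bA]; exists (- b); first by lra.
by move=> x xI; rewrite -[x]opprK; apply: bA; apply/andP; split; lra.
Qed.

Lemma definable_left A a : definable A ->
  ev_left a A \/ ev_left a (fun x => ~ A x).
Proof.
move=> dA; have dAN : definable (fun x => A (- x)).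
  by apply: definable_comp dA _; apply: dfun_dmap; definability.
by case: (definable_right (- a) dAN) => h; [left|right]; apply: ev_leftN.
Qed.

Lemma definable_pinfty A : definable A ->
  ev_pinfty A \/ ev_pinfty (fun x => ~ A x).
Proof.
move=> /definable_tame[s As].
have [b bs] : exists b, forall z, z \in s -> z <= b.
  elim: s {As} => [|z s [b bs]]; first by exists 0.
  exists (Num.max z b) => u; rewrite inE le_max => /orP[/eqP ->|/bs ->].
    by rewrite lexx.
  by rewrite orbT.
have eqA x y : b < x -> b < y -> (A x <-> A y).
  wlog xy : x y / x <= y => [H xI yI|xI yI].
    have [xy|yx] := leP x y; first exact: H.
    by apply: iff_sym; apply: H => //; apply: ltW.
  apply: As => // z /bs zb; rewrite negb_and -!ltNge; apply/orP; left; lra.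
have mI : b < b + 1 by lra.
have [Am|nAm] := pselect (A (b + 1)).
  by left; exists b => // x xI; apply/(eqA x _ xI mI).
by right; exists b => // x xI; rewrite (eqA x _ xI mI).
Qed.

Lemma ev_right_and A B a : ev_right a A -> ev_right a B ->
  ev_right a (fun x => A x /\ B x).
Proof.
move=> [b ab bA] [c ac cB]; exists (Num.min b c); first by rewrite lt_min ab.
by move=> x; rewrite lt_min => /and3P[ax xb xc]; split; [apply: bA|apply: cB]; rewrite ax.
Qed.

Lemma ev_left_and A B a : ev_left a A -> ev_left a B ->
  ev_left a (fun x => A x /\ B x).
Proof.
move=> [b ab bA] [c ac cB]; exists (Num.max b c); first by rewrite gt_max ab.
move=> x; rewrite gt_max -andbA => /and3P[bx cx xa].
by split; [apply: bA|apply: cB]; rewrite xa andbT.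
Qed.

Lemma ev_right_imp A B a : (forall x, a < x -> A x -> B x) ->
  ev_right a A -> ev_right a B.
Proof.
move=> AB [b ab bA]; exists b => // x xI; apply: AB; last exact: bA.
by case/andP: xI.
Qed.

Lemma ev_right_ex A a : ev_right a A -> exists2 x, a < x & A x.
Proof.
by move=> [b ab bA]; exists ((a + b) / 2); [lra|apply: bA; apply/andP; split; lra].
Qed.

Lemma ev_right_lt a b : a < b -> ev_right a (fun x => x < b).
Proof. by exists b => // x /andP[]. Qed.

Definition on_itv a b A := forall x, a < x < b -> A x.

Definition sub_itv c d a b := [/\ a <= c, c < d & d <= b].

Lemma sub_itv_trans c d c' d' a b : sub_itv c d c' d' -> sub_itv c' d' a b ->
  sub_itv c d a b.
Proof. by move=> [? ? ?] [? ? ?]; split=> //; lra. Qed.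

Lemma definable_itv A a b : definable A -> a < b ->
  exists c d, sub_itv c d a b /\ (on_itv c d A \/ on_itv c d (fun x => ~ A x)).
Proof.
move=> /(definable_right a)[] + ab => -[c ac cA]; exists a, (Num.min b c).
  have [bc|cb] := leP b c; (split; first by split=> //; lra); left => x /andP[? ?];
    by apply: cA; apply/andP; split; lra.
have [bc|cb] := leP b c; (split; first by split=> //; lra); right => x /andP[? ?];
  by apply: cA; apply/andP; split; lra.
Qed.

Lemma definable_finite_or_itv A : definable A ->
  (exists s, forall x, A x -> x \in s) \/
  exists c d, c < d /\ on_itv c d A.
Proof.
move=> /definable_tame[s As].
have [[x [Ax xs]]|nx] := pselect (exists x, A x /\ x \notin s).
  right; have [d xd ds] := gap_right s x.
  exists x, d; split=> // y /andP[xy yd]; apply/(As x y (ltW xy)) => // z zs.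
  apply/negP => /andP[xz zy]; have := ds z zs; rewrite negb_and -!leNgt => /orP[zx|]; last lra.
  by move: xs; rewrite (_ : x = z) ?zs //; apply/eqP; rewrite eq_le xz.
left; exists s => x Ax; apply: contrapT => /negP xs; apply: nx; exists x; split=> //.
Qed.

Lemma definable_finite_or_sub_itv A a b : definable A ->
  (exists s, forall x, a < x < b -> A x -> x \in s) \/
  exists c d, sub_itv c d a b /\ on_itv c d A.
Proof.
move=> dA.
have [|[s sA]|[c [d [cd cdA]]]] :=
    @definable_finite_or_itv (fun x => a < x /\ x < b /\ A x); first by definability.
  by left; exists s => x /andP[? ?] ?; apply: sA.
right; exists c, d; split; last by move=> x /cdA[_ []].
split=> //; rewrite leNgt; apply/negP => lt.
  pose x := (c + Num.min a d) / 2.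
  have m : c < Num.min a d by rewrite lt_min lt.
  have ma : Num.min a d <= a by rewrite ge_min lexx.
  have md : Num.min a d <= d by rewrite ge_min lexx orbT.
  have [] : a < x /\ x < b /\ A x by apply: cdA; rewrite /x; apply/andP; split; lra.
  by rewrite /x => + _; lra.
pose x := (d + Num.max b c) / 2.
have m : Num.max b c < d by rewrite gt_max lt.
have ma : b <= Num.max b c by rewrite le_max lexx.
have md : c <= Num.max b c by rewrite le_max lexx orbT.
have [] : a < x /\ x < b /\ A x by apply: cdA; rewrite /x; apply/andP; split; lra.
by rewrite /x => _ []; lra.
Qed.

(** Otherwise every set of the cover would meet the interval in a finite set,
    and the interval would be countable. *)
Lemma definable_cover (A_ : nat -> R -> Prop) a b : a < b ->
  (forall n, definable (A_ n)) -> on_itv a b (fun x => exists n, A_ n x) ->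
  exists n c d, sub_itv c d a b /\ on_itv c d (A_ n).
Proof.
move=> ab dA cov; apply: contrapT => noitv.
have fin n : {s : seq R | forall x, a < x < b -> A_ n x -> x \in s}.
  apply: cid; case: (definable_finite_or_sub_itv a b (dA n)) => // -[c [d cdA]].
  by exfalso; apply: noitv; exists n, c, d.
have : countable (`]a, b[%classic : set R).
  apply: (@sub_countable _ _ _ (\bigcup_n [set x | x \in projT1 (fin n)])).
    apply: subset_card_le => x /=; rewrite in_itv /= => xI.
    by have [n Anx] := cov x xI; exists n => //=; apply: (projT2 (fin n)).
  apply: bigcup_countable => // n _; apply: finite_set_countable.
  by apply/finite_seqP; exists (projT1 (fin n)).
move=> /countable_lebesgue_measure0 /eqP; rewrite lebesgue_measure_itv /= lte_fin ab.
by rewrite -EFinB eqe subr_eq0 gt_eqF.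
Qed.

End Tame.

(** * Definable choice *)

Section Choice.
Context {R : realType}.
Implicit Types (A : R -> Prop) (a b c d x y : R) (s : seq R).

Definition boundary A x := forall e, 0 < e -> exists y z,
  [/\ `|y - x| < e, `|z - x| < e, A y & ~ A z].

Lemma definable_boundary_finite A : definable A ->
  exists s, forall x, boundary A x -> x \in s.
Proof.
move=> /definable_tame[s As]; exists s => x bx; apply: contrapT => /negP xs.
have [b xb bs] := gap_right s x.
have [b' xb' bs'] := gap_right [seq - z | z <- s] (- x).
pose e := Num.min (b - x) (b' + x).
have e0 : 0 < e by rewrite lt_min; apply/andP; split; lra.
have eqA y : `|y - x| < e -> (A y <-> A x).
  rewrite lt_min => /andP[yb yb'].
  have yb2 : y - x < b - x by apply: le_lt_trans yb; apply: ler_norm.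
  have yb2' : x - y < b' + x by apply: le_lt_trans yb'; rewrite distrC; apply: ler_norm.
  have [xy|/ltW yx] := leP x y.
    apply: iff_sym; apply: As => // z zs; apply/negP => /andP[xz zy].
    have := bs z zs; rewrite negb_and -!leNgt => /orP[zx|]; last lra.
    by move: xs; rewrite (_ : x = z) ?zs //; apply/eqP; rewrite eq_le xz.
  apply: As => // z zs; apply/negP => /andP[xz zy].
  have := bs' (- z) (map_f _ zs); rewrite negb_and -!leNgt => /orP[zx|]; last lra.
  by move: xs; rewrite (_ : x = z) ?zs //; apply/eqP; rewrite eq_le zy andbT; lra.
have [y [z [/eqA yx /eqA zx Ay nAz]]] := bx e e0; tauto.
Qed.

Lemma not_boundary A x : ~ boundary A x ->
  exists2 e, 0 < e & forall y z, `|y - x| < e -> `|z - x| < e -> A y -> A z.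
Proof.
move=> nb; apply: contrapT => h; apply: nb => e e0; apply: contrapT => h'.
apply: h; exists e => // y z ye ze Ay; apply: contrapT => nAz; apply: h'.
by exists y, z.
Qed.

(** A supremum argument: the largest interval starting at [x] on which [A]
    holds cannot end at a point that is not on the boundary. *)
Lemma no_boundary_right A x y : x <= y -> A x ->
  (forall z, x <= z <= y -> ~ boundary A z) -> A y.
Proof.
move=> xy Ax nb.
pose E := [set z | x <= z <= y /\ forall w, x <= w <= z -> A w].
have Ex : E x.
  split; first by rewrite lexx.
  by move=> w; rewrite -eq_le => /eqP <-.
have supE : has_sup E by split; [exists x|exists y => z [/andP[]]].
have cI : x <= sup E <= y.
  rewrite ub_le_sup //=; last by exists y => z [/andP[]].
  by apply: ge_sup; [exists x|move=> z [/andP[]]].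
have [e e0 ce] := not_boundary (nb _ cI).
have [z Ez zc] := sup_adherent e0 supE.
have zs : z <= sup E by apply: ub_le_sup => //; exists y => u [/andP[]].
have Anear w : `|w - sup E| < e -> A w.
  move=> we; apply: (ce z w) => //; first by rewrite distrC ger0_norm; lra.
  by apply: Ez.2; case: Ez => /andP[-> _]; rewrite lexx.
pose u := Num.min (sup E + e / 2) y.
have uy : u <= y by rewrite ge_min lexx orbT.
have ue : u <= sup E + e / 2 by rewrite ge_min lexx.
have cu : sup E <= u by rewrite le_min; case/andP: cI => _ ->; rewrite andbT; lra.
have Eu : E u.
  split; first by apply/andP; split=> //; case/andP: cI => ? ?; lra.
  move=> w /andP[xw wu]; have [wz|zw] := leP w z; first by apply: Ez.2; rewrite xw.
  by apply: Anear; rewrite ltr_norml; apply/andP; split; lra.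
have us : u <= sup E by apply: ub_le_sup => //; exists y => v [/andP[]].
have -> : y = u.
  have [h|/ltW h] := leP (sup E + e / 2) y; last by rewrite /u min_r.
  by move: us; rewrite /u min_l //; lra.
by apply: Eu.2; case: Eu => /andP[-> _]; rewrite lexx.
Qed.

Lemma no_boundary_const A x y : A x ->
  (forall z, (x <= z <= y) || (y <= z <= x) -> ~ boundary A z) -> A y.
Proof.
move=> Ax nb; have [xy|/ltW yx] := leP x y.
  by apply: no_boundary_right xy Ax _ => z zI; apply: nb; rewrite zI.
apply: contrapT => nAy.
have : ~ A x; last by [].
apply: (no_boundary_right (A := fun x => ~ A x) yx nAy) => z zI bz.
apply: (nb z); first by rewrite zI orbT.
move=> e e0; have [u [v [ue ve nAu nnAv]]] := bz e e0.
by exists v, u; split=> //; apply: contrapT.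
Qed.

Lemma seq_max (P : R -> Prop) s : (exists2 x, x \in s & P x) ->
  exists m, [/\ m \in s, P m & forall x, x \in s -> P x -> x <= m].
Proof.
elim: s => [|z s IH] [x]; first by rewrite in_nil.
have [exs|nexs] := pselect (exists2 x, x \in s & P x).
  have [m [ms Pm mmax]] := IH exs => _ _.
  have [[Pz mz]|nz] := pselect (P z /\ m <= z).
    exists z; split=> // [|y]; first exact: mem_head.
    by rewrite inE => /orP[/eqP ->//|ys Py]; apply: le_trans mz; apply: mmax.
  exists m; split=> // [|y]; first by rewrite inE ms orbT.
  rewrite inE => /orP[/eqP -> Pz|]; last exact: mmax.
  by apply/ltW; rewrite ltNge; apply/negP => mz; apply: nz.
rewrite inE => /orP[/eqP -> Pz|xs Px]; last by exfalso; apply: nexs; exists x.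
exists z; split=> // [|y]; first exact: mem_head.
by rewrite inE => /orP[/eqP ->//|ys Py]; exfalso; apply: nexs; exists y.
Qed.

Lemma seq_min (P : R -> Prop) s : (exists2 x, x \in s & P x) ->
  exists m, [/\ m \in s, P m & forall x, x \in s -> P x -> m <= x].
Proof.
move=> [x xs Px].
have [|m [ms Pm mmax]] := @seq_max (fun x => P (- x)) [seq - z | z <- s].
  by exists (- x); rewrite ?opprK ?map_f.
exists (- m); split=> //.
  by case/mapP: ms => z zs ->; rewrite opprK.
move=> y ys Py; have := mmax (- y); rewrite opprK map_f // => /(_ isT Py); lra.
Qed.

(** Between two consecutive boundary points a definable set is full or empty.
    So a nonempty one contains a boundary point, the midpoint of two of them, a
    point at distance 1 from an extreme one, or 0 when there are none.  These
    points form a finite set, defined by a formula. *)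
Definition candidate A x := A x /\
  (x = 0 \/ (exists y, boundary A y /\ (x = y + 1 \/ x = y - 1)) \/
   (exists y z, boundary A y /\ boundary A z /\ x = (y + z) / 2)).

Lemma candidate_finite A : definable A ->
  exists s, forall x, candidate A x -> x \in s.
Proof.
move=> /definable_boundary_finite[s As].
exists (0 :: [seq y + 1 | y <- s] ++ [seq y - 1 | y <- s] ++
  [seq (y + z) / 2 | y <- s, z <- s]) => x [_].
rewrite inE !mem_cat; move=> [->|[[y [/As ys [->|->]]]|[y [z [/As ys [/As zs ->]]]]]].
- by rewrite eqxx.
- by rewrite (map_f (fun y => y + 1) ys) orbT.
- by rewrite (map_f (fun y => y - 1) ys) !orbT.
- by rewrite (allpairs_f (fun y z => (y + z) / 2) ys zs) !orbT.
Qed.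

Lemma candidate_exists A : definable A -> (exists x, A x) ->
  exists x, candidate A x.
Proof.
move=> dA [a Aa]; have [s bs] := definable_boundary_finite dA.
have [ba|nba] := pselect (boundary A a).
  exists a; split=> //; right; right; exists a, a; do 2!split => //; lra.
have [hasl|nl] := pselect (exists2 y, y \in s & boundary A y /\ y < a);
have [hasr|nr] := pselect (exists2 y, y \in s & boundary A y /\ a < y).
- have [l [_ [bl la] lmax]] := seq_max hasl.
  have [u [_ [bu au] umin]] := seq_min hasr.
  exists ((l + u) / 2); split; last by right; right; exists l, u.
  apply: (no_boundary_const Aa) => z zI bz.
  have [za|az|za] := ltgtP z a; last by apply: nba; rewrite -za.
    have := lmax z (bs z bz) (conj bz za); case/orP: zI => /andP[]; lra.
  have := umin z (bs z bz) (conj bz az); case/orP: zI => /andP[]; lra.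
- have [l [_ [bl la] lmax]] := seq_max hasl.
  exists (l + 1); split; last by right; left; exists l; split=> //; left.
  apply: (no_boundary_const Aa) => z zI bz.
  have [za|az|za] := ltgtP z a; last by apply: nba; rewrite -za.
    have := lmax z (bs z bz) (conj bz za); case/orP: zI => /andP[]; lra.
  by apply: nr; exists z => //; apply: bs.
- have [u [_ [bu au] umin]] := seq_min hasr.
  exists (u - 1); split; last by right; left; exists u; split=> //; right.
  apply: (no_boundary_const Aa) => z zI bz.
  have [za|az|za] := ltgtP z a; last by apply: nba; rewrite -za.
    by apply: nl; exists z => //; apply: bs.
  have := umin z (bs z bz) (conj bz az); case/orP: zI => /andP[]; lra.
- exists 0; split; last by left.
  apply: (no_boundary_const Aa) => z zI bz.
  have [za|az|za] := ltgtP z a; last by apply: nba; rewrite -za.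
    by apply: nl; exists z => //; apply: bs.
  by apply: nr; exists z => //; apply: bs.
Qed.

Definition least_candidate A x :=
  candidate A x /\ forall y, candidate A y -> x <= y.

Lemma least_candidate_exists A : definable A -> (exists x, A x) ->
  exists x, least_candidate A x.
Proof.
move=> dA /(candidate_exists dA)[x cx]; have [s cs] := candidate_finite dA.
have [|m [_ cm mmin]] := @seq_min (candidate A) s; first by exists x => //; apply: cs.
by exists m; split=> // y cy; apply: mmin => //; apply: cs.
Qed.

(** The selection is the least candidate. *)
Lemma definable_choice T {c : context T} (A : T -> R -> Prop) :
  definable (fun p : T * R => A p.1 p.2) ->
  exists2 g : T -> R, dfun g & forall t, (exists a, A t a) -> A t (g t).
Proof.
move=> dA.
have dAt U (b : context U) (F : U -> T) (g : U -> R) : dmap F -> dfun g ->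
    definable (fun u => A (F u) (g u)).
  move=> dF dg; apply: (definable_comp (F := fun u => (F u, g u)) dA).
  by apply: dmap_pair => //; apply: dfun_dmap.
pose g t := xget 0 [set a | least_candidate (A t) a].
have gP t : (exists a, A t a) -> least_candidate (A t) (g t).
  move=> /least_candidate_exists[|a la]; first by apply: dAt; definability.
  by rewrite /g; case: xgetP => // /(_ a).
exists g => [|t /gP[[]]//].
apply: (eq_definable (A := fun p => least_candidate (A p.1) p.2 \/
   (~ (exists a, A p.1 a)) /\ p.2 = 0)).
  move=> [t a] /=; split=> [[la|[nex ->]]|<-].
  - have [c1 m1] := gP t (ex_intro _ a la.1.1); have [c2 m2] := la.
    by apply/eqP; rewrite eq_le m1 // m2.
  - rewrite /g; case: xgetP => // y _ [[Ay _] _]; exfalso; apply: nex; by exists y.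
  - have [/gP|nex] := pselect (exists a, A t a); first by left.
    right; split=> //; rewrite /g; case: xgetP => // y _ [[Ay _] _].
    by exfalso; apply: nex; exists y.
have dbd U (b : context U) (F : U -> T) (h : U -> R) : dmap F -> dfun h ->
    definable (fun u => boundary (A (F u)) (h u)).
  move=> dF dh; apply: (definable_comp (A := fun p : T * R => boundary (A p.1) p.2)
    (F := fun u => (F u, h u))); last by apply: dmap_pair => //; apply: dfun_dmap.
  apply: (eq_definable (A := fun p : T * R => forall e, 0 < e -> exists y z,
    `|y - p.2| < e /\ `|z - p.2| < e /\ A p.1 y /\ ~ A p.1 z)).
    move=> p; split=> h' e e0; have [y [z]] := h' e e0.
      by move=> [? [? [? ?]]]; exists y, z; split.
    by move=> [? ? ? ?]; exists y, z; split.
  by definability_with ltac:(apply: dAt).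
have dcand U (b : context U) (F : U -> T) (h : U -> R) : dmap F -> dfun h ->
    definable (fun u => candidate (A (F u)) (h u)).
  move=> dF dh; apply: (definable_comp (A := fun p : T * R => candidate (A p.1) p.2)
    (F := fun u => (F u, h u))); last by apply: dmap_pair => //; apply: dfun_dmap.
  by definability_with ltac:(first [apply: dAt|apply: dbd]).
by definability_with ltac:(first [apply: dAt|apply: dcand]).
Qed.

(** One coordinate is chosen at a time, with the previous ones as parameters. *)
Lemma definable_choiceV n T {c : context T} (A : T -> 'rV[R]_n -> Prop) :
  definable (fun p : T * 'rV[R]_n => A p.1 p.2) ->
  exists2 G : T -> 'rV[R]_n, dmap G & forall t, (exists v, A t v) -> A t (G t).
Proof.
elim: n T c A => [|n IH] T c A dA.
  exists (fun=> 0) => [|t [x]]; first exact: dmap_cst.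
  by rewrite [x]thinmx0.
have rowE (v : 'rV[R]_(1 + n)) : exists a (w : 'rV[R]_n), v = row_mx (a%:M : 'rV[R]_1) w.
  by exists (lsubmx v 0 0), (rsubmx v); rewrite -mx11_scalar hsubmxK.
have drow U (b : context U) (F : U -> R) (G : U -> 'rV[R]_n) : dfun F -> dmap G ->
    dmap (fun u => row_mx ((F u)%:M : 'rV[R]_1) (G u) : 'rV[R]_n.+1).
  move=> dF dG; apply: dmap_row_mx => //; apply: dmap_row => i.
  by apply: eq_dfun dF => t; rewrite ord1 mxE eqxx mulr1n.
have dA' : definable (fun p : T * R * 'rV[R]_n =>
    A p.1.1 (row_mx (p.1.2%:M : 'rV[R]_1) p.2)).
  apply: (definable_comp (F := fun p : T * R * 'rV[R]_n => (p.1.1,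
    row_mx (p.1.2%:M : 'rV[R]_1) p.2)) dA).
  by apply: dmap_pair; [|apply: drow]; definability.
pose B (p : T * R) v := A p.1 (row_mx (p.2%:M : 'rV[R]_1) v).
have [g dg gP] := definable_choice (A := fun t a => exists v, B (t, a) v)
  (definable_existsV (A := fun p => B (p.1, p.2)) dA').
have [G dG GP] := IH _ _ B dA'.
have d1 : dmap (fun t => (t, g t)) by apply: dmap_pair; [definability|apply: dfun_dmap].
exists (fun t => row_mx ((g t)%:M : 'rV[R]_1) (G (t, g t))).
  by apply: drow => //; apply: (dmap_comp dG d1).
move=> t [v]; have [a [w ->]] := rowE v => Ax.
by apply: (GP (t, g t)); apply: (gP t); exists a; exists w.
Qed.

End Choice.

(** * Differentiability of definable functions *)

Section Differentiability.
Context {R : realType}.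
Implicit Types (A : R -> Prop) (Q : R -> R -> Prop) (g : R -> R) (a b c d x y : R).

Lemma definable_ev_right T {ct : context T} (F : T -> R) (A : T -> R -> Prop) :
  dfun F -> definable (fun p : T * R => A p.1 p.2) ->
  definable (fun t => ev_right (F t) (A t)).
Proof.
move=> dF dA; definability_with ltac:(first [apply: (dfun_comp dF)
  | apply: (definable_comp (F := fun q : T * R * R => (q.1.1, q.2)) dA)]).
Qed.

Lemma definable_ev_left T {ct : context T} (F : T -> R) (A : T -> R -> Prop) :
  dfun F -> definable (fun p : T * R => A p.1 p.2) ->
  definable (fun t => ev_left (F t) (A t)).
Proof.
move=> dF dA; definability_with ltac:(first [apply: (dfun_comp dF)
  | apply: (definable_comp (F := fun q : T * R * R => (q.1.1, q.2)) dA)]).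
Qed.

(** The sets of the [s] for which [Q s x] holds for all [x] in an interval of
    length [1 / n.+1] to the right of [s] cover the interval, so one of them
    contains a subinterval, which may be shortened to length [1 / n.+1]. *)
Lemma definable_right_uniform Q a b : definable (fun p => Q p.1 p.2) -> a < b ->
  on_itv a b (fun s => ev_right s (Q s)) ->
  exists c d, sub_itv c d a b /\ forall s x, c < s -> s < x -> x < d -> Q s x.
Proof.
move=> dQ ab evQ.
pose A_ (n : nat) s := forall x, s < x < s + n.+1%:R^-1 -> Q s x.
have dA_ n : definable (A_ n).
  by definability_with ltac:(apply: (definable_comp dQ)).
have [|n [c [d [cd cdA]]]] := definable_cover ab dA_.
  move=> s /evQ[e se sQ].
  have [n ne] : exists n : nat, n.+1%:R^-1 < e - s.
    exists (Num.bound (e - s)^-1); rewrite invf_plt ?posrE ?subr_gt0 //.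
    by apply: lt_le_trans (archi_boundP _) _; rewrite ?ler_nat // invr_ge0 subr_ge0 ltW.
  by exists n => x /andP[sx xn]; apply: sQ; rewrite sx (lt_trans xn) // -ltrBrDl.
have n0 : 0 < n.+1%:R^-1 :> R by rewrite invr_gt0 ltr0n.
case: (cd) => ac cd' db; move: n0 cdA; rewrite /A_; set r := n.+1%:R^-1 => n0 cdA.
exists c, (Num.min d (c + r)); split.
  by split; rewrite ?lt_min ?ge_min ?cd' ?db //=; lra.
move=> s x cs sx; rewrite lt_min => /andP[xd xn].
by apply: (cdA s); apply/andP; split; lra.
Qed.

Lemma ev_rightN A a : ev_left (- a) (fun x => A (- x)) -> ev_right a A.
Proof.
move=> [b ab bA]; exists (- b); first by lra.
by move=> x xI; rewrite -[x]opprK; apply: bA; apply/andP; split; lra.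
Qed.

Lemma definable_left_uniform Q a b : definable (fun p => Q p.1 p.2) -> a < b ->
  on_itv a b (fun s => ev_left s (Q s)) ->
  exists c d, sub_itv c d a b /\ forall s x, c < x -> x < s -> s < d -> Q s x.
Proof.
move=> dQ ab evQ.
have [||s sI|c [d [[ac cd db] cdQ]]] :=
    @definable_right_uniform (fun s x => Q (- s) (- x)) (- b) (- a).
- by apply: (definable_comp (F := fun p : R * R => (- p.1, - p.2)) dQ); definability.
- lra.
- apply: ev_rightN.
  have [e es eQ] : ev_left (- s) (Q (- s)) by apply: evQ; apply/andP; split; lra.
  by exists e => // x xI; rewrite opprK; apply: eQ.
exists (- d), (- c); split; first by split; lra.
by move=> s x dx xs sc; rewrite -[s]opprK -[x]opprK; apply: cdQ; lra.
Qed.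

(** For each [s], either [Q s x] or its negation holds for all [x] close to [s]
    on the right; one of the two cases occurs on a whole subinterval, where it
    becomes uniform. *)
Lemma definable_ramsey Q a b : definable (fun p => Q p.1 p.2) -> a < b ->
  exists c d, sub_itv c d a b /\
    ((forall s x, c < s -> s < x -> x < d -> Q s x) \/
     (forall s x, c < s -> s < x -> x < d -> ~ Q s x)).
Proof.
move=> dQ ab.
have dS : definable (fun s => ev_right s (Q s)).
  by apply: definable_ev_right => //; definability.
have [c [d [cd [cdQ|cdQ]]]] := definable_itv dS ab; case: (cd) => _ cd0 _.
  have [c' [d' [cd' Q']]] := definable_right_uniform dQ cd0 cdQ.
  by exists c', d'; split; [apply: sub_itv_trans cd' cd|left].
have dnQ : definable (fun p => ~ Q p.1 p.2) by apply: definable_not.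
have [|c' [d' [cd' Q']]] := definable_right_uniform (Q := fun s x => ~ Q s x) dnQ cd0.
  move=> s /cdQ; case: (definable_right s (A := Q s)) => //.
  by apply: (definable_comp (F := fun x => (s, x)) dQ); definability.
by exists c', d'; split; [apply: sub_itv_trans cd' cd|right].
Qed.

(** A monotone function can only jump upwards, so the largest point up to
    which the growth is at least [M] is the right end. *)
Lemma steep_right g a b M : a < b ->
  (forall s x, a <= s -> s < x -> x <= b -> g s <= g x) ->
  (forall s, a <= s -> s < b -> ev_right s (fun x => M * (x - s) < g x - g s)) ->
  0 <= M -> M * (b - a) <= g b - g a.
Proof.
move=> ab mono steep M0.
pose E := [set x | a <= x <= b /\ M * (x - a) <= g x - g a].
have Ea : E a by split; [rewrite lexx ltW|rewrite !subrr mulr0].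
have ubE : ubound E b by move=> x [/andP[]].
have supE : has_sup E by split; [exists a|exists b].
have cI : a <= sup E <= b.
  by apply/andP; split; [apply: ub_le_sup => //; exists b|apply: ge_sup => //; exists a].
have Ec : E (sup E).
  split=> //; rewrite leNgt; apply/negP => lt.
  have Mp : 0 < M.
    rewrite lt_neqAle M0 andbT; apply/eqP => M00; move: lt; rewrite -M00 mul0r.
    case/andP: cI => ac cb; move: ac; rewrite le_eqVlt => /orP[/eqP <-|ac].
      by rewrite subrr ltxx.
    by have := mono a (sup E) (lexx _) ac cb; lra.
  pose e := (M * (sup E - a) - (g (sup E) - g a)) / M.
  have e0 : 0 < e by rewrite divr_gt0 // subr_gt0.
  have [x Ex xc] := sup_adherent e0 supE.
  have xs : x <= sup E by apply: ub_le_sup => //; exists b.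
  have gx : g x <= g (sup E).
    move: xs; rewrite le_eqVlt => /orP[/eqP -> //|xs].
    by apply: mono => //; [case: Ex => /andP[]|case/andP: cI].
  have : M * (sup E - e) < M * x by rewrite ltr_pM2l.
  have -> : M * (sup E - e) = M * sup E - (M * (sup E - a) - (g (sup E) - g a)).
    by rewrite mulrBr /e mulrCA divff ?mulr1 // gt_eqF.
  by case: Ex => _; nra.
case/andP: (cI) => ac; rewrite le_eqVlt => /orP[/eqP <-|cb]; first exact: Ec.2.
exfalso; have [e ce estep] := steep (sup E) ac cb.
pose x := (sup E + Num.min e b) / 2.
have mc : sup E < Num.min e b by rewrite lt_min ce.
have me : Num.min e b <= e by rewrite ge_min lexx.
have mb : Num.min e b <= b by rewrite ge_min lexx orbT.
have xI : sup E < x < e by rewrite /x; apply/andP; split; lra.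
have Ex : E x.
  split; first by rewrite /x; apply/andP; split; lra.
  have := estep x xI; case: Ec => _; lra.
have : x <= sup E by apply: ub_le_sup => //; exists b.
by case/andP: xI => xI _; lra.
Qed.

(** The right-hand slopes cannot be unbounded at every point of an interval:
    the function would then grow faster than any multiple of the length
    ([steep_right]).  So on some subinterval they are bounded at each point, and
    the bound becomes uniform. *)
Lemma definable_lipschitz_mono g a b : dfun g -> a < b ->
  (forall s x, a < s -> s < x -> x < b -> g s <= g x) ->
  exists c d (N : nat), sub_itv c d a b /\
    forall s x, c < s -> s < x -> x < d -> `|g x - g s| <= N%:R * (x - s).
Proof.
move=> dg ab mono.
have dS : definable (fun s => exists M, ev_right s (fun x => g x - g s <= M * (x - s))).
  by definability_with ltac:(first [apply: (dfun_comp dg)|apply: definable_ev_right]).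
have [c [d [cd [cdU|cdU]]]] := definable_itv dS ab; case: (cd) => ac cd0 db; last first.
  have evU s M : c < s -> s < d -> ev_right s (fun x => M * (x - s) < g x - g s).
    move=> cs sd; have dM : definable (fun x => g x - g s <= M * (x - s)).
      by definability_with ltac:(first [apply: (dfun_comp dg)]).
    case: (definable_right s dM) => h.
      by exfalso; apply: (cdU s); [rewrite cs|exists M].
    by apply: ev_right_imp h => x _ /negP; rewrite -ltNge.
  pose c' := c + (d - c) / 3; pose d' := c + (d - c) / 3 * 2.
  pose M := (g d' - g c') / (d' - c') + 1.
  have cd' : c' < d' by rewrite /c' /d'; lra.
  have : M * (d' - c') <= g d' - g c'.
    apply: steep_right => //.
    - by move=> s x cs sx xd; apply: mono; rewrite /c' /d' in cs xd; lra.
    - by move=> s cs sd; apply: evU; rewrite /c' /d' in cs sd; lra.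
    - apply: addr_ge0 => //; apply: divr_ge0; last by rewrite subr_ge0 ltW.
      by rewrite subr_ge0; apply: mono => //; rewrite /c' /d'; lra.
  rewrite /M mulrDl divfK ?subr_eq0 ?gt_eqF // mul1r; lra.
have dA_ (n : nat) : definable (fun s => ev_right s (fun x => g x - g s <= n%:R * (x - s))).
  by definability_with ltac:(first [apply: (dfun_comp dg)|apply: definable_ev_right]).
have [|n [c' [d' [cd' nU]]]] := definable_cover cd0 dA_.
  move=> s /cdU[M MU]; exists (Num.bound `|M|).
  apply: ev_right_imp MU => x sx h; apply: (le_trans h); rewrite ler_wpM2r ?subr_ge0 ?ltW //.
  by apply: le_lt_trans (ler_norm _) _; apply: archi_boundP.
have [_ cd0' _] := cd'.
have [|c'' [d'' [cd'' LQ]]] :=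
    definable_right_uniform (Q := fun s x => g x - g s <= n%:R * (x - s)) _ cd0' nU.
  by definability_with ltac:(first [apply: (dfun_comp dg)]).
have [? ? ?] := cd'; have [? ? ?] := cd''.
exists c'', d'', n; split; first by split; lra.
move=> s x cs sx xd; rewrite ger0_norm; first exact: LQ.
by rewrite subr_ge0; apply: mono => //; lra.
Qed.

Lemma definable_lipschitz g a b : dfun g -> a < b ->
  exists c d (N : nat), sub_itv c d a b /\
    forall s x, c < s -> s < x -> x < d -> `|g x - g s| <= N%:R * (x - s).
Proof.
move=> dg ab.
have [|c [d [cd [up|down]]]] := definable_ramsey (Q := fun s x => g s <= g x) _ ab.
- by definability_with ltac:(first [apply: (dfun_comp dg)]).
- have [_ cd0 _] := cd.
  have [c' [d' [N [cd' L]]]] := definable_lipschitz_mono dg cd0 up.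
  by exists c', d', N; split=> //; apply: sub_itv_trans cd' cd.
have [_ cd0 _] := cd.
have [|c' [d' [N [cd' L]]]] := definable_lipschitz_mono (dfun_opp dg) cd0.
  by move=> s x cs sx xd; rewrite lerN2 ltW // ltNge; apply/negP; apply: down.
exists c', d', N; split; first exact: sub_itv_trans cd' cd.
by move=> s x cs sx xd; have := L s x cs sx xd; rewrite opprK addrC distrC.
Qed.

(** The derivative, in a form that is visibly a formula. *)
Definition has_slope g s L := forall e, 0 < e -> exists2 d, 0 < d &
  forall x, `|x - s| < d -> `|g x - g s - L * (x - s)| <= e * `|x - s|.

Lemma definable_has_slope T {ct : context T} g (F L : T -> R) :
  dfun g -> dfun F -> dfun L -> definable (fun t => has_slope g (F t) (L t)).
Proof.
move=> dg dF dL; definability_with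
  ltac:(first [apply: (dfun_comp dg)|apply: (dfun_comp dF)|apply: (dfun_comp dL)]).
Qed.

(** The right-hand derivative is larger than [q] and the left-hand one is
    smaller; [steeper_left] is the opposite.  If the one-sided derivatives
    differ, a rational [q] lies between them. *)
Let steeper_right g q s := ev_right s (fun x => q * (x - s) < g x - g s) /\
  ev_left s (fun x => g s - g x < q * (s - x)).

Let steeper_left g q s := ev_right s (fun x => g x - g s < q * (x - s)) /\
  ev_left s (fun x => q * (s - x) < g s - g x).

Let dslope g q s : dfun g -> [/\ definable (fun x => q * (x - s) < g x - g s),
  definable (fun x => g s - g x < q * (s - x)),
  definable (fun x => g x - g s < q * (x - s)) &
  definable (fun x => q * (s - x) < g s - g x)].
Proof.
by move=> dg; split; definability_with ltac:(first [apply: (dfun_comp dg)]).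
Qed.

(** The derivative is the supremum of the [L] such that the right-hand
    difference quotients are eventually at least [L]. *)
Let same_slopes g s (N : R) : dfun g ->
  ev_right s (fun x => `|g x - g s| <= N * (x - s)) ->
  (forall q : rat, ~ steeper_right g (ratr q) s) ->
  (forall q : rat, ~ steeper_left g (ratr q) s) -> exists L, has_slope g s L.
Proof.
move=> dg lip nr nl.
pose E := [set L | ev_right s (fun x => L * (x - s) <= g x - g s)].
have EN : E (- N).
  by apply: ev_right_imp lip => x sx; rewrite mulNr ler_norml => /andP[].
have ubE : ubound E N.
  move=> L EL; have [x sx [h1]] := ev_right_ex (ev_right_and EL lip).
  move=> /(le_trans (ler_norm _)); rewrite -subr_gt0 in sx => h2.
  by rewrite -(ler_pM2r sx); apply: le_trans h2.
have supE : has_sup E by split; [exists (- N)|exists N].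
exists (sup E) => e e0.
have [|q] := @rat_in_itvoo _ (sup E - e) (sup E); first lra.
rewrite in_itv /= => /andP[qe qs].
have [|q'] := @rat_in_itvoo _ (sup E) (sup E + e); first lra.
rewrite in_itv /= => /andP[qs' qe'].
have r1 : ev_right s (fun x => ratr q * (x - s) < g x - g s).
  have [|L EL Lq] := @sup_adherent _ E (sup E - ratr q) _ supE; first by rewrite subr_gt0.
  apply: ev_right_imp EL => x sx; apply: lt_le_trans; rewrite ltr_pM2r ?subr_gt0 //; lra.
have [dq1 dq2 _ _] := dslope (ratr q) s dg.
have [_ _ dq3 dq4] := dslope (ratr q') s dg.
have l1 : ev_left s (fun x => ~ g s - g x < ratr q * (s - x)).
  by case: (definable_left s dq2) => // h; case: (nr q).
have r2 : ev_right s (fun x => g x - g s < ratr q' * (x - s)).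
  case: (definable_right s dq3) => // h; exfalso.
  have : E (ratr q') by apply: ev_right_imp h => x _ /negP; rewrite -leNgt.
  by move=> /(ub_le_sup (ex_intro _ N ubE)); lra.
have l2 : ev_left s (fun x => ~ ratr q' * (s - x) < g s - g x).
  by case: (definable_left s dq4) => // h; case: (nl q').
have [b sb rb] := ev_right_and r1 r2.
have [b' sb' lb] := ev_left_and l1 l2.
exists (Num.min (b - s) (s - b')); first by rewrite lt_min !subr_gt0 sb.
move=> x; rewrite lt_min => /andP[xb xb'].
have [xs|sx|->] := ltgtP x s; last by rewrite !subrr mulr0 subr0 normr0 mulr0.
  have b'x : b' < x by move: xb'; rewrite ltr0_norm; lra.
  have [|/negP h1 /negP h2] := lb x; first by rewrite b'x.
  rewrite -!leNgt in h1 h2; rewrite [`|x - s|]ltr0_norm ?subr_lt0 //.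
  by rewrite ler_norml; apply/andP; split; nra.
have xb2 : x < b by move: xb; rewrite gtr0_norm; lra.
have [|h1 h2] := rb x; first by rewrite sx.
rewrite [`|x - s|]gtr0_norm ?subr_gt0 //.
by rewrite ler_norml; apply/andP; split; nra.
Qed.

(** Otherwise, by the covering argument, one of the countably many conditions
    [steeper_right] and [steeper_left] with rational slopes would hold on a
    subinterval.  It could be made uniform from the right and then from the left,
    and the slope of a chord would be at the same time larger and smaller than
    [q]. *)
Lemma definable_differentiable g a b : dfun g -> a < b ->
  exists c d, sub_itv c d a b /\ on_itv c d (fun s => exists L, has_slope g s L).
Proof.
move=> dg ab; have [c [d [N [cd lip]]]] := definable_lipschitz dg ab.
have [ac cd0 db] := cd.
have dD : definable (fun s => exists L, has_slope g s L).
  by apply: definable_exists; apply: definable_has_slope => //; definability.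
have [c1 [d1 [cd1 [cdD|cdD]]]] := definable_itv dD cd0.
  by exists c1, d1; split=> //; apply: sub_itv_trans cd1 cd.
exfalso; have [cc1 cd1' dd1] := cd1.
pose q_ n : R := if unpickle n is Some q then ratr (q : rat) else 0.
have dr q : definable (steeper_right g q).
  by apply: definable_and; [apply: definable_ev_right|apply: definable_ev_left];
   definability_with ltac:(first [apply: (dfun_comp dg)]).
have dl q : definable (steeper_left g q).
  by apply: definable_and; [apply: definable_ev_right|apply: definable_ev_left];
   definability_with ltac:(first [apply: (dfun_comp dg)]).
have [|n [c2 [d2 [cd2 cdn]]]] := definable_cover cd1' (fun n => definable_or (dr (q_ n)) (dl (q_ n))).
  move=> s sI; apply: contrapT => nex.
  have nE (q : rat) : ~ (steeper_right g (ratr q) s \/ steeper_left g (ratr q) s).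
    by move=> h; apply: nex; exists (pickle q); rewrite /q_ pickleK.
  apply: (cdD s sI); apply: (same_slopes (N := N%:R) dg).
  - exists d1; first by case/andP: sI.
    by move=> x /andP[sx xd]; case/andP: sI => ? ?; apply: lip; lra.
  - by move=> q h; apply: (nE q); left.
  - by move=> q h; apply: (nE q); right.
have [_ cd20 _] := cd2.
have [c3 [d3 [[_ cd3 _] [cd3r|cd3l]]]] : exists c3 d3, sub_itv c3 d3 c2 d2 /\
    (on_itv c3 d3 (steeper_right g (q_ n)) \/ on_itv c3 d3 (steeper_left g (q_ n))).
  have [c3 [d3 [cd3 [h|h]]]] := definable_itv (dr (q_ n)) cd20; exists c3, d3; split=> //.
    by left.
  right=> s sI; have := cdn s; case=> // [|h']; last by have := h s sI.
  by case: cd3 => *; case/andP: sI => *; apply/andP; split; lra.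
- have [|c4 [d4 [cd4 h4]]] := definable_right_uniform
    (Q := fun s x => q_ n * (x - s) < g x - g s) _ cd3 (fun s sI => (cd3r s sI).1).
    by definability_with ltac:(first [apply: (dfun_comp dg)]).
  have [? cd4' ?] := cd4.
  have [||c5 [d5 [[? cd5 ?] h5]]] := definable_left_uniform
    (Q := fun s x => g s - g x < q_ n * (s - x)) _ cd4'.
  + by definability_with ltac:(first [apply: (dfun_comp dg)]).
  + by move=> s sI; apply: (cd3r s _).2; case/andP: sI => *; apply/andP; split; lra.
  pose s := c5 + (d5 - c5) / 3; pose x := c5 + (d5 - c5) / 3 * 2.
  have sI : [/\ c5 < s, s < x & x < d5] by rewrite /s /x; split; lra.
  have [cs sx xd] := sI; have sc4 : c4 < s by lra.
  by have := lt_trans (h5 x s cs sx xd) (h4 s x sc4 sx ltac:(lra)); rewrite ltxx.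
- have [|c4 [d4 [cd4 h4]]] := definable_right_uniform
    (Q := fun s x => g x - g s < q_ n * (x - s)) _ cd3 (fun s sI => (cd3l s sI).1).
    by definability_with ltac:(first [apply: (dfun_comp dg)]).
  have [? cd4' ?] := cd4.
  have [||c5 [d5 [[? cd5 ?] h5]]] := definable_left_uniform
    (Q := fun s x => q_ n * (s - x) < g s - g x) _ cd4'.
  + by definability_with ltac:(first [apply: (dfun_comp dg)]).
  + by move=> s sI; apply: (cd3l s _).2; case/andP: sI => *; apply/andP; split; lra.
  pose s := c5 + (d5 - c5) / 3; pose x := c5 + (d5 - c5) / 3 * 2.
  have sI : [/\ c5 < s, s < x & x < d5] by rewrite /s /x; split; lra.
  have [cs sx xd] := sI; have sc4 : c4 < s by lra.
  by have := lt_trans (h5 x s cs sx xd) (h4 s x sc4 sx ltac:(lra)); rewrite ltxx.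
Qed.

End Differentiability.

(** * Regular and approximate normals *)

Section Curve.
Context {R : realType}.
Implicit Types (g : R -> R) (a b s : R).

(** This gives access to the mean value theorem and to the rules for products. *)
Lemma has_slope_derive g s L : has_slope g s L -> is_derive s 1 g L.
Proof.
move=> gL.
have cv : (fun h : R => h^-1 *: (g (h *: (1 : R) + s) - g s)) @ 0^' --> L.
  apply/cvgrPdist_le => e e0; have [d d0 dg] := gL e e0.
  exists d => //= h; rewrite /ball_ /= sub0r normrN => hd h0.
  have := dg (h *: (1 : R) + s); rewrite addrK [h *: 1]mulr1 => /(_ hd).
  set X := g _ - g s => hX.
  have -> : L - h^-1 *: X = - (h^-1 * (X - L * h)).
    by rewrite mulrBr mulrCA mulVf // mulr1 opprB.
  by rewrite normrN normrM normfV mulrC ler_pdivrMr ?normr_gt0.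
by apply: DeriveDef; [exact: (cvgP L cv)|exact: cvg_lim cv].
Qed.

Lemma has_slope_unique g s L M : has_slope g s L -> has_slope g s M -> L = M.
Proof.
move=> /has_slope_derive hL /has_slope_derive hM.
by rewrite -(@derive_val _ _ _ _ _ _ _ hL) (@derive_val _ _ _ _ _ _ _ hM).
Qed.

Definition coord_near n e (x y : 'rV[R]_n) := forall i, `|y 0 i - x 0 i| < e.

Lemma regular_normalP n (S : set 'rV[R]_n) x v : regular_normal S x v <->
  forall e, 0 < e -> exists2 d, 0 < d & forall y, S y -> coord_near d x y ->
    dot v (y - x) <= e * enorm (y - x).
Proof.
split=> h e e0.
  have := h e e0; rewrite /within /= => /nbhs_ballP[d /= d0 dh]; exists d => // y Sy xy.
  apply: dh => //; split=> // i j; rewrite (ord1 i).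
  by rewrite /ball /= distrC; apply: xy.
have [d d0 dh] := h e e0; apply/nbhs_ballP; exists d => //= y xy Sy.
apply: dh => // i; have := xy.2 0 i.
by rewrite /ball /= distrC.
Qed.

(** A description of the limiting normals without sequences, so that it can be
    seen to be a formula. *)
Definition approx_normal n (S : set 'rV[R]_n) (x v : 'rV[R]_n) := forall e, 0 < e ->
  exists y w, [/\ coord_near e x y, coord_near e v w, S y & regular_normal S y w].

Lemma limiting_approx n (S : set 'rV[R]_n) (x v : 'rV[R]_n) : limiting_normal S x v ->
  approx_normal S x v.
Proof.
move=> [y [w [yx wv yw]]] e e0.
have near_e (u : nat -> 'rV[R]_n) z : u @ \oo --> z ->
    \forall k \near \oo, coord_near e z (u k).
  move=> uz; have := uz _ (nbhsx_ballx z e e0); apply: filterS => k /= uk i.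
  by have := uk.2 0 i; rewrite /ball /= distrC.
have [k [ky kw]] : exists k, coord_near e x (y k) /\ coord_near e v (w k).
  have [N _ HN] := filterI (near_e y x yx) (near_e w v wv).
  by exists N; apply: (HN N) => /=.
by exists (y k), (w k); case: (yw k).
Qed.

Lemma definable_regular_normal n (S : set 'rV[R]_n) : definable S ->
  definable (fun p : 'rV[R]_n * 'rV[R]_n => regular_normal S p.1 p.2).
Proof.
move=> dS; apply: (eq_definable _ (A := fun p : 'rV[R]_n * 'rV[R]_n =>
  forall e, 0 < e -> exists2 d, 0 < d & forall y, S y -> coord_near d p.1 y ->
    dot p.2 (y - p.1) <= e * enorm (y - p.1))).
  by move=> p; apply: iff_sym; apply: regular_normalP.
by rewrite /coord_near; definability_with ltac:(apply: (definable_comp dS)).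
Qed.

Lemma definable_approx_normal n (S : set 'rV[R]_n) : definable S ->
  definable (fun p : 'rV[R]_n * 'rV[R]_n => approx_normal S p.1 p.2).
Proof.
move=> dS; have dN := definable_regular_normal dS.
by rewrite /approx_normal /coord_near; definability_with ltac:(first [apply: (definable_comp dS)
  |apply: (definable_comp (F := fun q => (q.1.2, q.2)) dN)]).
Qed.

Lemma dotC n (u v : 'rV[R]_n) : dot u v = dot v u.
Proof. by apply: eq_bigr => i _; rewrite mulrC. Qed.

Lemma dotDl n (u v w : 'rV[R]_n) : dot (u + v) w = dot u w + dot v w.
Proof. by rewrite -big_split; apply: eq_bigr => i _; rewrite mxE mulrDl. Qed.

Lemma dotZl n a (u w : 'rV[R]_n) : dot (a *: u) w = a * dot u w.
Proof. by rewrite /dot mulr_sumr; apply: eq_bigr => i _; rewrite mxE mulrA. Qed.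

Lemma dotDr n (u v w : 'rV[R]_n) : dot w (u + v) = dot w u + dot w v.
Proof. by rewrite !(dotC w) dotDl. Qed.

Lemma dotZr n a (u w : 'rV[R]_n) : dot u (a *: w) = a * dot u w.
Proof. by rewrite !(dotC u) dotZl. Qed.

Lemma dot_rV_pair n (u v : 'rV[R]_n) a b :
  dot (rV_pair u a) (rV_pair v b) = dot u v + a * b.
Proof.
rewrite /dot big_split_ord /= big_ord1; congr (_ + _).
  by apply: eq_bigr => i _; rewrite !row_mxEl.
by rewrite !row_mxEr !mxE eqxx !mulr1n.
Qed.

Lemma dot_ge0 n (u : 'rV[R]_n) : 0 <= dot u u.
Proof. by apply: sumr_ge0 => i _; rewrite -expr2 sqr_ge0. Qed.

Lemma enorm_ge0 n (u : 'rV[R]_n) : 0 <= enorm u.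
Proof. exact: sqrtr_ge0. Qed.

Lemma enorm_sqr n (u : 'rV[R]_n) : enorm u ^+ 2 = dot u u.
Proof. by rewrite sqr_sqrtr // dot_ge0. Qed.

Lemma enorm_le_sum n (u : 'rV[R]_n) : enorm u <= \sum_(i < n) `|u 0 i|.
Proof.
have s0 : 0 <= \sum_(i < n) `|u 0 i| by apply: sumr_ge0.
rewrite -(ler_pXn2r (n := 2)) ?nnegrE ?enorm_ge0 // enorm_sqr expr2 mulr_suml.
apply: ler_sum => i _; rewrite -expr2 -real_normK ?num_real // expr2.
by rewrite ler_wpM2l // (bigD1 i) //= lerDl sumr_ge0.
Qed.

Lemma exists_radius_ord n (P : 'I_n -> R -> Prop) :
  (forall i, exists2 d, 0 < d & forall x, `|x| < d -> P i x) ->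
  exists2 d, 0 < d & forall i x, `|x| < d -> P i x.
Proof.
move=> h; pose D i := projT1 (cid2 (h i)).
have D0 i : 0 < D i by rewrite /D; case: cid2.
have DP i x : `|x| < D i -> P i x by rewrite /D; case: cid2 => d /= _; apply.
exists (\big[Num.min/1]_(i < n) D i).
  by apply: (big_ind (fun x => 0 < x)) => // x y x0 y0; rewrite lt_min x0.
by move=> i x xd; apply: DP; apply: (lt_le_trans xd); apply: bigmin_le_cond.
Qed.

Lemma le_eps (x C : R) : (forall e, 0 < e -> e < 1 -> x <= e * C) -> x <= 0.
Proof.
move=> h; rewrite leNgt; apply/negP => x0.
have hx : x <= 1 / 2 * C by apply: h; lra.
have xC : 0 < x + 2 * C by lra.
have : x <= x / (x + 2 * C) * C.
  by apply: h; [rewrite divr_gt0|rewrite ltr_pdivrMr // mul1r]; lra.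
rewrite mulrAC ler_pdivlMr // ler_pM2l //; lra.
Qed.

(** The curve stays in [E] on both sides of [s], so that [D] and [- D] are both
    tangent directions. *)
Lemma regular_normal_slope n (E : set 'rV[R]_n) (z : R -> 'rV[R]_n) s (w D : 'rV[R]_n) (d : R) :
  0 < d -> (forall x, `|x - s| < d -> E (z x)) -> regular_normal E (z s) w ->
  (forall i, has_slope (fun x => z x 0 i) s (D 0 i)) -> dot w D = 0.
Proof.
move=> d0 Ez /regular_normalP wN zD.
pose K := \sum_(i < n) (`|D 0 i| + 1).
pose W := \sum_(i < n) `|w 0 i|.
have K0 : 0 <= K by apply: sumr_ge0.
have est e : 0 < e -> e < 1 -> exists2 r, 0 < r & forall x, `|x| < r ->
    dot w D * x <= e * (K + W) * `|x|.
  move=> e0 e1; have [d1 d10 h1] := wN e e0.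
  have [r r0 hr] : exists2 r, 0 < r & forall i x, `|x| < r ->
      `|z (s + x) 0 i - z s 0 i| < d1 /\
      `|z (s + x) 0 i - z s 0 i - D 0 i * x| <= e * `|x|.
    apply: exists_radius_ord => i; have [r r0 hr] := zD i e e0.
    pose m := `|D 0 i| + e + 1; have m0 : 0 < m by rewrite /m; have := normr_ge0 (D 0 i); lra.
    exists (Num.min r (d1 / m)); first by rewrite lt_min r0 divr_gt0.
    move=> x; rewrite lt_min ltr_pdivlMr // => /andP[xr xd].
    have := hr (s + x); rewrite [s + x]addrC addrK => /(_ xr) h; split=> //.
    have := ler_normD (z (x + s) 0 i - z s 0 i - D 0 i * x) (D 0 i * x).
    rewrite subrK normrM => h'; apply: le_lt_trans h' _; apply: le_lt_trans xd.
    by have := normr_ge0 x; rewrite /m; nra.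
  exists (Num.min r d); first by rewrite lt_min r0.
  move=> x; rewrite lt_min => /andP[xr xd].
  have Ezx : E (z (s + x)) by apply: Ez; rewrite addrC addKr.
  have := h1 _ Ezx (fun i => (hr i x xr).1).
  set y := z (s + x) - z s.
  have yE i : y 0 i = z (s + x) 0 i - z s 0 i by rewrite /y !mxE.
  have yn : enorm y <= K * `|x|.
    apply: le_trans (enorm_le_sum _) _; rewrite /K mulr_suml; apply: ler_sum => i _.
    have := ler_normD (y 0 i - D 0 i * x) (D 0 i * x); rewrite subrK normrM.
    have := (hr i x xr).2; rewrite -yE; have := normr_ge0 x.
    move: `|x| `|D 0 i| `|y 0 i| `|y 0 i - D 0 i * x| => p q t u *; nra.
  have dy : dot w D * x - e * W * `|x| <= dot w y.
    rewrite /dot /W mulr_suml mulr_sumr mulr_suml -sumrB; apply: ler_sum => i _.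
    have := (hr i x xr).2; rewrite -yE => hi.
    have : `|w 0 i * (y 0 i - D 0 i * x)| <= `|w 0 i| * (e * `|x|).
      by rewrite normrM ler_wpM2l.
    by rewrite ler_norml => /andP[+ _]; rewrite mulrBr !mulrA; lra.
  have := normr_ge0 x; move: dy yn; move: (dot w D) (dot w y) (enorm y) `|x| => p q t u.
  by move=> *; nra.
have le0 c : (c = 1 \/ c = -1) -> c * dot w D <= 0.
  move=> c1; apply: (@le_eps _ (K + W)) => e e0 e1; have [r r0 hr] := est e e0 e1.
  have nc : `|c| = 1 by case: c1 => ->; rewrite ?normrN normr1.
  have := hr (c * (r / 2)); rewrite normrM nc mul1r gtr0_norm ?divr_gt0 //.
  have -> : r / 2 < r by lra.
  move=> /(_ isT); rewrite mulrCA mulrA ler_pM2r ?divr_gt0 // mulrC.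
have := le0 1 (or_introl erefl); have := le0 (-1) (or_intror erefl); lra.
Qed.

Lemma ev_right_ord n (A : 'I_n -> R -> Prop) a : (forall i, ev_right a (A i)) ->
  ev_right a (fun x => forall i, A i x).
Proof.
move=> h; pose D i := projT1 (cid2 (h i)).
have D0 i : a < D i by rewrite /D; case: cid2.
have DP i x : a < x < D i -> A i x by rewrite /D; case: cid2 => d /= _; apply.
exists (\big[Num.min/a + 1]_(i < n) D i).
  apply: (big_ind (fun x => a < x)) => //; first by rewrite ltrDl.
  by move=> x y x0 y0; rewrite lt_min x0.
move=> x /andP[ax xd] i; apply: DP; rewrite ax /=; apply: (lt_le_trans xd).
exact: bigmin_le_cond.
Qed.

(** Otherwise all the derivatives near [s0] would exceed [L + e], and by the
    mean value theorem so would the slope of every chord there; this contradicts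
    the expansion of [g] at [s0]. *)
Lemma slope_limit_le g z s0 L e : dfun g -> 0 < e ->
  (forall e, 0 < e -> ev_right s0 (fun x => `|g x - z - L * (x - s0)| <= e * (x - s0))) ->
  ev_right s0 (fun x => forall M, has_slope g x M -> M <= L + e).
Proof.
move=> dg e0 gz.
have dA : definable (fun x => forall M, has_slope g x M -> M <= L + e).
  by definability_with ltac:(apply: definable_has_slope).
have dD : definable (fun s => exists M, has_slope g s M).
  by definability_with ltac:(apply: definable_has_slope).
case: (definable_right s0 dA) => // nA; exfalso.
have [b sb hb] : ev_right s0 (fun x => exists2 M, has_slope g x M & L + e < M).
  apply: ev_right_imp nA => x _ h; apply: contrapT => h'; apply: h => M gM.
  by rewrite leNgt; apply/negP => ML; apply: h'; exists M.
have mono s x : s0 < s -> s < x -> x < b -> (L + e) * (x - s) <= g x - g s.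
  move=> s0s sx xb.
  pose D y := xget 0 [set M | has_slope g y M /\ L + e < M].
  have DP y : s0 < y < b -> has_slope g y (D y) /\ L + e < D y.
    move=> /hb[M gM LM]; rewrite /D; case: xgetP => [M' _ //|/(_ M)].
    by case.
  have der y : s0 < y < b -> is_derive y 1 g (D y) by move=> /DP[/has_slope_derive].
  have [||c] := @MVT _ g D s x sx.
  - by move=> y; rewrite in_itv /= => /andP[sy yx]; apply: der; apply/andP; split; lra.
  - apply: derivable_within_continuous => y; rewrite in_itv /= => /andP[sy yx].
    have yI : s0 < y < b by apply/andP; split; lra.
    by have [] := der y yI.
  rewrite in_itv /= => /andP[sc cx] ->; rewrite ler_pM2r ?subr_gt0 //.
  by have [|_ /ltW] := DP c; first by apply/andP; split; lra.
have e40 : 0 < e / 4 by lra.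
have [b1 sb1 h1] := gz (e / 4) e40.
pose x := s0 + (Num.min b b1 - s0) / 2.
have mb : Num.min b b1 <= b by rewrite ge_min lexx.
have mb1 : Num.min b b1 <= b1 by rewrite ge_min lexx orbT.
have sm : s0 < Num.min b b1 by rewrite lt_min sb.
(* The expansion at s0 is used at x and at the midpoint s of s0 and x: the
   errors add up to 3/8 of e * (x - s0), while the chord from s to x gains
   half of e * (x - s0). *)
have xs0 : s0 < x by rewrite /x; lra.
pose s := s0 + (x - s0) / 2.
have hx := h1 x; have hs := h1 s; have hm := mono s x.
have {}hx : `|g x - z - L * (x - s0)| <= e / 4 * (x - s0) by apply: hx; rewrite /x; apply/andP; split; lra.
have {}hs : `|g s - z - L * (s - s0)| <= e / 4 * (s - s0) by apply: hs; rewrite /s /x; apply/andP; split; lra.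
have {}hm : (L + e) * (x - s) <= g x - g s by apply: hm; rewrite /s /x; lra.
move: hx hs hm; rewrite !ler_norml => /andP[_ hx] /andP[hs _] hm.
have es : e * (x - s) = e * (x - s0) / 2 by rewrite /s; field.
have ess : e / 4 * (s - s0) = e * (x - s0) / 8 by rewrite /s; field.
have ep : 0 < e * (x - s0) by rewrite mulr_gt0 ?subr_gt0.
move: hx hs hm; rewrite mulrDl es ess; lra.
Qed.

End Curve.

(** * Normals along definable curves *)

Section CurveNormals.
Context {R : realType}.
Implicit Types (g : R -> R) (a b s : R).

Lemma slope_limit g z s0 L e : dfun g -> 0 < e ->
  (forall e, 0 < e -> ev_right s0 (fun x => `|g x - z - L * (x - s0)| <= e * (x - s0))) ->
  ev_right s0 (fun x => forall M, has_slope g x M -> `|M - L| <= e).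
Proof.
move=> dg e0 gz; have h1 := slope_limit_le dg e0 gz.
have gzN e' : 0 < e' ->
    ev_right s0 (fun x => `|- g x - - z - - L * (x - s0)| <= e' * (x - s0)).
  move=> /gz; apply: ev_right_imp => x sx; apply: le_trans.
  by rewrite -normrN le_eqVlt; apply/orP; left; apply/eqP; congr (`|_|); ring.
have h2 := slope_limit_le (dfun_opp dg) e0 gzN.
apply: ev_right_imp (ev_right_and h1 h2) => x sx [{}h1 {}h2] M gM.
have hN : has_slope (fun x => - g x) x (- M).
  move=> e' e'0; have [d d0 dP] := gM e' e'0; exists d => // y /dP; apply: le_trans.
  by rewrite -normrN le_eqVlt; apply/orP; left; apply/eqP; congr (`|_|); ring.
by have := h1 M gM; have := h2 _ hN => h3 h4; rewrite ler_norml; apply/andP; split; lra.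
Qed.

Lemma ev_right_differentiable g s0 : dfun g ->
  ev_right s0 (fun s => exists M, has_slope g s M).
Proof.
move=> dg; have dD : definable (fun s => exists M, has_slope g s M).
  by definability_with ltac:(apply: definable_has_slope).
case: (definable_right s0 dD) => // -[b sb nD]; exfalso.
have [c [d [[sc cd db] cdD]]] := definable_differentiable dg sb.
have mI : c < (c + d) / 2 < d by apply/andP; split; lra.
by apply: (nD ((c + d) / 2)); [apply/andP; split; lra|apply: cdD].
Qed.

(** The curve [z] is replaced near [s0] by a definable curve in [E] within
    [(s - s0) ^+ 2] of it, with regular normals within [s - s0] of [u].  Its
    derivatives tend to [L] when [s] tends to [s0] from the right, and the
    identity for regular normals passes to the limit. *)
Lemma approx_normal_slope N (E : set 'rV[R]_N) (z u : R -> 'rV[R]_N) s0 b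
    (L : 'rV[R]_N) :
  definable E -> dmap z -> dmap u -> s0 < b ->
  (forall s, s0 < s < b -> approx_normal E (z s) (u s)) ->
  (forall i, has_slope (fun x => z x 0 i) s0 (L 0 i)) ->
  (forall i e, 0 < e -> ev_right s0 (fun s => `|u s 0 i - u s0 0 i| <= e)) ->
  dot (u s0) L = 0.
Proof.
move=> dE dz du sb nor zL uc.
pose P s (y w : 'rV[R]_N) := [/\ coord_near ((s - s0) ^+ 2) (z s) y,
  coord_near (s - s0) (u s) w, E y & regular_normal E y w].
have dN := definable_regular_normal dE.
have dP : definable (fun p : R * 'rV[R]_N * 'rV[R]_N => P p.1.1 p.1.2 p.2).
  rewrite /P /coord_near; definability_with ltac:(first [apply: (definable_comp dE)
    | apply: (dmap_comp dz) | apply: (dmap_comp du)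
    | apply: (definable_comp (F := fun q => (q.1.2, q.2)) dN)]).
have dP1 : definable (fun p : R * 'rV[R]_N => exists w, P p.1 p.2 w).
  exact: (definable_existsV (A := fun p : R * 'rV[R]_N => P p.1 p.2)).
have [zt dzt ztP] := definable_choiceV (A := fun s y => exists w, P s y w) dP1.
have dP2 : definable (fun p : R * 'rV[R]_N => P p.1 (zt p.1) p.2).
  apply: (definable_comp (F := fun p : R * 'rV[R]_N => (p.1, zt p.1, p.2)) dP).
  by definability_with ltac:(apply: (dmap_comp dzt)).
have [ut dut utP] := definable_choiceV (A := fun s w => P s (zt s) w) dP2.
have {}utP s : s0 < s < b -> P s (zt s) (ut s).
  move=> sI; apply/utP/ztP; case/andP: (sI) => ss0 _.
  have e0 : 0 < Num.min ((s - s0) ^+ 2) (s - s0) by rewrite lt_min exprn_gt0 ?subr_gt0.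
  have [y [w [zy uw Ey wN]]] := nor s sI _ e0; exists y, w; split=> // i.
    by apply: (lt_le_trans (zy i)); rewrite ge_min lexx.
  by apply: (lt_le_trans (uw i)); rewrite ge_min lexx orbT.
have dzti i : dfun (fun s => zt s 0 i) by apply: dfun_coord.
have ztL i e : 0 < e ->
    ev_right s0 (fun x => `|zt x 0 i - z s0 0 i - L 0 i * (x - s0)| <= e * (x - s0)).
  move=> e0; have e20 : 0 < e / 2 by lra.
  have [d d0 dP'] := zL i _ e20.
  exists (Num.min b (s0 + Num.min d (e / 2))).
    by rewrite lt_min sb ltrDl lt_min d0.
  move=> x; rewrite lt_min => /and3P[sx xb xd].
  have md : Num.min d (e / 2) <= d by rewrite ge_min lexx.
  have me : Num.min d (e / 2) <= e / 2 by rewrite ge_min lexx orbT.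
  have xs : `|x - s0| = x - s0 by rewrite gtr0_norm ?subr_gt0.
  have := dP' x; rewrite xs => /(_ _) h1.
  have {}h1 : `|z x 0 i - z s0 0 i - L 0 i * (x - s0)| <= e / 2 * (x - s0) by apply: h1; lra.
  have [zz _ _ _] := utP x (introT andP (conj sx xb)); have h2 := zz i.
  have h3 : (x - s0) ^+ 2 <= e / 2 * (x - s0).
    by rewrite expr2 ler_wpM2r ?subr_ge0 ?ltW //; lra.
  have := ler_normD (zt x 0 i - z x 0 i) (z x 0 i - z s0 0 i - L 0 i * (x - s0)).
  rewrite [X in `|X| <= _](_ : _ = zt x 0 i - z s0 0 i - L 0 i * (x - s0)); last by ring.
  by move=> h4; lra.
pose D s : 'rV[R]_N := \row_i xget 0 [set M | has_slope (fun x => zt x 0 i) s M].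
have DP : ev_right s0 (fun s => forall i, has_slope (fun x => zt x 0 i) s (D s 0 i)).
  apply: ev_right_ord => i; apply: ev_right_imp (ev_right_differentiable s0 (dzti i)).
  by move=> s _ [M sM]; rewrite mxE; case: xgetP => [y _ //|/(_ M)].
suff h (e : R) : 0 < e -> e < 1 ->
    `|dot (u s0) L| <= e * \sum_(i < N) (`|u s0 0 i| + 1 + `|L 0 i|).
  have := @le_eps _ _ _ h; rewrite normr_le0 => /eqP //.
move=> e0 e1.
have evL : ev_right s0 (fun s => forall i M, has_slope (fun x => zt x 0 i) s M ->
    `|M - L 0 i| <= e).
  by apply: ev_right_ord => i; apply: slope_limit (z s0 0 i) _ _ _ _ _ _ => // e' e'0; apply: ztL.
have e20 : 0 < e / 2 by lra.
have evu : ev_right s0 (fun s => forall i, `|u s 0 i - u s0 0 i| <= e / 2).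
  by apply: ev_right_ord => i; apply: uc.
have evb : ev_right s0 (fun s => s < Num.min b (s0 + e / 2)).
  by apply: ev_right_lt; rewrite lt_min sb ltrDl.
have [s ss0 [sL [su [smin sD]]]] :=
  ev_right_ex (ev_right_and evL (ev_right_and evu (ev_right_and evb DP))).
move: smin; rewrite lt_min => /andP[sb' se].
have [_ wu Ez wN] := utP s (introT andP (conj ss0 sb')).
have wD : dot (ut s) (D s) = 0.
  pose d := Num.min (s - s0) (b - s).
  apply: (regular_normal_slope (d := d) _ _ wN) => //.
    by rewrite lt_min !subr_gt0 ss0.
  move=> x; rewrite lt_min => /andP[x1 x2].
  suff /utP[] : s0 < x < b by [].
  by move: x1 x2; rewrite !ltr_norml => /andP[? ?] /andP[? ?]; apply/andP; split; lra.
have -> : dot (u s0) L = dot (u s0) L - dot (ut s) (D s) by rewrite wD subr0.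
rewrite /dot -sumrB mulr_sumr; apply: le_trans (ler_norm_sum _ _ _) _.
apply: ler_sum => i _.
have wi : `|ut s 0 i - u s0 0 i| <= e.
  have := ler_normD (ut s 0 i - u s 0 i) (u s 0 i - u s0 0 i).
  by rewrite subrKA => h; have := su i; have := wu i; lra.
have Di := sL i _ (sD i).
have -> : u s0 0 i * L 0 i - ut s 0 i * D s 0 i =
  - (ut s 0 i * (D s 0 i - L 0 i)) - (ut s 0 i - u s0 0 i) * L 0 i by ring.
apply: le_trans (ler_normB _ _) _; rewrite normrN !normrM.
have wn : `|ut s 0 i| <= `|u s0 0 i| + 1.
  by have := ler_normD (ut s 0 i - u s0 0 i) (u s0 0 i); rewrite subrK => h; lra.
have h1 : `|ut s 0 i| * `|D s 0 i - L 0 i| <= (`|u s0 0 i| + 1) * e.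
  by apply: ler_pM.
have h2 : `|ut s 0 i - u s0 0 i| * `|L 0 i| <= e * `|L 0 i| by rewrite ler_wpM2r.
lra.
Qed.

Definition differentiable_at g s := exists L, has_slope g s L.

Lemma has_slope_continuous g s : differentiable_at g s -> forall e, 0 < e ->
  ev_right s (fun x => `|g x - g s| <= e).
Proof.
move=> [L gL] e e0; have [d d0 dP] := gL 1 ltr01.
pose m := `|L| + 1; have m0 : 0 < m by rewrite /m; have := normr_ge0 L; lra.
exists (s + Num.min d (e / m)); first by rewrite ltrDl lt_min d0 divr_gt0.
move=> x /andP[sx]; rewrite -ltrBlDl lt_min ltr_pdivlMr // => /andP[xd xe].
have xs : `|x - s| = x - s by rewrite gtr0_norm ?subr_gt0.
have := dP x; rewrite xs => /(_ xd) h1.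
have := ler_normD (g x - g s - L * (x - s)) (L * (x - s)); rewrite subrK normrM xs => h2.
by move: xe; rewrite /m; move: `|L| h2 => l h2; lra.
Qed.

Lemma differentiable_seq (I : Type) (gs : seq I) (G : I -> R -> R) a b :
  (forall i, dfun (G i)) -> a < b -> exists c d, sub_itv c d a b /\
  on_itv c d (fun s => forall i, List.In i gs -> differentiable_at (G i) s).
Proof.
move=> dG ab; elim: gs => [|i gs [c [d [cd cdG]]]]; first by exists a, b; split=> // s _ i [].
have [_ cd0 _] := cd.
have [c' [d' [cd' cdG']]] := definable_differentiable (dG i) cd0.
exists c', d'; split; first exact: sub_itv_trans cd' cd.
move=> s sI j [<-|jgs]; first exact: cdG'.
by apply: cdG => //; case: cd' => *; case/andP: sI => *; apply/andP; split; lra.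
Qed.

Lemma differentiable_ord n (G : 'I_n -> R -> R) a b :
  (forall i, dfun (G i)) -> a < b -> exists c d, sub_itv c d a b /\
  on_itv c d (fun s => forall i, differentiable_at (G i) s).
Proof.
move=> dG ab; have [c [d [cd cdG]]] := differentiable_seq (enum 'I_n) dG ab.
exists c, d; split=> // s sI i; apply: cdG => //.
have : i \in enum 'I_n by rewrite mem_enum.
by elim: (enum 'I_n) => //= j t IH; rewrite inE => /orP[/eqP->|/IH]; [left|right].
Qed.

Definition has_slopeV n (x : R -> 'rV[R]_n) s (L : 'rV[R]_n) :=
  forall i, has_slope (fun y => x y 0 i) s (L 0 i).

Lemma differentiableV n (x : R -> 'rV[R]_n) a b : dmap x -> a < b ->
  exists c d, sub_itv c d a b /\ on_itv c d (fun s => exists L, has_slopeV x s L).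
Proof.
move=> dx ab.
have [c [d [cd cdx]]] := differentiable_ord (fun i => dfun_coord i dx) ab.
exists c, d; split=> // s /cdx h; exists (\row_i projT1 (cid (h i))) => i.
by rewrite mxE; case: cid.
Qed.

Lemma has_slopeV_pair n (x : R -> 'rV[R]_n) (g : R -> R) s L l :
  has_slopeV x s L -> has_slope g s l ->
  has_slopeV (fun y => rV_pair (x y) (g y)) s (rV_pair L l).
Proof.
move=> xL gl i; case: (fintype.splitP i) => j ij.
  have -> : i = lshift 1 j by apply/val_inj.
  by move: (xL j); rewrite !row_mxEl; congr has_slope; apply: funext => y; rewrite row_mxEl.
have -> : i = rshift n j by apply/val_inj.
move: gl; rewrite row_mxEr ord1 !mxE eqxx mulr1n; congr has_slope; apply: funext => y.
by rewrite row_mxEr !mxE eqxx mulr1n.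
Qed.

(** The normals to [E] and to [S] annihilate the velocities of
    [(x, al)] and of [x]; the scalar product of [v + w + mu *: x = 0] with the
    velocity of [x] then leaves only two terms. *)
Lemma curve_identity n (E : set 'rV[R]_(n + 1)) (S : set 'rV[R]_n) (tau : R)
  (x v w : R -> 'rV[R]_n) (al mu : R -> R) a b :
  definable E -> definable S -> dmap x -> dmap v -> dmap w -> dfun al -> dfun mu ->
  a < b ->
  on_itv a b (fun s => [/\ approx_normal E (rV_pair (x s) (al s)) (rV_pair (v s) (- tau)),
    approx_normal S (x s) (w s) & v s + w s + mu s *: x s = 0]) ->
  exists s x' al', [/\ a < s < b, has_slopeV x s x', has_slope al s al' &
    tau * al' + mu s * dot (x s) x' = 0].
Proof.
move=> dE dS dx dv dw dal dmu ab nor.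
have [a1 [b1 [ab1 h1]]] := differentiableV dx ab; have [_ ab1' _] := ab1.
have [a2 [b2 [ab2 h2]]] := differentiableV dv ab1'; have [_ ab2' _] := ab2.
have [a3 [b3 [ab3 h3]]] := differentiableV dw ab2'; have [_ ab3' _] := ab3.
have [a4 [b4 [ab4 h4]]] := definable_differentiable dal ab3'; have [_ ab4' _] := ab4.
pose s := (a4 + b4) / 2; have sI : a4 < s < b4 by rewrite /s; apply/andP; split; lra.
have s3 : a3 < s < b3 by have [? _ ?] := ab4; case/andP: sI => *; apply/andP; split; lra.
have s2 : a2 < s < b2 by have [? _ ?] := ab3; case/andP: s3 => *; apply/andP; split; lra.
have s1 : a1 < s < b1 by have [? _ ?] := ab2; case/andP: s2 => *; apply/andP; split; lra.
have s0 : a < s < b by have [? _ ?] := ab1; case/andP: s1 => *; apply/andP; split; lra.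
have [x' xx'] := h1 s s1; have [v' vv'] := h2 s s2; have [w' ww'] := h3 s s3.
have [al' alal'] := h4 s sI.
exists s, x', al'; split=> //.
have sb : s < b by case/andP: s0.
have norI y : s < y < b -> a < y < b by move=> /andP[sy yb]; case/andP: s0 => *; apply/andP; split; lra.
have dE0 : dot (rV_pair (v s) (- tau)) (rV_pair x' al') = 0.
  apply: (approx_normal_slope (u := fun s => rV_pair (v s) (- tau))
    (z := fun s => rV_pair (x s) (al s)) dE _ _ sb).
  - by definability.
  - by definability.
  - by move=> y /norI/nor[].
  - exact: has_slopeV_pair.
  - move=> i; apply: (has_slope_continuous (g := fun y => rV_pair (v y) (- tau) 0 i)).
    exists (rV_pair v' 0 0 i); apply: (has_slopeV_pair vv') => e e0; exists 1 => // y _.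
    by rewrite subrr mul0r subr0 normr0 mulr_ge0 // ltW.
have dS0 : dot (w s) x' = 0.
  apply: (approx_normal_slope dS dx dw sb) => //.
    by move=> y /norI/nor[].
  by move=> i; apply: has_slope_continuous; exists (w' 0 i).
have [_ _ eq0] := nor s s0.
have : dot (v s + w s + mu s *: x s) x' = 0 by rewrite eq0 /dot big1 // => i _; rewrite mxE mul0r.
rewrite !dotDl dotZl dS0 addr0; move: dE0; rewrite dot_rV_pair.
move: (dot (v s) x') (dot (x s) x') => p q; lra.
Qed.

(** The derivative of [enorm (x s) ^+ 2 = c s ^+ 2], divided by 2. *)
Lemma enorm_slope n (x : R -> 'rV[R]_n) (c : R -> R) s x' c' a b : a < s < b ->
  on_itv a b (fun y => enorm (x y) = c y) -> has_slopeV x s x' -> is_derive s 1 c c' ->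
  dot (x s) x' = c s * c'.
Proof.
move=> sI xc xx' cc'.
have h1 : is_derive s 1 (\sum_(i < n) ((fun y => x y 0 i) * (fun y => x y 0 i)))
    (\sum_(i < n) (x s 0 i *: x' 0 i + x s 0 i *: x' 0 i)).
  by apply: is_derive_sum => i; have := has_slope_derive (xx' i) => hi; apply: is_deriveM.
have h2 : is_derive s 1 (c * c) (c s *: c' + c s *: c') by apply: is_deriveM.
have h3 : is_derive s 1 (c * c) (\sum_(i < n) (x s 0 i *: x' 0 i + x s 0 i *: x' 0 i)).
  apply: near_eq_is_derive h1.
  have : \forall y \near s, y \in `]a, b[ by apply: near_in_itvoo; rewrite in_itv.
  apply: filterS => y; rewrite in_itv /= => yI.
  rewrite /= fct_sumE; transitivity (c y ^+ 2); last by rewrite expr2.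
  by rewrite -(xc y yI) enorm_sqr.
have := @derive_val _ _ _ _ _ _ _ h2; rewrite (@derive_val _ _ _ _ _ _ _ h3) => h.
have : dot (x s) x' *+ 2 = (c s * c') *+ 2.
  by rewrite mulr2n -big_split /= mulr2n.
by move=> /(@pmulrnI _ 2 isT).
Qed.

End CurveNormals.

(** * Tangency along definable curves *)

Section Tangency.
Context {R : realType}.

Lemma pol_meval n (p : mpoly.mpoly n R) :
  pol (fun x : 'rV[R]_n => mpoly.meval (fun i => x 0 i) p).
Proof.
apply: (eq_pol (p := fun x : 'rV[R]_n => \sum_(m <- mpoly.msupp p)
    mpoly.mcoeff m p * \prod_(i < n) x 0 i ^+ (mpoly.fun_of_multinom m i))).
  by move=> x; rewrite mpoly.mevalE.
apply: pol_sum => m; apply: pol_mul; first exact: pol_cst.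
apply: pol_prod => i; apply: pol_exp.
by apply: eq_pol (pol_coord (i : nat)) => x; rewrite nth_coord_row.
Qed.

Lemma semialgebraic_definable n (A : set 'rV[R]_n) : semialgebraic A -> definable A.
Proof.
move=> [s ->]; elim: s => [|[P Q] s IH].
  by apply: eq_definable (definable_cst False) => x.
have dP : definable (fun x : 'rV[R]_n =>
    all (fun p => mpoly.meval (fun i => x 0 i) p == 0) P).
  elim: P => [|p P IHP]; first by apply: eq_definable (definable_cst True) => x.
  apply: eq_definable (definable_and (definable_eq0 (pol_meval p)) IHP) => x.
  by rewrite /=; split=> [[/eqP -> ->]|/andP[/eqP]].
have dQ : definable (fun x : 'rV[R]_n =>
    all (fun p => 0 < mpoly.meval (fun i => x 0 i) p) Q).
  elim: Q => [|p Q IHQ]; first by apply: eq_definable (definable_cst True) => x.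
  apply: eq_definable (definable_and (definable_gt0 (pol_meval p)) IHQ) => x.
  by rewrite /=; split=> [[-> ->]|/andP[]].
apply: eq_definable (definable_or (definable_and dP dQ) IH) => x.
by rewrite /= /basic_semialg /=; split=> [[/andP ->|->]|/orP[/andP|]]; rewrite ?orbT //; [left|right].
Qed.

Lemma rV_pair_inj n (x y : 'rV[R]_n) (a b : R) :
  rV_pair x a = rV_pair y b -> x = y /\ a = b.
Proof.
move=> /eq_row_mx[-> ab]; split=> //.
by have := congr1 (fun M : 'M[R]_1 => M 0 0) ab; rewrite !mxE eqxx !mulr1n.
Qed.

Variables (n : nat) (f : 'rV[R]_n -> \bar R) (S : set 'rV[R]_n).
Hypothesis f_proper : forall x, f x != -oo%E.
Hypothesis f_semialg : semialgebraic_efun f.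
Hypothesis S_semialg : semialgebraic S.

Let dS : definable S. Proof. exact: semialgebraic_definable. Qed.

Lemma definable_graph : definable (fun p : 'rV[R]_n * R => f p.1 = p.2%:E).
Proof.
have dG := semialgebraic_definable f_semialg.
have dG' : definable (fun p : 'rV[R]_n * R =>
    [set rV_pair z.1 z.2 | z in [set z : 'rV[R]_n * R | f z.1 = z.2%:E]] (rV_pair p.1 p.2)).
  by apply: (definable_comp (F := fun p : 'rV[R]_n * R => rV_pair p.1 p.2) dG); definability.
apply: eq_definable dG' => -[x a] /=; split=> [[[y b] /= fyb /rV_pair_inj[<- <-]] //|fx].
by exists (x, a).
Qed.

Lemma definable_epi : definable (epi f).
Proof.
have dG := definable_graph.
apply: (eq_definable (A := fun y => exists x, exists a, exists b,
   f x = b%:E /\ b <= a /\ y = rV_pair x a)).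
  move=> y; split=> [[x [a [b [fx [ba ->]]]]]|[[x a] /= fx <-]].
    by exists (x, a) => //=; rewrite fx lee_fin.
  have := f_proper x; case fxE: (f x) fx => [b| |] //=; rewrite lee_fin => ba _.
  by exists x, a, b.
by definability_with ltac:(apply: (definable_comp (F := fun p => (p.1.1.2, p.2)) dG)).
Qed.

(** For [tau = 1] this is the relation that defines the tangency variety,
    with approximate normals; for [tau = 0] and [mu != 0] it says that the
    sphere through [x] is not transverse to the pair [f, S] at [x]. *)
Definition tangent_at tau x al v w mu :=
  [/\ f x = al%:E, S x, approx_normal (epi f) (rV_pair x al) (rV_pair v (- tau)),
      approx_normal S x w & v + w + mu *: x = 0].

Lemma definable_tangent_at T {c : context T} tau (x v w : T -> 'rV[R]_n) (al mu : T -> R) :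
  dmap x -> dfun al -> dmap v -> dmap w -> dfun mu ->
  definable (fun t => tangent_at tau (x t) (al t) (v t) (w t) (mu t)).
Proof.
move=> dx dal dv dw dmu.
have dG := definable_graph; have dE := definable_approx_normal definable_epi.
have dN := definable_approx_normal dS.
have h0 : definable (fun t => f (x t) = (al t)%:E).
  by apply: (definable_comp (F := fun t => (x t, al t)) dG); definability.
have h1 : definable (fun t => S (x t)) by apply: definable_comp dS dx.
have h2 : definable (fun t => approx_normal (epi f) (rV_pair (x t) (al t)) (rV_pair (v t) (- tau))).
  by apply: (definable_comp (F := fun t => (rV_pair (x t) (al t), rV_pair (v t) (- tau))) dE); definability.
have h3 : definable (fun t => approx_normal S (x t) (w t)).
  by apply: (definable_comp (F := fun t => (x t, w t)) dN); definability.
have h4 : definable (fun t => v t + w t + mu t *: x t = 0) by definability.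
apply: eq_definable (definable_and h0 (definable_and h1 (definable_and3 h2 h3 h4))) => t.
by split=> [[? [? []]]|[]].
Qed.

(** The points and the multipliers are chosen definably, one after the other. *)
Lemma tangent_curve tau (P : R -> 'rV[R]_n -> R -> R -> Prop) a b :
  definable (fun p : R * 'rV[R]_n * R * R => P p.1.1.1 p.1.1.2 p.1.2 p.2) -> a < b ->
  on_itv a b (fun s => exists x al mu v w, tangent_at tau x al v w mu /\ P s x al mu) ->
  exists (x : R -> 'rV[R]_n) (al mu : R -> R) s x' al', [/\ a < s < b,
    has_slopeV x s x', has_slope al s al',
    tau * al' + mu s * dot (x s) x' = 0 &
    on_itv a b (fun s => P s (x s) (al s) (mu s))].
Proof.
move=> dP ab hab.
pose Q s x al mu v w := tangent_at tau x al v w mu /\ P s x al mu.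
have dQ T (c : context T) (s : T -> R) (x v w : T -> 'rV[R]_n) (al mu : T -> R) :
    dfun s -> dmap x -> dfun al -> dmap v -> dmap w -> dfun mu ->
    definable (fun t => Q (s t) (x t) (al t) (mu t) (v t) (w t)).
  move=> ds dx dal dv dw dmu; apply: definable_and; first exact: definable_tangent_at.
  apply: (definable_comp (F := fun t => (s t, x t, al t, mu t)) dP).
  by do ?apply: dmap_pair => //; apply: dfun_dmap.
have d1 : definable (fun p : R * 'rV[R]_n => exists al mu v w, Q p.1 p.2 al mu v w).
  by definability_with ltac:(apply: dQ).
have [x dx xP] := definable_choiceV (A := fun s x => exists al mu v w, Q s x al mu v w) d1.
have d2 : definable (fun p : R * R => exists mu v w, Q p.1 (x p.1) p.2 mu v w).
  by definability_with ltac:(first [apply: dQ | apply: (dmap_comp dx)]).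
have [al dal alP] := definable_choice (A := fun s al => exists mu v w, Q s (x s) al mu v w) d2.
have d3 : definable (fun p : R * R => exists v w, Q p.1 (x p.1) (al p.1) p.2 v w).
  by definability_with ltac:(first [apply: dQ | apply: (dmap_comp dx) | apply: (dfun_comp dal)]).
have [mu dmu muP] := definable_choice (A := fun s mu => exists v w, Q s (x s) (al s) mu v w) d3.
have d4 : definable (fun p : R * 'rV[R]_n => exists w, Q p.1 (x p.1) (al p.1) (mu p.1) p.2 w).
  by definability_with ltac:(first [apply: dQ | apply: (dmap_comp dx) | apply: (dfun_comp dal)
    | apply: (dfun_comp dmu)]).
have [v dv vP] := definable_choiceV (A := fun s v => exists w, Q s (x s) (al s) (mu s) v w) d4.
have d5 : definable (fun p : R * 'rV[R]_n => Q p.1 (x p.1) (al p.1) (mu p.1) (v p.1) p.2).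
  by definability_with ltac:(first [apply: dQ | apply: (dmap_comp dx) | apply: (dfun_comp dal)
    | apply: (dfun_comp dmu) | apply: (dmap_comp dv)]).
have [w dw wP] := definable_choiceV (A := fun s w => Q s (x s) (al s) (mu s) (v s) w) d5.
have allP s : a < s < b -> Q s (x s) (al s) (mu s) (v s) (w s).
  by move=> sI; apply/wP/vP/muP/alP/xP/hab.
have [|s [x' [al' [sI xx' alal' eq0]]]] :=
    curve_identity (tau := tau) definable_epi dS dx dv dw dal dmu ab.
  by move=> s /allP[[]].
exists x, al, mu, s, x', al'; split=> //.
by move=> t /allP[].
Qed.

Lemma has_slope_id (g : R -> R) a b s l : a < s < b -> on_itv a b (fun y => g y = y) ->
  has_slope g s l -> l = 1.
Proof.
move=> /andP[as0 sb] gE gl; apply: has_slope_unique gl _ => e e0.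
exists (Num.min (s - a) (b - s)); first by rewrite lt_min !subr_gt0 as0.
move=> x; rewrite lt_min !ltr_norml => /andP[/andP[? ?] /andP[? ?]].
rewrite !gE ?as0 //; last by apply/andP; split; lra.
by rewrite mul1r subrr normr0 mulr_ge0 // ltW.
Qed.

(** Otherwise choose a tangency point [x s] of norm [t] and value [s] for each
    [s] in the interval.  In [curve_identity] the norm is constant, so the term
    with [mu] vanishes, whereas the derivative of the value is 1. *)
Lemma sphere_values_no_itv t a b : a < b ->
  ~ on_itv a b (fun y => exists x v w mu, tangent_at 1 x y v w mu /\ enorm x = t).
Proof.
move=> ab h.
have [||x [al [mu [s [x' [al' [sI xx' alal' eq0 P]]]]]]] :=
    @tangent_curve 1 (fun s x al mu => al = s /\ enorm x = t) a b _ ab.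
- by definability.
- by move=> s /h[x [v [w [mu [xt ?]]]]]; exists x, s, mu, v, w; split.
have xx0 : dot (x s) x' = 0.
  rewrite (@enorm_slope _ _ x (cst t) s x' 0 a b sI) ?mulr0 //.
  by move=> y /P[].
have al1 : al' = 1 by apply: (has_slope_id sI _ alal') => y /P[].
by move: eq0; rewrite xx0 al1; lra.
Qed.

(** The argument of [sphere_values_no_itv], where the term with [mu] vanishes
    because [mu = 0]. *)
Lemma critical_values_finite : exists s : seq R, forall y,
  (exists x v w, tangent_at 1 x y v w 0) -> y \in s.
Proof.
have dA : definable (fun y : R => exists x v w, tangent_at 1 x y v w 0).
  by definability_with ltac:(apply: definable_tangent_at).
case: (definable_finite_or_itv dA) => // -[a [b [ab h]]]; exfalso.
have [||x [al [mu [s [x' [al' [sI xx' alal' eq0 P]]]]]]] :=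
    @tangent_curve 1 (fun s x al mu => al = s /\ mu = 0) a b _ ab.
- by definability.
- by move=> s /h[x [v [w xt]]]; exists x, s, 0, v, w; split.
have al1 : al' = 1 by apply: (has_slope_id sI _ alal') => y /P[].
by move: eq0; have [_ ->] := P s sI; rewrite al1; lra.
Qed.

(** Otherwise there would be such points, with [mu != 0], on every large
    sphere.  Along a definable choice of them with [enorm (x s) = s],
    [curve_identity] reads [mu s * s = 0]. *)
Lemma spheres_transverse : ev_pinfty (fun t => forall x al v w mu,
  tangent_at 0 x al v w mu -> enorm x = t -> mu = 0).
Proof.
have dA : definable (fun t : R => forall x al v w mu,
    tangent_at 0 x al v w mu -> enorm x = t -> mu = 0).
  by definability_with ltac:(apply: definable_tangent_at).
case: (definable_pinfty dA) => // -[c hc]; exfalso.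
pose a := Num.max c 0; have ab : a < a + 1 by lra.
have [ca a0] : c <= a /\ 0 <= a by rewrite !le_max !lexx orbT.
have [||x [al [mu [s [x' [al' [sI xx' alal' eq0 P]]]]]]] :=
    @tangent_curve 0 (fun s x al mu => enorm x = s /\ mu != 0) a (a + 1) _ ab.
- by definability.
- move=> s /andP[as0 _]; apply: contrapT => h; apply: (hc s); first lra.
  move=> x al v w mu tx xs; apply/eqP/negPn/negP => mu0; apply: h.
  by exists x, al, mu, v, w.
have xx1 : dot (x s) x' = s.
  rewrite (@enorm_slope _ _ x id s x' 1 a (a + 1) sI) ?mulr1 //.
  by move=> y /P[].
have [_ mu0] := P s sI.
move: eq0; rewrite xx1 mul0r add0r => /eqP; rewrite mulf_eq0 (negPf mu0) /=.
by case/andP: sI => as0 _; rewrite gt_eqF //; lra.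
Qed.

End Tangency.

(** * Penalization *)

Section Penalization.
Context {R : realType}.

Lemma ereal_between (i x : \bar R) : (i < x)%E -> exists a : R, (i < a%:E)%E /\ (a%:E < x)%E.
Proof.
case: i => [r| |]; case: x => [s| |] //=.
- by rewrite lte_fin => rs; exists ((r + s) / 2); rewrite !lte_fin; split; lra.
- by move=> _; exists (r + 1); rewrite lte_fin ltry; split=> //; lra.
- by move=> _; exists (s - 1); rewrite lte_fin ltNyr; split=> //; lra.
- by move=> _; exists 0; rewrite ltNyr ltry.
Qed.

(** If the infimum were not attained, [g] would stay near each point above some
    level larger than the infimum; by compactness, a single such level would
    bound [g] from below. *)
Lemma compact_lsc_min (T : topologicalType) (C : set T) (g : T -> \bar R) :
  compact C -> C !=set0 ->
  (forall x (a : R), C x -> (a%:E < g x)%E -> \forall y \near x, (a%:E < g y)%E) ->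
  exists2 x, C x & forall y, C y -> (g x <= g y)%E.
Proof.
move=> /compact_near_coveringP cC [x0 Cx0] lsc; apply: contrapT => nmin.
pose i := ereal_inf (g @` C).
have ltC x : C x -> (i < g x)%E.
  move=> Cx; apply: contrapT => /negP; rewrite -leNgt => gi; apply: nmin; exists x => // y Cy.
  by apply: le_trans gi _; apply: ereal_inf_lbound; exists y.
pose F := [set A : set R | exists b : R, (i < b%:E)%E /\ forall c, (i < c%:E)%E -> c <= b -> A c].
have FF : Filter F.
  split.
  - by have [b [ib _]] := ereal_between (ltC _ Cx0); exists b.
  - move=> A B [b [ib bA]] [b' [ib' bB]]; exists (Num.min b b'); split.
      by have [h|h] := leP b b'.
    by move=> c ic; rewrite le_min => /andP[cb cb']; split; [exact: bA|exact: bB].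
  - by move=> A B AB [b [ib bA]]; exists b; split=> // c ic cb; apply/AB/bA.
have [|b [ib bP]] := cC R F (fun b x => (b%:E <= g x)%E) FF.
  move=> x Cx; have [a [ia ax]] := ereal_between (ltC x Cx).
  exists ([set y | a%:E < g y]%E, [set b | b <= a]) => /=.
    by split; [exact: lsc|exists a].
  by move=> [y b] /= [ay ba]; apply: le_trans (ltW ay); rewrite lee_fin.
have ii : (b%:E <= i)%E.
  by apply: le_ereal_inf_tmp => _ [y Cy <-]; apply: (bP b ib (lexx _)).
by move: ib; rewrite ltNge ii.
Qed.

Lemma nbhs_coord_near n (x : 'rV[R]_n) (V : set 'rV[R]_n) :
  nbhs x V <-> exists2 d, 0 < d & forall y, coord_near d x y -> V y.
Proof.
split=> [/nbhs_ballP[d /= d0 dV]|[d d0 dV]].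
  exists d => // y xy; apply: dV; split=> // i j; rewrite (ord1 i).
  by rewrite /ball /= distrC; apply: xy.
apply/nbhs_ballP; exists d => //= y xy; apply: dV => i.
by have := xy.2 0 i; rewrite /ball /= distrC.
Qed.

Lemma cvg_dot n T (F : set_system T) {FF : Filter F} (u v : T -> 'rV[R]_n) a b :
  u @ F --> a -> v @ F --> b -> (dot (u t) (v t)) @[t --> F] --> dot a b.
Proof.
move=> ua vb; rewrite /dot; elim: (index_enum 'I_n) => [|i r IH].
  by rewrite big_nil; under eq_cvg do rewrite big_nil; apply: cvg_cst.
rewrite big_cons; under eq_cvg do rewrite big_cons; apply: cvgD => //.
have coordE (w : T -> 'rV[R]_n) (d : 'rV[R]_n) : w @ F --> d -> (w t 0 i) @[t --> F] --> d 0 i.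
  by move=> wd; exact: (@cvg_comp _ _ _ w (fun x : 'rV[R]_n => x 0 i) F _ _ wd (@coord_continuous R 1 n 0 i d)).
by apply: cvgM; apply: coordE.
Qed.

Lemma dot_eq0 n (u : 'rV[R]_n) : dot u u = 0 -> u = 0.
Proof.
move=> /eqP; rewrite psumr_eq0 => [/allP h|i _]; last by rewrite -expr2 sqr_ge0.
apply/rowP => i; have := h i; rewrite mem_index_enum => /(_ isT).
by rewrite mulf_eq0 orbb mxE => /eqP.
Qed.

Lemma dot_sqrD n (u v : 'rV[R]_n) :
  dot (u + v) (u + v) = dot u u + 2 * dot u v + dot v v.
Proof. rewrite !dotDl !dotDr (dotC v u); ring. Qed.

Lemma coord_le_enorm n (u : 'rV[R]_n) i : `|u 0 i| <= enorm u.
Proof.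
rewrite -(ler_pXn2r (n := 2)) ?nnegrE ?enorm_ge0 // enorm_sqr real_normK ?num_real //.
rewrite /dot (bigD1 i) //= expr2 lerDl; apply: sumr_ge0 => j _.
by rewrite -expr2 sqr_ge0.
Qed.

Lemma coord_near_enorm n d (x y : 'rV[R]_n) : coord_near d x y ->
  enorm (y - x) <= d *+ n.
Proof.
move=> xy; apply: le_trans (enorm_le_sum _) _.
rewrite -[X in _ *+ X]card_ord -sumr_const; apply: ler_sum => i _.
by have := ltW (xy i); rewrite !mxE.
Qed.

Lemma dot_le_norm n (u v : 'rV[R]_n) : `|dot u v| <= (\sum_(i < n) `|u 0 i|) * enorm v.
Proof.
apply: le_trans (ler_norm_sum _ _ _) _; rewrite mulr_suml; apply: ler_sum => i _.
by rewrite normrM ler_wpM2l // coord_le_enorm.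
Qed.

(** The form in which minimality of a penalized function provides regular
    normals: a linear bound up to a quadratic error. *)
Lemma regular_normal_quadratic n (S : set 'rV[R]_n) x v d C : 0 < d -> 0 <= C ->
  (forall y, S y -> coord_near d x y -> dot v (y - x) <= C * dot (y - x) (y - x)) ->
  regular_normal S x v.
Proof.
move=> d0 C0 h; apply/regular_normalP => e e0.
pose r := e / (C * n%:R + 1).
have n0 : 0 <= C * n%:R :> R by rewrite mulr_ge0.
have r0 : 0 < r by rewrite divr_gt0 //; lra.
exists (Num.min d r); first by rewrite lt_min d0.
move=> y Sy xy; have xd : coord_near d x y.
  by move=> i; apply: lt_le_trans (xy i) _; rewrite ge_min lexx.
have xr : coord_near r x y.
  by move=> i; apply: lt_le_trans (xy i) _; rewrite ge_min lexx orbT.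
apply: le_trans (h y Sy xd) _; rewrite -enorm_sqr expr2 mulrA.
apply: ler_wpM2r; first exact: enorm_ge0.
apply: le_trans (_ : C * (r *+ n) <= _); first by rewrite ler_wpM2l // coord_near_enorm.
rewrite -mulr_natr mulrCA /r mulrAC ler_pdivrMr; last by lra.
by rewrite ler_pM2l //; lra.
Qed.

Lemma regular_normal_scale n (S : set 'rV[R]_n) x v a : 0 < a ->
  regular_normal S x v -> regular_normal S x (a *: v).
Proof.
move=> a0 /regular_normalP vN; apply/regular_normalP => e e0.
have [|d d0 dP] := vN (e / a); first by rewrite divr_gt0.
exists d => // y Sy xy; rewrite dotZl mulrC -ler_pdivlMr //.
by rewrite mulrAC; apply: dP.
Qed.

Variables (n : nat) (f : 'rV[R]_n -> \bar R) (S : set 'rV[R]_n).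
Hypothesis f_proper : forall x, f x != -oo%E.
Hypothesis f_lsc : lower_semicontinuous f.
Hypothesis S_closed : closed S.

Let lsc_near x (a : R) : (a%:E < f x)%E -> \forall y \near x, (a%:E < f y)%E.
Proof. by move=> /f_lsc[V xV Vf]; apply: filterS xV. Qed.

Variables (y : 'rV[R]_n) (al c t2 : R).
Hypothesis Sy : S y.
Hypothesis fy : f y = al%:E.
Hypothesis y_constraint : c * (dot y y - t2) = 0.
Hypothesis y_min : forall x, S x -> c * (dot x x - t2) = 0 -> (al%:E <= f x)%E.

Let box : set 'rV[R]_n := [set x | forall i, `|x 0 i - y 0 i| <= 1].

Let box_compact : compact box.
Proof.
have := @rV_compact R n (fun i => `[y 0 i - 1, y 0 i + 1]%classic)
  (fun i => @segment_compact R _ _).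
congr compact; apply/seteqP; split=> x /= h i; have := h i; rewrite ?in_itv /=.
  by rewrite ler_norml => /andP[? ?]; apply/andP; split; lra.
by rewrite ler_norml => /andP[? ?]; apply/andP; split; lra.
Qed.

Let q (x : 'rV[R]_n) := c * (dot x x - t2).

Let pen (p : 'rV[R]_n * 'rV[R]_n) := dot (p.1 - p.2) (p.1 - p.2) + q p.1 ^+ 2.

Let dist (p : 'rV[R]_n * 'rV[R]_n) := dot (p.1 - y) (p.1 - y).

Let dom := box `*` (box `&` S).

Let dom_compact : compact dom.
Proof.
apply: compact_setX => //.
by apply: compact_closedI.
Qed.

Let penalized k p := (f p.1 + (dist p + k * pen p)%:E)%E.

Let cvgq (p : 'rV[R]_n * 'rV[R]_n) : q x.1 @[x --> p] --> q p.1.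
Proof.
rewrite /q; apply: cvgM; first exact: cvg_cst.
apply: cvgB; last exact: cvg_cst.
by apply: cvg_dot; apply: cvg_fst; exact: cvg_id.
Qed.

Let cvg_pen (p : 'rV[R]_n * 'rV[R]_n) : pen x @[x --> p] --> pen p.
Proof.
apply: cvgD; last first.
  have -> : (fun x : 'rV[R]_n * 'rV[R]_n => q x.1 ^+ 2) =
    (fun x : 'rV[R]_n * 'rV[R]_n => q x.1 * q x.1) by apply: funext => x; rewrite expr2.
  by rewrite expr2; apply: cvgM; exact: cvgq.
have c1 : x.1 @[x --> p] --> p.1 by exact: cvg_fst.
have c2 : x.2 @[x --> p] --> p.2 by exact: cvg_snd.
exact: (cvg_dot (cvgB c1 c2) (cvgB c1 c2)).
Qed.

Let cvg_dist (p : 'rV[R]_n * 'rV[R]_n) : dist x @[x --> p] --> dist p.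
Proof. by apply: cvg_dot; (apply: cvgB; [apply: cvg_fst; exact: cvg_id|exact: cvg_cst]). Qed.

Let lsc_fst (p : 'rV[R]_n * 'rV[R]_n) (a : R) :
  (a%:E < f p.1)%E -> \forall x \near p, (a%:E < f x.1)%E.
Proof. by move=> /lsc_near; apply: cvg_fst. Qed.

Let penalized_min k : exists2 p, dom p & forall p', dom p' -> (penalized k p <= penalized k p')%E.
Proof.
apply: compact_lsc_min => //.
  by exists (y, y); split; [|split] => //= i; rewrite subrr normr0.
move=> p a _; rewrite /penalized; set s := dist p + k * pen p => h.
have cs : (dist x + k * pen x) @[x --> p] --> s.
  by apply: cvgD; [exact: cvg_dist|apply: cvgM; [exact: cvg_cst|exact: cvg_pen]].
have [b [ab bf]] : exists b : R, a < b + s /\ (b%:E < f p.1)%E.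
  have : ((a - s)%:E < f p.1)%E.
    by case: (f p.1) h => [r| |] //=; rewrite -?EFinD ?lte_fin ?ltry //; lra.
  move=> /ereal_between[b [h1 h2]]; exists b; split=> //.
  by move: h1; rewrite lte_fin; lra.
have [e0 nearf] : 0 < b + s - a /\ \forall x \near p, (b%:E < f x.1)%E.
  by split; [lra|exact: lsc_fst].
have sb : s - (b + s - a) < s by lra.
have nears : \forall x \near p, s - (b + s - a) < dist x + k * pen x.
  by apply: (@cvgr_gt R _ _ _ _ _ cs _ sb).
apply: filterS2 nearf nears => x bx sx.
case: (f x.1) bx => [r| |] //=; rewrite -?EFinD ?lte_fin ?ltry //; lra.
Qed.

(** Each point of the compact domain has a neighbourhood in which, for large
    [k], either the conclusion holds (near [(y, y)]) or the penalized value
    exceeds [al]: because the penalty is positive, or because the point is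
    feasible and different from [y]. *)
Let penalized_close d : 0 < d -> exists2 k, 0 < k & forall p, dom p ->
  (penalized k p <= al%:E)%E ->
  [/\ coord_near d y p.1, coord_near d y p.2 & ((al - d)%:E < f p.1)%E].
Proof.
move=> d0.
have pen_ge0 p : 0 <= pen p by rewrite addr_ge0 ?dot_ge0 ?sqr_ge0.
have dist_ge0 p : 0 <= dist p by exact: dot_ge0.
have /compact_near_coveringP/near_covering_withinP cov := dom_compact.
have [|K [_ KP]] := cov R (+oo : set_system R) (fun k p => 0 < k -> (penalized k p <= al%:E)%E ->
  [/\ coord_near d y p.1, coord_near d y p.2 & ((al - d)%:E < f p.1)%E]) _.
  move=> p dp; have [p0|pn0] := eqVneq (pen p) 0; last first.
    have penp : 0 < pen p by rewrite lt_neqAle eq_sym pn0 pen_ge0.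
    have [b [_ bf]] : exists b : R, (-oo < b%:E)%E /\ (b%:E < f p.1)%E.
      by apply: ereal_between; rewrite ltNye.
    pose K := Num.max 0 ((al - b) / (pen p / 2)).
    exists ([set x : 'rV[R]_n * 'rV[R]_n | (b%:E < f x.1)%E /\ pen p / 2 < pen x], [set k | K < k]) => /=.
      split; last by exists K; rewrite num_real.
      have pen2 : pen p / 2 < pen p by lra.
      have n1 : \forall x \near p, pen p / 2 < pen x.
        by apply: (@cvgr_gt R _ _ _ _ _ (@cvg_pen p) _ pen2).
      by apply: filterS2 (lsc_fst bf) n1 => x.
    move=> [x k] /= [[bx px] Kk] _ k0; rewrite /penalized.
    have h : al < b + (dist x + k * pen x).
      have : (al - b) / (pen p / 2) < k by apply: le_lt_trans Kk; rewrite le_max lexx orbT.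
      rewrite ltr_pdivrMr; last by lra.
      have := dist_ge0 x; have : k * (pen p / 2) <= k * pen x by rewrite ler_pM2l // ltW.
      lra.
    by case: (f x.1) bx => [r| |] //=; rewrite -EFinD lte_fin lee_fin; lra.
  move: p0 => /eqP; rewrite paddr_eq0 ?dot_ge0 ?sqr_ge0 // => /andP[/eqP/dot_eq0/eqP].
  rewrite subr_eq0 sqrf_eq0 => /eqP p12 /eqP q0.
  have Sp : S p.1 by rewrite p12; case: dp => _ [].
  have alp : (al%:E <= f p.1)%E by apply: y_min.
  have [py|py] := eqVneq p.1 y.
    exists ([set x : 'rV[R]_n * 'rV[R]_n | [/\ coord_near d y x.1, coord_near d y x.2 & ((al - d)%:E < f x.1)%E]], setT) => /=.
      split; last exact: filterT.
      have near_y (z : 'rV[R]_n) : z = y -> \forall x \near z, coord_near d y x.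
        by move=> ->; apply/nbhs_coord_near; exists d.
      have n1 : \forall x \near p, coord_near d y x.1 by apply: cvg_fst; apply: near_y.
      have n2 : \forall x \near p, coord_near d y x.2.
        by apply: cvg_snd; apply: near_y; rewrite -p12.
      have n3 : \forall x \near p, ((al - d)%:E < f x.1)%E.
        by apply: lsc_fst; rewrite py fy lte_fin; lra.
      by apply: filterS3 n1 n2 n3 => x; split.
    by move=> [x k] /= [].
  have distp : 0 < dist p.
    rewrite lt_neqAle dist_ge0 andbT eq_sym; apply/eqP => /dot_eq0/eqP.
    by rewrite subr_eq0 (negPf py).
  exists ([set x : 'rV[R]_n * 'rV[R]_n | ((al - dist p / 2)%:E < f x.1)%E /\ dist p / 2 < dist x], setT) => /=.
    split; last exact: filterT.
    have dist2 : dist p / 2 < dist p by lra.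
    have n1 : \forall x \near p, dist p / 2 < dist x.
      by apply: (@cvgr_gt R _ _ _ _ _ (@cvg_dist p) _ dist2).
    have n2 : \forall x \near p, ((al - dist p / 2)%:E < f x.1)%E.
      by apply: lsc_fst; apply: lt_le_trans alp; rewrite lte_fin; lra.
    by apply: filterS2 n1 n2 => x.
  move=> [x k] /= [[bx px] _] _ k0; rewrite /penalized.
  have := mulr_ge0 (ltW k0) (pen_ge0 x).
  by case: (f x.1) bx => [r| |] //=; rewrite -EFinD lte_fin lee_fin; lra.
pose k := Num.max K 0 + 1.
have [Kk k0] : K < k /\ 0 < k by rewrite /k; split; [have : K <= Num.max K 0 by rewrite le_max lexx|
  have : 0 <= Num.max K 0 by rewrite le_max lexx orbT]; lra.
by exists k => // p dp; apply: (KP k).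
Qed.

(** The function [f x + |x - y|^2 + k (|x - u|^2 + q(x)^2)], with
    [q x = c (|x|^2 - t2)], is minimized over [x] near [y] and [u] in [S] near
    [y].  For large [k] the minimizers are close to [(y, y)] ([penalized_close]),
    hence interior, and the optimality conditions in [u] and in [x] give regular
    normals to [S] and to the epigraph, with [w = 2 k (x - u)] and
    [mu = 4 k c q(x)]. *)
Lemma fuzzy_multiplier d : 0 < d -> d < 1 -> exists x u w mu a,
  [/\ f x = a%:E, `|a - al| <= d, coord_near d y x, coord_near d y u &
   [/\ S u, regular_normal S u w, c = 0 -> mu = 0 &
   regular_normal (epi f) (rV_pair x a) (rV_pair (- (w + mu *: x + 2 *: (x - y))) (-1))]].
Proof.
move=> d0 d1; have [k k0 kP] := penalized_close d0.
have [[x u] dp pmin] := penalized_min k.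
have dyy : dom (y, y) by split; [|split] => //= i; rewrite subrr normr0.
have le_al : (penalized k (x, u) <= al%:E)%E.
  apply: le_trans (pmin _ dyy) _; rewrite /penalized /= fy /dist /pen /=.
  have d00 : dot (0 : 'rV[R]_n) 0 = 0 by rewrite /dot big1 // => i _; rewrite mxE mul0r.
  by rewrite /q y_constraint !subrr d00 expr0n /= !addr0 mulr0 addr0 adde0.
have [yx yu af] := kP _ dp le_al.
have [a fx] : exists a, f x = a%:E.
  by move: le_al af; rewrite /penalized /=; case: (f x) => // r _ _; exists r.
have Su : S u by case: dp => _ [].
pose w := (2 * k) *: (x - u); pose mu := 4 * k * q x * c.
exists x, u, w, mu, a; split=> //.
  move: af le_al; rewrite /penalized /= fx -EFinD lte_fin lee_fin /pen => h1 h2.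
  have := dot_ge0 (x - y); have := mulr_ge0 (ltW k0) (addr_ge0 (dot_ge0 (x - u)) (sqr_ge0 (q x))).
  by rewrite /dist /= in h2 *; move=> h3 h4; rewrite ler_norml; apply/andP; split; lra.
have box_near z z' : coord_near d y z -> coord_near (1 - d) z z' -> box z'.
  move=> yz zz' i; have := ler_normD (z' 0 i - z 0 i) (z 0 i - y 0 i).
  by rewrite subrKA; have := yz i; have := zz' i; lra.
have dd : 0 < 1 - d by lra.
split=> //; last 2 first.
- by move=> c0; rewrite /mu c0 mulr0.
(* Minimality in x, with the smooth terms expanded at x: C bounds all the
   quadratic terms for increments of norm at most n. *)
- pose X := \sum_(i < n) `|x 0 i|.
  pose C := 1 + k + `|2 * k * q x * c| + k * c ^+ 2 * (2 * X + n%:R) ^+ 2.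
  have C0 : 0 <= C.
    have h1 : 0 <= k * c ^+ 2 * (2 * X + n%:R) ^+ 2.
      by apply: mulr_ge0; [apply: mulr_ge0; [exact: ltW|exact: sqr_ge0]|exact: sqr_ge0].
    by have := normr_ge0 (2 * k * q x * c); rewrite /C; lra.
  apply: (regular_normal_quadratic dd C0) => z [[x' a'] /= fx' <-] near.
  set xi := x' - x.
  have -> : rV_pair x' a' - rV_pair x a = rV_pair xi (a' - a).
    by rewrite /rV_pair opp_row_mx add_row_mx raddfB.
  rewrite !dot_rV_pair.
  have near' : coord_near (1 - d) x x'.
    by move=> i; have := near (lshift 1 i); rewrite !row_mxEl.
  have := pmin (x', u); rewrite /penalized /= fx => /(_ _).
  have dx' : dom (x', u).
    by split; [apply: box_near near'|case: dp].
  move=> /(_ dx') le1.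
  have {le1} : a + (dist (x, u) + k * pen (x, u)) <= a' + (dist (x', u) + k * pen (x', u)).
    rewrite -lee_fin !EFinD; apply: le_trans le1 _; apply: leeD => //.
  have x'E : x' = x + xi by rewrite /xi addrC subrK.
  have E1 : dist (x', u) = dist (x, u) + 2 * dot (x - y) xi + dot xi xi.
    by rewrite /dist /= (_ : x' - y = x - y + xi) ?dot_sqrD // x'E addrAC.
  have E2 : dot (x' - u) (x' - u) = dot (x - u) (x - u) + 2 * dot (x - u) xi + dot xi xi.
    by rewrite (_ : x' - u = x - u + xi) ?dot_sqrD // x'E addrAC.
  have E3 : q x' = q x + c * (2 * dot x xi + dot xi xi).
    by rewrite /q x'E dot_sqrD; ring.
  rewrite /pen /= E1 E2 E3 => le1.
  have -> : dot (- (w + mu *: x + 2 *: (x - y))) xi =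
     - (2 * k * dot (x - u) xi + 4 * k * q x * c * dot x xi + 2 * dot (x - y) xi).
    by rewrite /w /mu -scaleN1r !(dotDl, dotZl); ring.
  have xiN : enorm xi <= n%:R.
    apply: le_trans (coord_near_enorm near') _; rewrite -[(1 - d) *+ n]mulr_natl ler_piMr //; lra.
  have bnd : (2 * dot x xi + dot xi xi) ^+ 2 <= (2 * X + n%:R) ^+ 2 * dot xi xi.
    rewrite -enorm_sqr -exprMn -ler_sqrt ?sqrtr_sqr; last by rewrite sqr_ge0.
    rewrite [X in _ <= X]ger0_norm; last first.
      by rewrite mulr_ge0 ?enorm_ge0 // addr_ge0 ?mulr_ge0 ?sumr_ge0.
    apply: le_trans (ler_normD _ _) _; rewrite [X in _ <= X]mulrDl; apply: lerD.
      rewrite normrM ger0_norm // -mulrA ler_wpM2l //; exact: dot_le_norm.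
    by rewrite normrX ger0_norm ?enorm_ge0 // expr2 ler_wpM2r ?enorm_ge0.
  have D0 := dot_ge0 xi.
  have b1 : k * (c ^+ 2 * (2 * dot x xi + dot xi xi) ^+ 2) <=
      k * c ^+ 2 * (2 * X + n%:R) ^+ 2 * dot xi xi.
    rewrite mulrA -[X in _ <= X]mulrA ler_wpM2l //; apply: mulr_ge0; [exact: ltW|exact: sqr_ge0].
  have b2 : 2 * k * q x * c * dot xi xi <= `|2 * k * q x * c| * dot xi xi.
    by rewrite ler_wpM2r // ler_norm.
  apply: le_trans (_ : C * dot xi xi <= _); last first.
    by rewrite ler_wpM2l // lerDl -expr2 sqr_ge0.
  rewrite /C; move: le1 b1 b2 D0; move: (k * c ^+ 2 * (2 * X + n%:R) ^+ 2) => T.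
  move: (dot xi xi) (dot x xi) (dot (x - y) xi) (dot (x - u) xi) (dot (x - u) (x - u)) => D E B A U.
  move: `|2 * k * q x * c| => N; move: (dist (x, u)) (q x) => dst Q le1 b1 b2 D0.
  have -> : (1 + k + N + T) * D = D + k * D + N * D + T * D by ring.
  move: le1; have -> : k * (U + 2 * A + D + (Q + c * (2 * E + D)) ^+ 2) =
    k * (U + Q ^+ 2) + 2 * k * A + k * D + 4 * k * Q * c * E + 2 * k * Q * c * D +
    k * (c ^+ 2 * (2 * E + D) ^+ 2) by ring.
  lra.
apply: (regular_normal_quadratic dd (ltW k0)) => z Sz near.
have duz : dom (x, z).
  by split; [case: dp|split=> //; apply: box_near near].
have := pmin _ duz; rewrite /penalized /= fx -!EFinD lee_fin /dist /pen /=.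
have E : dot (x - z) (x - z) = dot (x - u) (x - u) - 2 * dot (x - u) (z - u) + dot (z - u) (z - u).
  have -> : x - z = (x - u) + -1 *: (z - u) by rewrite scaleN1r opprB addrA subrK.
  by rewrite dot_sqrD dotZl !dotZr; ring.
rewrite E /w dotZl; move: (dot (x - u) (z - u)) => *; nra.
Qed.

End Penalization.

(** * The multiplier rule *)

Section Multiplier.
Context {R : realType}.

Lemma cvg_coord_near n (u : nat -> 'rV[R]_n) x :
  (forall k, coord_near k.+1%:R^-1 x (u k)) -> u @ \oo --> x.
Proof.
move=> ux V /nbhs_coord_near[d d0 dV].
have : \forall k \near \oo, k.+1%:R^-1 < d.
  have := near_infty_natSinv_lt (PosNum d0).
  by apply: filterS.
by apply: filterS => k kd; apply: dV => i; apply: lt_trans (ux k i) kd.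
Qed.

(** The converse of [limiting_approx]; the sequences are chosen with precision
    [1 / k.+1]. *)
Lemma approx_limiting n (S : set 'rV[R]_n) x v :
  approx_normal S x v -> limiting_normal S x v.
Proof.
move=> xv.
have h (k : nat) : exists p : 'rV[R]_n * 'rV[R]_n, [/\ coord_near k.+1%:R^-1 x p.1,
    coord_near k.+1%:R^-1 v p.2, S p.1 & regular_normal S p.1 p.2].
  have [|y [w yw]] := xv k.+1%:R^-1; first by rewrite invr_gt0 ltr0n.
  by exists (y, w).
have [p pP] := choice h.
exists (fun k => (p k).1), (fun k => (p k).2); split.
- by apply: cvg_coord_near => k; case: (pP k).
- by apply: cvg_coord_near => k; case: (pP k).
- by move=> k; case: (pP k).
Qed.

Lemma approx_normal_scale n (S : set 'rV[R]_n) x v a : 0 < a ->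
  approx_normal S x v -> approx_normal S x (a *: v).
Proof.
move=> a0 xv e e0.
have [|y [w [xy vw Sy wN]]] := xv (Num.min e (e / a)).
  by rewrite lt_min e0 divr_gt0.
exists y, (a *: w); split=> //; last exact: regular_normal_scale.
- by move=> i; apply: lt_le_trans (xy i) _; rewrite ge_min lexx.
- move=> i; rewrite !mxE -mulrBr normrM gtr0_norm // mulrC -ltr_pdivlMr //.
  by apply: lt_le_trans (vw i) _; rewrite ge_min lexx orbT.
Qed.

Lemma bounded_cluster n (u : nat -> 'rV[R]_n) :
  (forall k i, `|u k 0 i| <= 1) ->
  exists p, forall e J, 0 < e -> exists2 j, (J <= j)%N & coord_near e p (u j).
Proof.
move=> ub.
have cK : compact [set x : 'rV[R]_n | forall i, x 0 i \in `[-1, 1]%classic].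
  have := @rV_compact R n (fun i => `[(-1 : R), 1]%classic) (fun i => @segment_compact R _ _).
  by congr compact; apply/seteqP; split=> x /= h i; have := h i; rewrite ?in_setE.
have [|p [_ pc]] := cK (u @ \oo) _.
  exists 0%N => // k _ /= i; rewrite in_setE /= in_itv /= -ler_norml; exact: ub.
exists p => e J e0.
have [||x [[j Jj <-] pj]] := pc (u @` [set j | (J <= j)%N]) [set y | coord_near e p y].
- by exists J => // j /= Jj; exists j.
- by apply/nbhs_coord_near; exists e.
- by exists j.
Qed.

Lemma rV_pair_surj n (z : 'rV[R]_(n + 1)) : exists x a, z = rV_pair x a.
Proof.
by exists (lsubmx z), (rsubmx z 0 0); rewrite /rV_pair -mx11_scalar hsubmxK.
Qed.

Lemma coord_near_pair n e (x y : 'rV[R]_n) a b :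
  coord_near e (rV_pair x a) (rV_pair y b) <-> coord_near e x y /\ `|b - a| < e.
Proof.
split=> [h|[h1 h2] i].
  split=> [i|]; first by have := h (lshift 1 i); rewrite !row_mxEl.
  by have := h (rshift n 0); rewrite !row_mxEr !mxE eqxx !mulr1n.
case: (fintype.splitP i) => j ij.
  have -> : i = lshift 1 j by apply/val_inj.
  by rewrite !row_mxEl.
have -> : i = rshift n j by apply/val_inj.
by rewrite !row_mxEr ord1 !mxE eqxx !mulr1n.
Qed.

Variables (n : nat) (f : 'rV[R]_n -> \bar R) (S : set 'rV[R]_n).
Hypothesis f_proper : forall x, f x != -oo%E.
Hypothesis f_lsc : lower_semicontinuous f.
Hypothesis S_closed : closed S.

(** The fuzzy multipliers may be unbounded, so they are divided by
    [1 + |w| + |mu|].  A cluster point [(w, mu, s)] of the scaled multipliers and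
    of the scaling factor is not zero.  If [s > 0], division by [s] gives the
    rule; if [s = 0], the cluster point contradicts the last hypothesis. *)
Lemma multiplier_rule (y : 'rV[R]_n) (al c t2 : R) :
  S y -> f y = al%:E -> c * (dot y y - t2) = 0 ->
  (forall x, S x -> c * (dot x x - t2) = 0 -> (al%:E <= f x)%E) ->
  (forall v w mu, approx_normal (epi f) (rV_pair y al) (rV_pair v 0) ->
     approx_normal S y w -> (c = 0 -> mu = 0) -> v + w + mu *: y = 0 ->
     w = 0 /\ mu = 0) ->
  exists v w mu, [/\ approx_normal (epi f) (rV_pair y al) (rV_pair v (-1)),
    approx_normal S y w, c = 0 -> mu = 0 & v + w + mu *: y = 0].
Proof.
move=> Sy fy yc ymin nondeg.
pose d (j : nat) : R := j.+2%:R^-1.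
have d0 j : 0 < d j by rewrite invr_gt0 ltr0n.
have d1 j : d j < 1 by rewrite invf_lt1 ?ltr0n // ltr1n.
pose T : Type := ('rV[R]_n * 'rV[R]_n * 'rV[R]_n * R * R)%type.
have h j : exists p : T, let: (x, u, w, mu, a) := p in
  [/\ f x = a%:E, `|a - al| <= d j, coord_near (d j) y x, coord_near (d j) y u &
   [/\ S u, regular_normal S u w, c = 0 -> mu = 0 &
   regular_normal (epi f) (rV_pair x a) (rV_pair (- (w + mu *: x + 2 *: (x - y))) (-1))]].
  have [x [u [w [mu [a H]]]]] := fuzzy_multiplier f_proper f_lsc S_closed Sy fy yc ymin (d0 j) (d1 j).
  by exists (x, u, w, mu, a).
have {h}[p pP] := choice h.
pose x_ j := (p j).1.1.1.1; pose u_ j := (p j).1.1.1.2; pose w_ j := (p j).1.1.2.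
pose mu_ j := (p j).1.2; pose a_ j := (p j).2.
have {pP} pP j : [/\ f (x_ j) = (a_ j)%:E, `|a_ j - al| <= d j, coord_near (d j) y (x_ j),
   coord_near (d j) y (u_ j) &
   [/\ S (u_ j), regular_normal S (u_ j) (w_ j), c = 0 -> mu_ j = 0 &
   regular_normal (epi f) (rV_pair (x_ j) (a_ j))
     (rV_pair (- (w_ j + mu_ j *: x_ j + 2 *: (x_ j - y))) (-1))]].
  by have := pP j; rewrite /x_ /u_ /w_ /mu_ /a_; case: (p j) => [[[[? ?] ?] ?] ?].
pose W j := \sum_(i < n) `|w_ j 0 i|.
have W0 j : 0 <= W j by apply: sumr_ge0.
have wW j i : `|w_ j 0 i| <= W j.
  by rewrite /W (bigD1 i) //= lerDl; apply: sumr_ge0.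
pose s_ j := (1 + W j + `|mu_ j|)^-1.
have den0 j : 0 < 1 + W j + `|mu_ j| by have := W0 j; have := normr_ge0 (mu_ j); lra.
have s0 j : 0 < s_ j by rewrite invr_gt0.
have sE j : s_ j * (1 + W j + `|mu_ j|) = 1 by rewrite mulVf // gt_eqF.
have [|P Pcl] := @bounded_cluster _ (fun j => rV_pair (rV_pair (s_ j *: w_ j) (s_ j * mu_ j)) (s_ j)).
  have bound j r : `|r| <= 1 + W j + `|mu_ j| -> `|s_ j * r| <= 1.
    by move=> rb; rewrite normrM gtr0_norm // -(sE j) ler_pM2l.
  move=> j i; case: (fintype.splitP i) => k ik.
    have -> : i = lshift 1 k by apply/val_inj.
    rewrite row_mxEl; case: (fintype.splitP k) => k' kk'.
      have -> : k = lshift 1 k' by apply/val_inj.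
      rewrite row_mxEl mxE; apply: bound; have := wW j k'; have := normr_ge0 (mu_ j); lra.
    have -> : k = rshift n k' by apply/val_inj.
    rewrite row_mxEr ord1 mxE eqxx mulr1n; apply: bound; have := W0 j; lra.
  have -> : i = rshift (n + 1) k by apply/val_inj.
  rewrite row_mxEr ord1 mxE eqxx mulr1n -[s_ j]mulr1; apply: bound; rewrite normr1.
  have := W0 j; have := normr_ge0 (mu_ j); lra.
have [Q [s PE]] := rV_pair_surj P; have [w [mu QE]] := rV_pair_surj Q.
have cl e : 0 < e -> exists j, [/\ d j < e, coord_near e w (s_ j *: w_ j),
    `|s_ j * mu_ j - mu| < e & `|s_ j - s| < e].
  move=> e0; have [J _ Je] : \forall k \near \oo, k.+1%:R^-1 < e.
    by have := near_infty_natSinv_lt (PosNum e0); apply: filterS.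
  have [j Jj] := Pcl e J e0; rewrite PE QE => /coord_near_pair[/coord_near_pair[h1 h2] h3].
  exists j; split=> //; apply: lt_trans (Je j Jj).
  by rewrite ltf_pV2 ?posrE ?ltr0n // ltr_nat.
have s_ge0 : 0 <= s.
  have [//|sneg] := leP 0 s; have [|j [_ _ _ sj]] := cl (- s); first lra.
  suff : (1 : R) < 1 by rewrite ltxx.
  by have := s0 j; move: sj; rewrite ltr_norml => /andP[? ?] ?; lra.
have mu0 : c = 0 -> mu = 0.
  move=> c0; apply/eqP; rewrite -normr_le0 leNgt; apply/negP => mup.
  have [j [_ _ + _]] := cl _ mup; have [_ _ _ _ [_ _ -> // _]] := pP j.
  by rewrite mulr0 sub0r normrN ltxx.
have nz : ~ (w = 0 /\ mu = 0 /\ s = 0).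
  move=> [w0 [m0 ss0]].
  have [|j [_ cw cm cs]] := cl (2 * (n%:R + 2))^-1.
    by rewrite invr_gt0 mulr_gt0 // addr_gt0 // ltr0n.
  move: cw cm cs; rewrite w0 m0 ss0 !subr0; set e := _^-1 => cw cm cs.
  have e0 : 0 < e by rewrite invr_gt0 mulr_gt0 // addr_gt0 // ltr0n.
  have eE : e * (n%:R + 2) = 1 / 2.
    rewrite /e invfM mul1r -mulrA mulVf ?mulr1 // gt_eqF // addr_gt0 // ltr0n.
  have sW : s_ j * W j <= e * n%:R.
    rewrite /W mulr_sumr mulr_natr -[X in _ *+ X]card_ord -sumr_const.
    apply: ler_sum => i _; have := ltW (cw i).
    by rewrite !mxE subr0 normrM gtr0_norm.
  have sj := s0 j; rewrite (gtr0_norm sj) in cs; rewrite normrM (gtr0_norm sj) in cm.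
  suff : (1 : R) < 1 by rewrite ltxx.
  by have := sE j; rewrite !mulrDr mulr1; rewrite mulrDr in eE; lra.
have Nw : approx_normal S y w.
  move=> e e0; have [j [dj cw _ _]] := cl e e0.
  have [_ _ _ yu [Su wN _ _]] := pP j.
  exists (u_ j), (s_ j *: w_ j); split=> //; last exact: regular_normal_scale.
  by move=> i; apply: lt_trans (yu i) dj.
have Nv : approx_normal (epi f) (rV_pair y al) (rV_pair (- (w + mu *: y)) (- s)).
  move=> e e0; pose Y := \sum_(i < n) `|y 0 i|.
  have Y0 : 0 <= Y by apply: sumr_ge0.
  have yY i : `|y 0 i| <= Y by rewrite /Y (bigD1 i) //= lerDl; apply: sumr_ge0.
  (* The error is at most e' for w, e' * Y for mu *: y, and 3 * e' for the terms
     that contain x - y. *)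
  pose e' := e / (4 + Y); have Y4 : 0 < 4 + Y by lra.
  have e'0 : 0 < e' by rewrite divr_gt0.
  have e'E : e' * (4 + Y) = e by rewrite divfK // gt_eqF.
  have e'e : e' <= e by rewrite ler_pdivrMr // ler_peMr //; lra.
  have [j [dj cw cm cs]] := cl e' e'0.
  have [fx aal yx _ [_ _ _ vN]] := pP j.
  exists (rV_pair (x_ j) (a_ j)),
    (s_ j *: rV_pair (- (w_ j + mu_ j *: x_ j + 2 *: (x_ j - y))) (-1)); split.
  - apply/coord_near_pair; split=> [i|]; last lra.
    by apply: lt_trans (yx i) _; lra.
  - rewrite (_ : s_ j *: _ = rV_pair (s_ j *: - (w_ j + mu_ j *: x_ j + 2 *: (x_ j - y))) (- s_ j)); last first.
      by rewrite /rV_pair scale_row_mx scale_scalar_mx mulrN1.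
    apply/coord_near_pair; split=> [i|]; last first.
      by rewrite -opprD normrN; apply: lt_le_trans cs e'e.
    have wi := cw i; have xi := yx i; rewrite !mxE in wi xi *.
    have -> : s_ j * - (w_ j 0 i + mu_ j * x_ j 0 i + 2 * (x_ j 0 i - y 0 i)) - - (w 0 i + mu * y 0 i)
      = - ((s_ j * w_ j 0 i - w 0 i) + s_ j * mu_ j * (x_ j 0 i - y 0 i) +
        (s_ j * mu_ j - mu) * y 0 i + 2 * s_ j * (x_ j 0 i - y 0 i)) by ring.
    rewrite normrN.
    have smu : `|s_ j * mu_ j| <= 1.
      by rewrite normrM gtr0_norm // -(sE j) ler_pM2l //; have := W0 j; lra.
    have s1 : s_ j <= 1.
      by rewrite -(sE j) ler_peMr ?(ltW (s0 j)) //; have := W0 j; have := normr_ge0 (mu_ j); lra.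
    have t1 : `|s_ j * mu_ j * (x_ j 0 i - y 0 i)| <= e'.
      by rewrite normrM; apply: le_trans (ler_piMl _ smu) _ => //; lra.
    have t2' : `|(s_ j * mu_ j - mu) * y 0 i| <= e' * Y.
      by rewrite normrM; apply: ler_pM => //; lra.
    have t3 : `|2 * s_ j * (x_ j 0 i - y 0 i)| <= 2 * e'.
      rewrite -mulrA normrM ger0_norm // ler_pM2l // normrM (gtr0_norm (s0 j)).
      by apply: le_trans (ler_piMl _ s1) _ => //; lra.
    apply: le_lt_trans (ler_normD _ _) _; apply: le_lt_trans (lerD (ler_normD _ _) (lexx _)) _.
    apply: le_lt_trans (lerD (lerD (ler_normD _ _) (lexx _)) (lexx _)) _.
    by rewrite -e'E [X in _ < X]mulrDr; lra.
  - by exists (x_ j, a_ j) => //=; rewrite fx.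
  - exact: regular_normal_scale.
have [s00|spos] := eqVneq s 0; last first.
  have sp : 0 < s by rewrite lt_neqAle eq_sym spos.
  have sp' : 0 < s^-1 by rewrite invr_gt0.
  exists (- (s^-1 *: w + (s^-1 * mu) *: y)), (s^-1 *: w), (s^-1 * mu); split.
  - have := approx_normal_scale sp' Nv.
    by rewrite /rV_pair scale_row_mx scale_scalar_mx mulrN mulVf ?gt_eqF // scalerN scalerDr scalerA.
  - exact: approx_normal_scale.
  - by move=> /mu0 ->; rewrite mulr0.
  - by rewrite -addrA addNr.
exfalso; apply: nz.
have [||||] := nondeg (- (w + mu *: y)) w mu => //.
- by move: Nv; rewrite s00 oppr0.
- by rewrite -addrA addNr.
Qed.

End Multiplier.

(** * Continuous selections of thin families of values, and minimizers *)

Section Selections.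
Context {R : realType}.

Variable V : R -> R -> Prop.
Hypothesis dV : definable (fun p : R * R => V p.1 p.2).
Hypothesis V_thin : forall t a b, a < b -> ~ on_itv a b (V t).

Let dVt t : definable (V t).
Proof. by apply: (definable_comp (F := fun y => (t, y)) dV); definability. Qed.

(** Otherwise, by the intermediate value theorem, each level [y] between [a]
    and [b] is a value for arbitrarily large [t], hence for all [t] beyond some
    bound; by the covering argument the bound is the same on a subinterval. *)
Lemma selection_ev_gt_or_lt (g : R -> R) r a b :
  (forall t, r < t -> {for t, continuous g}) -> (forall t, r < t -> V t (g t)) -> a < b ->
  ev_pinfty (fun t => a < g t) \/ ev_pinfty (fun t => g t < b).
Proof.
move=> gc gV ab; apply: contrapT => /not_orP[na nb].
have hit T y : a < y < b -> exists2 t, T < t & V t y.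
  move=> /andP[ay yb].
  have [t1 Tt1 gt1] : exists2 t, Num.max r T < t & g t <= a.
    apply: contrapT => h; apply: na; exists (Num.max r T) => t Tt.
    by rewrite ltNge; apply/negP => ga; apply: h; exists t.
  have [t2 t12 gt2] : exists2 t, t1 < t & b <= g t.
    apply: contrapT => h; apply: nb; exists t1 => t Tt.
    by rewrite ltNge; apply/negP => ga; apply: h; exists t.
  move: Tt1; rewrite gt_max => /andP[rt1 Tt1].
  have [|||c] := @IVT R g t1 t2 y.
  - exact: ltW.
  - apply: continuous_in_subspaceT => t; rewrite inE /= in_itv /= => /andP[t1t _].
    by apply: gc; apply: lt_le_trans t1t.
  - by rewrite ge_min le_max; apply/andP; split; apply/orP; [left|right]; lra.
  rewrite in_itv /= => /andP[t1c _] gcy; exists c; first exact: lt_le_trans Tt1 t1c.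
  by rewrite -gcy; apply: gV; apply: lt_le_trans rt1 t1c.
pose A_ (N : nat) y := forall t, N%:R < t -> V t y.
have dA N : definable (A_ N) by rewrite /A_; definability_with
  ltac:(apply: (definable_comp (F := fun q : R * R => (q.2, q.1)) dV)).
have [|N [c [d [[ac cd db] cdA]]]] := definable_cover ab dA; last first.
  apply: (V_thin (t := N%:R + 1) cd) => y yI; apply: (cdA y yI); lra.
move=> y yI.
have dy : definable (fun t => V t y).
  by apply: (definable_comp (F := fun t => (t, y)) dV); definability.
case: (definable_pinfty dy) => -[T HT].
  exists (Num.bound `|T|) => t tT; apply: HT; apply: le_lt_trans tT.
  by apply: le_trans (ler_norm _) _; apply/ltW; apply: archi_boundP.
by have [t Tt Vty] := hit T y yI; case: (HT t Tt).
Qed.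

Lemma ev_pinfty_near (A : R -> Prop) : ev_pinfty A -> \forall t \near +oo, A t.
Proof. by move=> [b bA]; exists b; rewrite num_real. Qed.

Lemma selection_limit (g : R -> R) r :
  (forall t, r < t -> {for t, continuous g}) -> (forall t, r < t -> V t (g t)) ->
  exists l : \bar R, (g t)%:E @[t --> +oo] --> l.
Proof.
move=> gc gV.
pose E := [set c%:E | c in [set c | ev_pinfty (fun t => c < g t)]].
have up (a : R) : (a%:E < ereal_sup E)%E -> ev_pinfty (fun t => a < g t).
  move=> /ereal_sup_gt[_ [c [T Tc] <-]]; rewrite lte_fin => ac.
  by exists T => t /Tc; apply: lt_trans.
have dn (b : R) : (ereal_sup E < b%:E)%E -> ev_pinfty (fun t => g t < b).
  move=> /ereal_between[a [la]]; rewrite lte_fin => ab.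
  case: (selection_ev_gt_or_lt gc gV ab) => // ga; exfalso.
  suff : (a%:E <= ereal_sup E)%E by rewrite leNgt la.
  by apply: ereal_sup_ubound; exists a.
exists (ereal_sup E); case: (ereal_sup E) up dn => [l| |] up dn.
- apply: cvg_EFin; first by near=> t.
  apply/cvgrPdist_le => e e0.
  have /ev_pinfty_near h1 : ev_pinfty (fun t => l - e < g t) by apply: up; rewrite lte_fin; lra.
  have /ev_pinfty_near h2 : ev_pinfty (fun t => g t < l + e) by apply: dn; rewrite lte_fin; lra.
  apply: filterS2 h1 h2 => t /= h1 h2; rewrite ler_norml; apply/andP; split; lra.
- by apply/cvgeryP/cvgryPgt => A; apply/ev_pinfty_near/up; rewrite ltry.
- by apply/cvgerNyP/cvgrNyPlt => A; apply/ev_pinfty_near/dn; rewrite ltNyr.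
Unshelve. all: by end_near.
Qed.

(** The set of the [t] near which the values above [c] do not stay away from
    [c] is definable; it is bounded above, by the covering argument.  Beyond it, a
    continuous selection cannot leave the value [c]. *)
Lemma selection_ev_eq (g : R -> R) r c :
  (forall t, r < t -> {for t, continuous g}) -> (forall t, r < t -> V t (g t)) ->
  (forall t, r < t -> c <= g t) ->
  (forall T, exists2 t, T < t & g t = c) -> ev_pinfty (fun t => g t = c).
Proof.
move=> gc gV cg hit.
(* a time is good when the values above c stay away from c nearby *)
pose good t := exists e, 0 < e /\ forall t', `|t' - t| < e ->
  forall y, c < y -> y < c + e -> ~ V t' y.
have dgood : definable good by rewrite /good; definability_with
  ltac:(apply: (definable_comp (F := fun q : R * R * R * R => (q.1.2, q.2)) dV)).
have [T goodT] : ev_pinfty good.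
  case: (definable_pinfty dgood) => // -[T badT]; exfalso.
  pose A_ (N : nat) t := forall y, c < y -> y < c + N.+1%:R^-1 -> ~ V t y.
  have dA N : definable (A_ N) by rewrite /A_; definability_with
    ltac:(apply: (definable_comp (F := fun q : R * R => (q.1, q.2)) dV)).
  have TT : T < T + 1 by lra.
  have [|N [a [b [[Ta ab bT] abA]]]] := definable_cover TT dA.
    move=> t _.
    have [h|[e ce eV]] := definable_right c (dVt t).
      by case: h => e ce eV; case: (V_thin ce eV).
    have [N _ Ne] : \forall k \near \oo, k.+1%:R^-1 < e - c.
      have ec : 0 < e - c by lra.
      by have := near_infty_natSinv_lt (PosNum ec); apply: filterS.
    exists N => y cy yN; apply: eV; rewrite cy /=.
    have := Ne N (leqnn _); move: yN => /=; move: (N.+1%:R^-1) => q; lra.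
  have mI : a < (a + b) / 2 < b by apply/andP; split; lra.
  apply: (badT ((a + b) / 2)); first lra.
  exists (Num.min N.+1%:R^-1 ((b - a) / 2)); split.
    by rewrite lt_min invr_gt0 ltr0n /=; lra.
  move=> t' t'I y cy ye; apply: (abA t') => //.
    move: t'I; rewrite lt_min !ltr_norml => /andP[_ /andP[? ?]]; apply/andP; split; lra.
  apply: lt_le_trans ye _; rewrite lerD2l ge_min lexx //.
pose T' := Num.max T r.
have [TT' rT'] : T <= T' /\ r <= T' by rewrite !le_max !lexx orbT.
exists T' => t2 T't2; have [t1 T't1 gt1] := hit T'.
pose a := Num.min t1 t2; pose b := Num.max t1 t2.
have T'a : T' < a by rewrite lt_min T't1.
have /compact_near_coveringP/near_covering_withinP cov := @segment_compact R a b.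
have [|e /= e0 eP] := cov R (0^'+ : set_system R)
  (fun e t => 0 < e -> forall y, c < y -> y < c + e -> ~ V t y) _.
  move=> t /=; rewrite in_itv /= => /andP[at_ _].
  have [|e [e0 et]] := goodT t; first lra.
  exists ([set t' | `|t' - t| < e], [set e' | e' < e]) => /=.
    split; last by apply: nbhs_right_lt.
    by apply/nbhs_ballP; exists e => //= t'; rewrite /ball /= distrC.
  move=> [t' e'] /= [t't e'e] _ e'0 y cy ye; apply: (et t') => //; lra.
have ce y : c < y -> y < c + e / 2 -> forall t, a <= t <= b -> ~ V t y.
  move=> cy ye t tI; apply: (eP (e / 2) _ _ t _ _ y) => //.
  - by rewrite /ball /= sub0r normrN gtr0_norm; lra.
  - lra.
  - lra.
apply: contrapT => gt2.
have ct2 : c < g t2.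
  by rewrite lt_neqAle cg ?andbT; [apply/eqP => h; apply: gt2|lra].
pose v := Num.min (c + e / 4) (g t2).
have [cv ve vg] : [/\ c < v, v < c + e / 2 & v <= g t2].
  rewrite /v; split; first by rewrite lt_min ct2 andbT; lra.
    by rewrite gt_min; apply/orP; left; lra.
  by rewrite ge_min lexx orbT.
have [|||s] := @IVT R g a b v.
- by rewrite ge_min le_max !lexx.
- apply: continuous_in_subspaceT => t; rewrite inE /= in_itv /= => /andP[at_ _].
  by apply: gc; lra.
- rewrite /a /b; have [t12|t21] := leP t1 t2; rewrite gt1 ge_min le_max vg (ltW cv) ?orbT //.
rewrite in_itv /= => sI gsv; apply: (ce v cv ve s sI); rewrite -gsv; apply: gV.
by case/andP: sI => ? _; lra.
Qed.

End Selections.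

Section Minimizers.
Context {R : realType}.
Variables (n : nat) (f : 'rV[R]_n -> \bar R) (S : set 'rV[R]_n).
Hypothesis f_proper : forall x, f x != -oo%E.
Hypothesis f_lsc : lower_semicontinuous f.
Hypothesis f_semialg : semialgebraic_efun f.
Hypothesis S_closed : closed S.
Hypothesis S_semialg : semialgebraic S.
Hypothesis QC : qualification f S.

Lemma qualification_normal y al v w : S y -> f y = al%:E ->
  approx_normal (epi f) (rV_pair y al) (rV_pair v 0) -> approx_normal S y w ->
  v + w = 0 -> w = 0.
Proof.
move=> Sy fy Nv Nw vw.
have ve : v = - w by apply/eqP; rewrite -subr_eq0 opprK vw.
have : (horizon_subdiff f y `&` [set - w | w in limiting_normal S y]) v.
  split; first by rewrite /horizon_subdiff /= fy; exact: approx_limiting.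
  by exists w => //; apply: approx_limiting.
rewrite QC; last by split=> //; rewrite /edom /= fy ltry.
by rewrite /= ve => /eqP; rewrite oppr_eq0 => /eqP.
Qed.

Lemma minimizer_critical x al : S x -> f x = al%:E ->
  (forall y, S y -> (f x <= f y)%E) -> critical f S x.
Proof.
move=> Sx fx xmin.
have [|y Sy _||v [w [mu [Nv Nw mu0 eq0]]]] := @multiplier_rule _ _ f S f_proper f_lsc S_closed x al 0 0 Sx fx.
- by rewrite mul0r.
- by rewrite -fx; apply: xmin.
- move=> v w mu Nv Nw mu0; rewrite (mu0 erefl) scale0r addr0 => vw; split=> //.
  exact: qualification_normal Sx fx Nv Nw vw.
split; first by split=> //; rewrite /edom /= fx ltry.
exists v, w; split.
- by rewrite /subdiff /= fx; apply: approx_limiting.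
- exact: approx_limiting.
- by rewrite -eq0 (mu0 erefl) scale0r addr0.
Qed.

Lemma sphere_minimizer_tangent : ev_pinfty (fun t => forall x al, S x ->
  f x = al%:E -> enorm x = t -> (forall y, S y -> enorm y = t -> (f x <= f y)%E) ->
  tangency f S x).
Proof.
have [T HT] := spheres_transverse f_proper f_semialg S_semialg.
exists (Num.max T 0) => t; rewrite gt_max => /andP[Tt t0] x al Sx fx xt xmin.
have dott z : dot z z = t ^+ 2 -> enorm z = t.
  by move=> zt; rewrite /enorm zt sqrtr_sqr gtr0_norm.
have [|y Sy yt||v [w [mu [Nv Nw mu0 eq0]]]] :=
    @multiplier_rule _ _ f S f_proper f_lsc S_closed x al 1 (t ^+ 2) Sx fx.
- by rewrite mul1r -enorm_sqr xt subrr.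
- rewrite -fx; apply: xmin => //; apply: dott.
  by apply/eqP; rewrite -subr_eq0; apply/eqP; rewrite -yt mul1r.
- move=> v w mu Nv Nw _ vw.
  have m0 : mu = 0.
    by apply: (HT t Tt x al v w mu _ xt); split=> //; rewrite oppr0.
  split=> //; apply: (qualification_normal Sx fx Nv Nw).
  by move: vw; rewrite m0 scale0r addr0.
split; first by split=> //; rewrite /edom /= fx ltry.
exists mu, v, w; split=> //.
- by rewrite /subdiff /= fx; apply: approx_limiting.
- exact: approx_limiting.
Qed.

Lemma finite_value x : edom f x -> exists al, f x = al%:E.
Proof.
by rewrite /edom /=; have := f_proper x; case: (f x) => // al _ _; exists al.
Qed.

Lemma tangency_tangent_at x al : tangency f S x -> f x = al%:E ->
  exists v w mu, tangent_at f S 1 x al v w mu.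
Proof.
move=> [[_ Sx] [mu [v [w [Nv Nw eq0]]]]] fx; exists v, w, mu; split=> //.
- by move: Nv; rewrite /subdiff /= fx => /limiting_approx.
- exact: limiting_approx.
Qed.

Lemma critical_tangent_at x al : critical f S x -> f x = al%:E ->
  exists v w, tangent_at f S 1 x al v w 0.
Proof.
move=> [[_ Sx] [v [w [Nv Nw eq0]]]] fx; exists v, w; split=> //.
- by move: Nv; rewrite /subdiff /= fx => /limiting_approx.
- exact: limiting_approx.
- by rewrite scale0r addr0.
Qed.

Lemma critical_tangency x : critical f S x -> tangency f S x.
Proof.
move=> [xS [v [w [Nv Nw eq0]]]]; split=> //; exists 0, v, w; split=> //.
by rewrite scale0r addr0.
Qed.

Lemma closed_sublevel (a : R) : closed [set x | S x /\ (f x <= a%:E)%E].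
Proof.
have -> : [set x | S x /\ (f x <= a%:E)%E] = S `&` ~` [set x | (f x > a%:E)%E].
  by apply/seteqP; split=> x /= [Sx fa]; split=> //; [apply/negP; rewrite -leNgt|rewrite leNgt; apply/negP].
by apply: closedI => //; apply: open_closedC; have /lower_semicontinuousP := f_lsc; exact.
Qed.

Lemma enorm_bounded_compact (A : set 'rV[R]_n) M : closed A ->
  (forall x, A x -> enorm x <= M) -> compact A.
Proof.
move=> cA AM; apply: (subclosed_compact cA (rV_compact (fun i => @segment_compact R (- M) M))).
move=> x /AM xM i; rewrite /= in_itv /= -ler_norml.
exact: le_trans (coord_le_enorm _ _) xM.
Qed.

Lemma compact_enorm_bounded (A : set 'rV[R]_n) : compact A ->
  exists M, forall x, A x -> enorm x <= M.
Proof.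
move=> /compact_bounded[B [_ HB]]; exists ((B + 1) *+ n) => x Ax.
have xB : `|x| <= B + 1 by apply: (HB (B + 1)) => //; rewrite ltrDl.
apply: le_trans (enorm_le_sum _) _; rewrite -[X in _ *+ X]card_ord -sumr_const.
apply: ler_sum => i _; apply: le_trans xB; rewrite [X in _ <= X]mx_normrE.
by apply: le_trans (le_bigmax_cond _ _ (j := (0, i)) _).
Qed.

Lemma closed_esphere t : closed (@esphere R n t).
Proof.
have [t0|t0] := leP 0 t; last first.
  have -> : @esphere R n t = set0; last exact: closed0.
  by apply/seteqP; split=> x //= xt; have := enorm_ge0 x; rewrite xt leNgt t0.
have -> : @esphere R n t = (fun x => dot x x) @^-1` [set t ^+ 2].
  apply/seteqP; split=> x /=; first by move=> <-; rewrite enorm_sqr.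
  by rewrite /esphere /= /enorm => ->; rewrite sqrtr_sqr ger0_norm.
apply: closed_comp; last exact: closed_eq.
by move=> x _; apply: (@cvg_dot R n _ (nbhs x) _ id id x x); apply: cvg_id.
Qed.

Lemma sphere_minimum_attained x : S x -> exists y, [/\ S y, enorm y = enorm x,
  (f y <= f x)%E & forall z, S z -> enorm z = enorm x -> (f y <= f z)%E].
Proof.
move=> Sx; have [|||y [Sy yx] ymin] := @compact_lsc_min R _ (S `&` esphere (enorm x)) f.
- apply: (@enorm_bounded_compact _ (enorm x)).
    by apply: closedI => //; apply: closed_esphere.
  by move=> y [_ /= ->].
- by exists x.
- by move=> y a _ /f_lsc[V yV Vf]; apply: filterS yV.
exists y; split=> //; first by apply: ymin.
by move=> z Sz zx; apply: ymin.
Qed.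

End Minimizers.

(** * The pieces of the tangency variety at infinity *)

Section Pieces.
Context {R : realType}.

Lemma lt_finite_ereal_inf (I : finType) (A : set I) (u : I -> \bar R) (c : \bar R) :
  (c < +oo)%E -> (forall i, A i -> (c < u i)%E) -> (c < ereal_inf (u @` A))%E.
Proof.
move=> c0 cu; pose m := (\big[Order.min/+oo]_(i | `[< A i >]) u i)%E.
apply: (@lt_le_trans _ _ m).
  apply: (big_ind (fun x => c < x)%E) => // [x y cx cy|i /asboolP /cu //].
  by rewrite lt_min cx.
apply: le_ereal_inf_tmp => _ [i Ai <-].
by apply: bigmin_le_cond; apply/asboolP.
Qed.

Lemma pigeonhole_unbounded p (P : 'I_p -> R -> Prop) :
  (forall T, exists2 t, T < t & exists k, P k t) ->
  exists k, forall T, exists2 t, T < t & P k t.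
Proof.
move=> h; apply: contrapT => nk.
have bnd k : exists T, forall t, T < t -> ~ P k t.
  apply: contrapT => nT; apply: nk; exists k => T; apply: contrapT => nt.
  by apply: nT; exists T => t Tt Pt; apply: nt; exists t.
have [T TP] := choice bnd.
have [t tT [k Pkt]] := h (\big[Num.max/0]_k T k).
by apply: (TP k t) => //; apply: le_lt_trans tT; apply: le_bigmax.
Qed.

Variables (n : nat) (f : 'rV[R]_n -> \bar R) (S : set 'rV[R]_n).
Hypothesis f_proper : forall x, f x != -oo%E.
Hypothesis f_semialg : semialgebraic_efun f.
Hypothesis S_semialg : semialgebraic S.

Definition tangent_values t y :=
  exists x v w mu, tangent_at f S 1 x y v w mu /\ enorm x = t.

Lemma definable_tangent_values :
  definable (fun p : R * R => tangent_values p.1 p.2).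
Proof.
by rewrite /tangent_values; definability_with ltac:(apply: definable_tangent_at).
Qed.

Lemma tangent_values_thin t a b : a < b -> ~ on_itv a b (tangent_values t).
Proof. exact: sphere_values_no_itv. Qed.

Lemma tangency_value x : tangency f S x ->
  exists2 y, f x = y%:E & tangent_values (enorm x) y.
Proof.
move=> tx; have [[dx _] _] := tx; have [y fx] := finite_value f_proper dx.
exists y => //; have [v [w [mu h]]] := tangency_tangent_at tx fx.
by exists x, v, w, mu.
Qed.

Variables (l : nat) (C : 'I_l -> set 'rV[R]_n).
Hypothesis C_continuous : forall i, {within C i, continuous f}.
Variables (m : nat) (F : 'I_l -> set 'rV[R]_m) (r0 : R).
Variable h : 'rV[R]_m * R -> 'rV[R]_n.
Hypothesis h_triv : norm_trivialization (tangency f S) C F r0 h.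

Let A := (\bigcup_i F i) `*` `]r0, +oo[%classic.

Let in_A i y t : F i y -> r0 < t -> A (y, t).
Proof. by move=> Fy t0; split; [exists i|rewrite /= in_itv /= t0]. Qed.

Let h_tangency y t : A (y, t) -> tangency f S (h (y, t)).
Proof. by move=> Ayt; have [hA _ _] := triv_bij h_triv; case: (hA _ Ayt). Qed.

Let h_enorm i y t : F i y -> r0 < t -> enorm (h (y, t)) = t.
Proof. by move=> Fy t0; apply: (triv_norm h_triv) => //; exists i. Qed.

Let h_piece i y t : F i y -> r0 < t -> C i (h (y, t)).
Proof.
move=> Fy t0; have : (h @` (F i `*` `]r0, +oo[%classic)) (h (y, t)).
  by exists (y, t) => //; split=> //=; rewrite in_itv /= t0.
by rewrite (triv_pieces h_triv) => -[].
Qed.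

(** A path inside one piece is seen by [h] within its domain and by [f] within
    [C i], the only sets on which they are known to be continuous. *)
Let cvg_value i (T : topologicalType) (D : set T) (ph : T -> 'rV[R]_m * R) s :
  D s -> (forall s', D s' -> F i (ph s').1 /\ r0 < (ph s').2) ->
  ph s' @[s' --> within D (nbhs s)] --> ph s ->
  fine (f (h (ph s'))) @[s' --> within D (nbhs s)] --> fine (f (h (ph s))).
Proof.
move=> Ds phD phc.
have inA s' : D s' -> A (ph s').
  by move=> /phD[]; case: (ph s') => y t; apply: in_A.
have phA : ph s' @[s' --> within D (nbhs s)] --> within A (nbhs (ph s)).
  move=> V; rewrite /within /= => nV.
  have := phc _ nV; rewrite /nbhs /= /within /=; apply: filterS => s' H Ds'.
  by apply: H => //; apply: inA.
have hc : h (ph s') @[s' --> within D (nbhs s)] --> h (ph s).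
  have /subspace_continuousP hcont := triv_continuous h_triv.
  by apply: cvg_comp phA _; apply: hcont; apply: inA.
have hC : h (ph s') @[s' --> within D (nbhs s)] --> within (C i) (nbhs (h (ph s))).
  move=> V; rewrite /within /= => nV.
  have := hc _ nV; rewrite /nbhs /= /within /=; apply: filterS => s' H Ds'.
  apply: H => //; have [Fs ts] := phD s' Ds'.
  by move: Fs ts; case: (ph s') => y t; apply: h_piece.
have fc : f (h (ph s')) @[s' --> within D (nbhs s)] --> f (h (ph s)).
  have /subspace_continuousP fcont := C_continuous (i := i).
  apply: cvg_comp hC _; apply: fcont.
  by have [Fs ts] := phD s Ds; move: Fs ts; case: (ph s) => y t; apply: h_piece.
apply: fine_cvg; rewrite fineK //.
have : tangency f S (h (ph s)).
  by have := inA s Ds; case: (ph s) => y t; apply: h_tangency.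
by move=> /tangency_value[y -> _].
Qed.

Lemma continuous_along_ray i x0 t : F i x0 -> r0 < t ->
  {for t, continuous (fun s => fine (f (h (x0, s))))}.
Proof.
move=> Fx t0.
have := @cvg_value i R (`]r0, +oo[%classic) (fun s => (x0, s)) t.
have tI : `]r0, +oo[%classic t by rewrite /= in_itv /= t0.
move=> /(_ tI) H; rewrite /prop_for /continuous_at.
have -> : nbhs t = within `]r0, +oo[%classic (nbhs t).
  apply/seteqP; split=> V nV; first by apply: filterS nV => s Vs _.
  have ot : nbhs t (`]r0, +oo[%classic : set R) by apply: open_nbhs_nbhs; split=> //; apply: interval_open.
  by apply: filterS2 ot nV => s Is; apply.
apply: H => [s /=|]; first by rewrite in_itv /= andbT.
by apply: (@cvg_pair _ _ _ _ (nbhs x0) (nbhs t) _ _ _ (fun=> x0) id); [exact: cvg_cst|exact: cvg_within].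
Qed.

(** The values of [f] on this connected set form an interval, and they are
    tangency values on a sphere. *)
Lemma constant_on_component i (D : set 'rV[R]_m) t x y : connected D ->
  D `<=` F i -> r0 < t -> D x -> D y -> f (h (x, t)) = f (h (y, t)).
Proof.
move=> cD DF t0 Dx Dy.
have tv z : D z -> exists2 b, f (h (z, t)) = b%:E & tangent_values t b.
  move=> /DF Fz; have [b fb] := tangency_value (h_tangency (in_A Fz t0)).
  by rewrite (h_enorm Fz t0) => bt; exists b.
have cimg : connected ((fun z => fine (f (h (z, t)))) @` D).
  apply: connected_continuous_connected => //; apply/subspace_continuousP => z Dz.
  apply: (@cvg_value i _ D (fun s => (s, t)) z) => //.
    by move=> s /DF Fs.
  by apply: (@cvg_pair _ _ _ _ (nbhs z) (nbhs t) _ _ _ id (fun=> t)); [exact: cvg_within|exact: cvg_cst].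
move: cimg => /connected_intervalP img.
have [a fx _] := tv x Dx; have [b fy _] := tv y Dy.
wlog ab : x y a b Dx Dy fx fy / a <= b => [H|].
  have /orP[ab|ba] := le_total a b; first exact: (H x y a b).
  by apply/esym; exact: (H y x b a).
rewrite fx fy; congr EFin; apply/eqP; rewrite eq_le ab /= leNgt; apply/negP => lt.
apply: (tangent_values_thin (t := t) lt) => c cI.
have [|||z Dz zc] := img a b _ _ c.
- by exists x => //; rewrite fx.
- by exists y => //; rewrite fy.
- by case/andP: cI => ? ?; apply/andP; split; apply: ltW.
by have [c' fz c't] := tv z Dz; move: zc; rewrite fz /= => <-.
Qed.

Lemma ray_values i x0 t : F i x0 -> r0 < t ->
  f (h (x0, t)) = (fine (f (h (x0, t))))%:E /\
  tangent_values t (fine (f (h (x0, t)))).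
Proof.
move=> Fx t0; have [y fy] := tangency_value (h_tangency (in_A Fx t0)).
by rewrite (h_enorm Fx t0) fy.
Qed.

Lemma component_sphere_value i x0 r t : F i x0 -> r0 <= r -> r < t ->
  sphere_value f (Gamma_k h (connected_component (F i) x0) r) t = f (h (x0, t)).
Proof.
move=> Fx rr rt; have t0 := le_lt_trans rr rt.
have nonempty : (Gamma_k h (connected_component (F i) x0) r `&` @esphere R n t) (h (x0, t)).
  split; last exact: h_enorm Fx t0.
  exists (x0, t) => //; split=> /=; first exact: connected_component_refl.
  by rewrite in_itv /= rt.
rewrite /sphere_value; case: (getPex (ex_intro _ _ nonempty)) => -[[y s] [/= Dy]].
rewrite in_itv /= andbT => rs <-; have Fy := connected_component_sub Dy.
rewrite /esphere /= (h_enorm Fy (le_lt_trans rr rs)) => ->.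
have cD : connected (connected_component (F i) x0) by exact: component_connected.
have Dx : connected_component (F i) x0 x0 by exact: connected_component_refl.
exact: (constant_on_component cD (@connected_component_sub _ _ _) t0 Dy Dx).
Qed.

End Pieces.

(** * The theorem *)

Theorem theorem4p5 (R : realType) (n : nat)
    (f : 'rV[R]_n -> \bar R) (S : set 'rV[R]_n)
    (f_proper : forall x, f x != -oo%E)
    (f_lsc : lower_semicontinuous f)
    (f_semialg : semialgebraic_efun f)
    (S_closed : closed S)
    (S_semialg : semialgebraic S)
    (domS_nonempty : edom f `&` S !=set0)
    (domS_unbounded : ~ bounded_set (edom f `&` S))
    (QC : qualification f S)
    (l : nat) (C : 'I_l -> set 'rV[R]_n)
    (C_partition : partition setT C (tangency f S))
    (C_semialg : forall i, semialgebraic (C i))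
    (C_continuous : forall i, {within C i, continuous f})
    (m : nat) (F : 'I_l -> set 'rV[R]_m) (r0 : R)
    (h : 'rV[R]_m * R -> 'rV[R]_n)
    (r0_gt0 : 0 < r0)
    (h_triv : norm_trivialization (tangency f S) C F r0 h)
    (p : nat) (F' : 'I_p -> set 'rV[R]_m)
    (F'_components : set_bij setT (components F) F') :
  \forall r \near +oo,
    let Gamma k := Gamma_k h (F' k) r in
    let fk k := sphere_value f (Gamma k) in
    let lambda k := limit_value f (Gamma k) in
    let K := [set k | ~ constant_beyond (fk k) r] in
    (solutions f S !=set0 /\ compact (solutions f S)) <->
    [/\ critical f S !=set0,
        (ereal_inf (f @` critical f S) <= ereal_inf (lambda @` K))%E &
        (ereal_inf (f @` critical f S) < ereal_inf (lambda @` (~` K)))%E].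
Proof.
pose Tv := tangent_values f S.
have dTv := definable_tangent_values f_proper f_semialg S_semialg.
have thin t a b : a < b -> ~ on_itv a b (Tv t).
  exact: tangent_values_thin.
(* The value of f on the k-th piece is followed along the ray through a point
   of F' k; g k is the real-valued version of f_k. *)
have base k : exists p : 'I_l * 'rV[R]_m,
    F p.1 p.2 /\ F' k = connected_component (F p.1) p.2.
  have [FF _ _] := F'_components; have [i [x [Fx ->]]] := FF k I.
  by exists (i, x).
have [b0 b0P] := choice base.
have Fb k : F (b0 k).1 (b0 k).2 by case: (b0P k).
pose ray k t := h ((b0 k).2, t).
pose g k t := fine (f (ray k t)).
have gE k t : r0 < t -> f (ray k t) = (g k t)%:E.
  by move=> t0; have [] := ray_values f_proper h_triv (Fb k) t0.
have gV k t : r0 < t -> Tv t (g k t).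
  by move=> t0; have [] := ray_values f_proper h_triv (Fb k) t0.
have gc k t : r0 < t -> {for t, continuous (g k)}.
  move=> t0; exact: (continuous_along_ray f_proper C_continuous h_triv (Fb k) t0).
have ray_tan k t : r0 < t -> tangency f S (ray k t).
  move=> t0; have [hA _ _] := triv_bij h_triv.
  have [] // := hA ((b0 k).2, t); split; first by exists (b0 k).1.
  by rewrite /= in_itv /= t0.
have ray_norm k t : r0 < t -> enorm (ray k t) = t.
  by move=> t0; apply: (triv_norm h_triv) => //; exists (b0 k).1.
have hL k : exists lk : \bar R, (g k t)%:E @[t --> +oo] --> lk.
  exact: (selection_limit dTv thin (gc k) (gV k)).
have [L gL] := choice hL.
have [Tm HTm] := sphere_minimizer_tangent f_proper f_lsc f_semialg S_closed S_semialg QC.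
(* Beyond M, a function g k that is eventually constant is already constant,
   so that K does not change any more. *)
have stab : exists M, forall r, M < r -> forall k c, ev_pinfty (fun t => g k t = c) ->
    forall t, r < t -> g k t = c.
  have bk k : exists T, forall c, ev_pinfty (fun t => g k t = c) ->
      forall t, T < t -> g k t = c.
    have [[c [T Tc]]|nc] := pselect (exists c, ev_pinfty (fun t => g k t = c)).
      exists T => c' [T' Tc'] t Tt; rewrite Tc //.
      pose s := Num.max T T' + 1.
      have [Ts Ts'] : T < s /\ T' < s.
        have : T <= Num.max T T' by rewrite le_max lexx.
        have : T' <= Num.max T T' by rewrite le_max lexx orbT.
        by rewrite /s; split; lra.
      by rewrite -(Tc s Ts) (Tc' s Ts').
    by exists 0 => c gc' ; exfalso; apply: nc; exists c.
  have [T TP] := choice bk.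
  exists (\big[Num.max/0]_k T k) => r Tr k c gkc t rt; apply: (TP k c gkc).
  by apply: le_lt_trans rt; apply/ltW; apply: le_lt_trans Tr; apply: le_bigmax.
have [M HM] := stab.
exists (Num.max r0 (Num.max Tm M)); split; first by rewrite num_real.
move=> r; rewrite !gt_max => /and3P[r0r Tmr Mr].
pose Gamma k := Gamma_k h (F' k) r; pose fk k := sphere_value f (Gamma k).
pose lambda k := limit_value f (Gamma k).
pose K := [set k | ~ constant_beyond (fk k) r].
change ((solutions f S !=set0 /\ compact (solutions f S)) <->
    [/\ critical f S !=set0,
        (ereal_inf (f @` critical f S) <= ereal_inf (lambda @` K))%E &
        (ereal_inf (f @` critical f S) < ereal_inf (lambda @` (~` K)))%E]).
have fkE k t : r < t -> fk k t = (g k t)%:E.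
  move=> rt; rewrite /fk /Gamma; have [_ ->] := b0P k.
  rewrite (component_sphere_value f_proper f_semialg S_semialg C_continuous h_triv (Fb k) (ltW r0r) rt).
  by apply: gE; apply: lt_trans rt.
have fkL k : fk k t @[t --> +oo] --> L k.
  apply: cvg_trans (gL k); apply: near_eq_cvg.
  by exists r; split; [rewrite num_real|move=> t /fkE].
have lamE k : lambda k = L k by rewrite /lambda /limit_value; apply: cvg_lim (fkL k).
have notK k c : ev_pinfty (fun t => g k t = c) -> (~` K) k.
  move=> gkc; rewrite /K /=; apply; exists c%:E => t rt.
  by rewrite fkE // (HM r Mr k c gkc).
have tan_piece x : tangency f S x -> r < enorm x -> exists k, f x = (g k (enorm x))%:E.
  move=> tx rx; have [_ _ hsurj] := triv_bij h_triv.
  have [|[y t] [[i _ Fy]] /=] := hsurj x.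
    by split=> //; apply/negP; rewrite /= -ltNge; apply: lt_trans rx.
  rewrite in_itv /= andbT => t0 hx.
  have [_ _ F'surj] := F'_components.
  have [|k _ F'k] := F'surj (connected_component (F i) y); first by exists i, y.
  have xt : enorm x = t by rewrite -hx (triv_norm h_triv) //; exists i.
  exists k; rewrite -fkE // /fk /Gamma F'k xt.
  rewrite (component_sphere_value f_proper f_semialg S_semialg C_continuous h_triv Fy (ltW r0r)) -?xt //.
  by rewrite xt hx.
pose phi := ereal_inf (f @` S).
have phi_le x : S x -> (phi <= f x)%E by move=> Sx; apply: ereal_inf_lbound; exists x.
have phi_lty : (phi < +oo)%E.
  have [x [dx Sx]] := domS_nonempty; exact: le_lt_trans (phi_le x Sx) dx.
have ray_S k t : r0 < t -> S (ray k t) by move=> /(ray_tan k)[[]].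
have crit_le : (phi <= ereal_inf (f @` critical f S))%E.
  by apply: le_ereal_inf_tmp => _ [x [[_ Sx] _] <-]; apply: phi_le.
have phi_real x : S x -> f x = phi -> exists c, phi = c%:E.
  move=> Sx fx; have [c fxc] : exists c, f x = c%:E.
    by apply: (finite_value f_proper); rewrite /edom /= fx.
  by exists c; rewrite -fx.
have sol_crit x : solutions f S x -> critical f S x.
  move=> [Sx fx]; have [c fc] := phi_real x Sx fx.
  apply: (minimizer_critical f_proper f_lsc S_closed QC (al := c)) => //.
    by rewrite fx -/phi fc.
  by move=> y Sy; rewrite fx; apply: phi_le.
split.
- move=> [[xs [Sxs fxs]] compact_sol].
  have [c phic] := phi_real xs Sxs fxs.
  have cxs : critical f S xs by apply: sol_crit.
  have crit_eq : ereal_inf (f @` critical f S) = phi.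
    apply/eqP; rewrite eq_le crit_le andbT -[X in (_ <= X)%E]fxs.
    by apply: ereal_inf_lbound; exists xs.
  have phi_lam k : (phi <= lambda k)%E.
    rewrite lamE; apply: cvge_ge (gL k).
    exists r; split; first by rewrite num_real.
    by move=> t rt; have t0 := lt_trans r0r rt; rewrite -gE //; apply/phi_le/ray_S.
  split; first by exists xs.
    by rewrite crit_eq; apply: le_ereal_inf_tmp => _ [k _ <-].
  rewrite crit_eq; apply: lt_finite_ereal_inf => // k; rewrite /K /setC /= => /contrapT[c' fkc].
  rewrite lt_neqAle phi_lam andbT; apply/eqP => phil.
  have lamc : lambda k = c'.
    rewrite lamE; apply: (cvg_unique (@ereal_hausdorff R) (fkL k)).
    have near_c : \forall t \near +oo, fk k t = c'.
      by exists r; split; [rewrite num_real|move=> t /fkc].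
    exact: cvg_near_cst near_c.
  have [B HB] := compact_enorm_bounded compact_sol.
  pose t := Num.max r B + 1.
  have [rt Bt] : r < t /\ B < t.
    have : r <= Num.max r B by rewrite le_max lexx.
    have : B <= Num.max r B by rewrite le_max lexx orbT.
    by rewrite /t; split; lra.
  have t0 := lt_trans r0r rt.
  have : solutions f S (ray k t).
    split; first exact: ray_S.
    by rewrite gE // -fkE // fkc // -lamc -phil.
  by move=> /HB; rewrite ray_norm // leNgt Bt.
- move=> [[xc0 cxc0] leK ltK].
  pose sigma := ereal_inf (f @` critical f S).
  have sigma_lam k : (sigma <= lambda k)%E.
    have [Kk|nKk] := pselect (K k).
      by apply: le_trans leK _; apply: ereal_inf_lbound; exists k.
    by apply/ltW; apply: lt_le_trans ltK _; apply: ereal_inf_lbound; exists k.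
  (* finitely many critical values, so the least one is attained *)
  have [xc [cxc fxc]] : exists xc, critical f S xc /\ f xc = sigma.
    have [s sP] := critical_values_finite f_proper f_semialg S_semialg.
    have cs x : critical f S x -> exists2 a, f x = a%:E & a \in s.
      move=> cx; have [[dx _] _] := cx; have [a fx] := finite_value f_proper dx.
      exists a => //; apply: sP; have [v [w h']] := critical_tangent_at cx fx.
      by exists x, v, w.
    have [a0 fx0 a0s] := cs _ cxc0.
    have [|a [_ [x cx fx] amin]] := @seq_min R (fun a => exists2 x, critical f S x & f x = a%:E) s.
      by exists a0 => //; exists xc0.
    exists x; split=> //; apply/eqP; rewrite eq_le; apply/andP; split; last first.
      by apply: ereal_inf_lbound; exists x.
    apply: le_ereal_inf_tmp => _ [y cy <-]; have [b fy bs] := cs y cy.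
    by rewrite fx fy lee_fin; apply: amin => //; exists y.
  have [[_ Sxc] _] := cxc.
  have sol_nonempty : solutions f S !=set0.
    have [phi_sigma|phi_sigma] := eqVneq phi sigma.
      by exists xc; split=> //; rewrite fxc -phi_sigma.
    have {phi_sigma} lt_sigma : (phi < sigma)%E by rewrite lt_neqAle phi_sigma.
    have [a [phia asigma]] := ereal_between lt_sigma.
    have [_ [x1 Sx1 <-] fx1] := ereal_inf_lt phia.
    pose Sa := [set x | S x /\ (f x <= a%:E)%E].
    have cSa : closed Sa by apply: closed_sublevel.
    have [B HB] : exists B, forall x, Sa x -> enorm x <= B.
      apply: contrapT => unb.
      have [k kP] : exists k, forall T, exists2 t, T < t & r < t /\ g k t <= a.
        apply: pigeonhole_unbounded => T.
        have [x [Sx fxa] Tx] : exists2 x, Sa x & Num.max T r < enorm x.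
          apply: contrapT => nx; apply: unb; exists (Num.max T r) => x Sax.
          by rewrite leNgt; apply/negP => Tx; apply: nx; exists x.
        move: Tx; rewrite gt_max => /andP[Tx rx].
        have [y [Sy yx fyx ymin]] := sphere_minimum_attained f_lsc S_closed Sx.
        have [al fy] : exists al, f y = al%:E.
          apply: (finite_value f_proper); rewrite /edom /=.
          by apply: le_lt_trans fyx _; apply: le_lt_trans fxa (ltry _).
        have ty : tangency f S y by apply: (HTm (enorm x) (lt_trans Tmr rx) y al).
        have [|k fyk] := tan_piece y ty; first by rewrite yx.
        exists (enorm x) => //; exists k; split=> //.
        by rewrite -lee_fin -yx -fyk; apply: le_trans fxa.
      suff : (sigma <= a%:E)%E by rewrite leNgt asigma.
      apply: le_trans (sigma_lam k) _; rewrite lamE leNgt; apply/negP => aL.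
      have [b [ab bL]] := ereal_between aL.
      have [T [_ HT]] : \forall t \near +oo, (b%:E < (g k t)%:E)%E.
        apply: (gL k [set z | (b%:E < z)%E]); apply: open_nbhs_nbhs.
        by split=> //; exact: open_ereal_gt_ereal.
      have [t Tt [_ gta]] := kP T.
      by have := HT t Tt; rewrite lte_fin ltNge (le_trans gta) // ltW // -lte_fin.
    have compSa : compact Sa by apply: enorm_bounded_compact HB.
    have [||x [Sx fxa] xmin] := @compact_lsc_min R _ Sa f compSa.
    - by exists x1; split=> //; apply: ltW.
    - by move=> x b _ /f_lsc[V xV Vf]; apply: filterS xV.
    exists x; split=> //; apply/eqP; rewrite eq_le phi_le // andbT.
    apply: le_ereal_inf_tmp => _ [y Sy <-].
    have [ya|ay] := leP (f y) a%:E; first by apply: xmin.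
    exact: le_trans fxa (ltW ay).
  split=> //; have [xs [Sxs fxs]] := sol_nonempty.
  have [c phic] := phi_real xs Sxs fxs.
  have phi_sigma : phi = sigma.
    apply/eqP; rewrite eq_le crit_le /= (_ : phi = f xs) //.
    by apply: ereal_inf_lbound; exists xs => //; apply: sol_crit.
  have solE : solutions f S = [set x | S x /\ (f x <= c%:E)%E].
    apply/seteqP; split=> x [Sx fx]; split=> //; first by rewrite fx -/phi phic.
    by apply/eqP; rewrite eq_le phi_le // andbT -/phi phic.
  have [B HB] : exists B, forall x, solutions f S x -> enorm x <= B.
    apply: contrapT => unb.
    have [k kP] : exists k, forall T, exists2 t, T < t & r < t /\ g k t = c.
      apply: pigeonhole_unbounded => T.
      have [x solx Tx] : exists2 x, solutions f S x & Num.max T r < enorm x.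
        apply: contrapT => nx; apply: unb; exists (Num.max T r) => x Sax.
        by rewrite leNgt; apply/negP => Tx; apply: nx; exists x.
      move: Tx; rewrite gt_max => /andP[Tx rx].
      have tx : tangency f S x by apply/critical_tangency/sol_crit.
      have [k fxk] := tan_piece x tx rx.
      exists (enorm x) => //; exists k; split=> //.
      by apply: EFin_inj; rewrite -fxk; case: solx => _ ->; rewrite -/phi.
    have gkc : ev_pinfty (fun t => g k t = c).
      apply: (selection_ev_eq dTv thin (gc k) (gV k)).
        by move=> t t0; rewrite -lee_fin -phic -gE //; apply/phi_le/ray_S.
      by move=> T; have [t Tt [_ gt]] := kP T; exists t.
    have : (sigma < lambda k)%E.
      by apply: lt_le_trans ltK _; apply: ereal_inf_lbound; exists k => //; apply: notK gkc.
    rewrite lamE -phi_sigma phic.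
    have -> : L k = c%:E; last by rewrite ltxx.
    apply: (cvg_unique (@ereal_hausdorff R) (gL k)).
    have near_c : \forall t \near +oo, (g k t)%:E = c%:E.
      have [T HT] := gkc; exists T; split; first by rewrite num_real.
      by move=> t /HT ->.
    exact: cvg_near_cst near_c.
  apply: enorm_bounded_compact HB; rewrite solE; exact: closed_sublevel.
Qed.
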